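(* Define the operator on symmetric functions $$H_3^{qt} = H_3^t + q\,(e_1 H_2^t - H_3^t) + q^2\,(e_1 \bar H_2^t - \bar H_3^t) + q^3\, \bar H_3^t = (1-q)\,(H_3^t - q^2 \bar H_3^t) + q\, e_1 (H_2^t + q\bar H_2^t).$$ Then for all integers $a,b\ge 0$, $$H_3^{qt}\, H_{(2^a1^b)}[X;q,t] = H_{(32^a1^b)}[X;q,t].$$
   Context: Work in the ring of symmetric functions in infinitely many variables $X=x_1,x_2,\dots$ with coefficients in $\mathbb{Q}(q,t)$; $p_\lambda, e_k, h_k, s_\lambda$ are the power sum, elementary, complete and Schur functions ($e_0=h_0=1$). Let $z_\lambda=\prod_i i^{m_i}m_i!$, where $m_i$ is the number of parts of $\lambda$ equal to $i$. Define scalar products by $\langle p_\lambda,p_\mu\rangle_{qt}=\delta_{\lambda\mu}z_\lambda\prod_k\frac{1-q^{\lambda_k}}{1-t^{\lambda_k}}$ and $\langle p_\lambda,p_\mu\rangle_{t}=\delta_{\lambda\mu}z_\lambda\prod_k\frac{1}{1-t^{\lambda_k}}$. For a cell $s$ of $\lambda$ (French notation, longest row at the bottom), $a_\lambda(s)$ is the number of cells of $\lambda$ strictly to the right of $s$ in its row and $l_\lambda(s)$ the number of cells strictly above $s$ in its column. The Macdonald integral forms $J_\lambda[X;q,t]$ are characterized by: $J_\lambda=\prod_{s\in\lambda}(1-q^{a_\lambda(s)}t^{l_\lambda(s)+1})\,s_\lambda+\sum_{\mu<\lambda}c_{\mu\lambda}(q,t)s_\mu$ (dominance order), and $\langle J_\lambda,J_\mu\rangle_{qt}=0$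 for $\lambda\ne\mu$. Set $K_{\lambda\mu}(q,t)=\langle J_\mu[X;q,t],s_\lambda\rangle_t$ and $H_\mu[X;q,t]=\sum_\lambda K_{\lambda\mu}(q,t)s_\lambda$. The partition $(2^a1^b)$ has $a$ parts equal to 2 and $b$ parts equal to 1, and $(32^a1^b)$ has in addition one part 3. For a symmetric function $f$, $f^\perp$ is the adjoint of multiplication by $f$ with respect to the Hall inner product (for which Schur functions are orthonormal). For an integer $m\geq 0$, $$H_m^t=\sum_{i,j\ge0}t^j(-1)^i\,h_{m+i+j}\,e_i^\perp h_j^\perp,$$ and $\bar H_m^t$ is the linear operator which on symmetric functions homogeneous of degree $n$ acts by $$\bar H_m^t=\sum_{i,j\ge0}t^{n-j}(-1)^i\,e_{m+i+j}\,h_i^\perp e_j^\perp.$$ A product such as $e_1H_2^t$ means: apply $H_2^t$, then multiply by $e_1$. *)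

(* Defs.v *)
From HB Require Import structures.
From mathcomp Require Import all_boot all_order all_algebra perm.
From mathcomp Require Import boolp classical_sets fsbigop.
From mathcomp Require Import mpoly.

Set Implicit Arguments.
Unset Strict Implicit.
Unset Printing Implicit Defensive.

Import GRing.Theory.
Local Open Scope ring_scope.

(* Symmetric functions are bounded-degree sequences (f_n) of symmetric        *)
(* polynomials in x_1, ..., x_n with f_(n+1)(x_1, ..., x_n, 0) = f_n          *)
(* (Macdonald's inverse limit in the category of graded rings).               *)

Definition mfam (R : comNzRingType) := forall n, {mpoly R[n]}.

Section MFam.
Variable R : comNzRingType.

HB.instance Definition _ := Choice.on (mfam R).

Definition mfam_zero : mfam R := fun=> 0.
Definition mfam_one : mfam R := fun=> 1.
Definition mfam_add (f g : mfam R) : mfam R := fun n => f n + g n.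
Definition mfam_opp (f : mfam R) : mfam R := fun n => - f n.
Definition mfam_mul (f g : mfam R) : mfam R := fun n => f n * g n.
Definition mfam_scale (c : R) (f : mfam R) : mfam R := fun n => c *: f n.

Lemma mfam_ext (f g : mfam R) : (forall n, f n = g n) -> f = g.
Proof. exact: functional_extensionality_dep. Qed.

Lemma mfam_addA : associative mfam_add.
Proof. by move=> f g h; apply: mfam_ext => n; exact: addrA. Qed.
Lemma mfam_addC : commutative mfam_add.
Proof. by move=> f g; apply: mfam_ext => n; exact: addrC. Qed.
Lemma mfam_add0 : left_id mfam_zero mfam_add.
Proof. by move=> f; apply: mfam_ext => n; exact: add0r. Qed.
Lemma mfam_addN : left_inverse mfam_zero mfam_opp mfam_add.
Proof. by move=> f; apply: mfam_ext => n; exact: addNr. Qed.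

HB.instance Definition _ := GRing.isZmodule.Build (mfam R)
  mfam_addA mfam_addC mfam_add0 mfam_addN.

Lemma mfam_mulA : associative mfam_mul.
Proof. by move=> f g h; apply: mfam_ext => n; exact: mulrA. Qed.
Lemma mfam_mulC : commutative mfam_mul.
Proof. by move=> f g; apply: mfam_ext => n; exact: mulrC. Qed.
Lemma mfam_mul1 : left_id mfam_one mfam_mul.
Proof. by move=> f; apply: mfam_ext => n; exact: mul1r. Qed.
Lemma mfam_mulDl : left_distributive mfam_mul +%R.
Proof. by move=> f g h; apply: mfam_ext => n; exact: mulrDl. Qed.
Lemma mfam_oner_neq0 : mfam_one != 0.
Proof.
by apply/eqP => /(congr1 (fun f : mfam R => f 0%N)) /eqP; apply/negP/oner_neq0.
Qed.

HB.instance Definition _ := GRing.Zmodule_isComNzRing.Build (mfam R)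
  mfam_mulA mfam_mulC mfam_mul1 mfam_mulDl mfam_oner_neq0.

Lemma mfam_scaleA c d f :
  mfam_scale c (mfam_scale d f) = mfam_scale (c * d) f.
Proof. by apply: mfam_ext => n; exact: scalerA. Qed.
Lemma mfam_scale1 : left_id 1 mfam_scale.
Proof. by move=> f; apply: mfam_ext => n; exact: scale1r. Qed.
Lemma mfam_scaleDr : right_distributive mfam_scale +%R.
Proof. by move=> c f g; apply: mfam_ext => n; exact: scalerDr. Qed.
Lemma mfam_scaleDl f : {morph mfam_scale^~ f : c d / c + d}.
Proof. by move=> c d; apply: mfam_ext => n; exact: scalerDl. Qed.

HB.instance Definition _ := GRing.Zmodule_isLmodule.Build R (mfam R)
  mfam_scaleA mfam_scale1 mfam_scaleDr mfam_scaleDl.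

Lemma mfam_scaleAl (c : R) (f g : mfam R) : c *: (f * g) = c *: f * g.
Proof. by apply: mfam_ext => n; exact: scalerAl. Qed.

HB.instance Definition _ := GRing.Lmodule_isLalgebra.Build R (mfam R)
  mfam_scaleAl.

End MFam.

Section SymFun.
Variable R : comNzRingType.

Definition restr n (p : {mpoly R[n.+1]}) : {mpoly R[n]} :=
  p \mPo [tuple oapp (fun j => 'X_j) 0 (unlift ord_max i) | i < n.+1].

HB.instance Definition _ n := GRing.RMorphism.copy (@restr n)
  (comp_mpoly [tuple oapp (fun j => 'X_j) 0 (unlift ord_max i) | i < n.+1]).
HB.instance Definition _ n := GRing.Linear.copy (@restr n)
  (comp_mpoly [tuple oapp (fun j => 'X_j) 0 (unlift ord_max i) | i < n.+1]).

Lemma mcoeff_restr n (p : {mpoly R[n.+1]}) (m : 'X_{1..n}) :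
  (restr p)@_m = p@_(mnmwiden m).
Proof.
rewrite [restr p]comp_mpolyEX [in RHS](mpolyE p) !raddf_sum /=.
apply: eq_bigr => m' _; rewrite !mcoeffZ; congr (_ * _).
rewrite comp_mpolyX mcoeffX big_ord_recr /= tnth_mktuple unlift_none /=.
pose m0 : 'X_{1..n} := [multinom m' (widen_ord (leqnSn n) i) | i < n].
have -> : \prod_(i < n) tnth [tuple oapp (fun j : 'I_n => 'X_j) (0 : {mpoly R[n]})
    (unlift ord_max i0) | i0 < n.+1] (widen_ord (leqnSn n) i) ^+
    m' (widen_ord (leqnSn n) i) = 'X_[m0].
  rewrite mpolyXE_id; apply: eq_bigr => i _; rewrite tnth_mktuple mnmE.
  have -> : widen_ord (leqnSn n) i = lift ord_max i.
    exact/val_inj/esym/lift_max.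
  by rewrite liftK.
rewrite expr0n; case: (eqVneq (m' ord_max) 0%N) => [m'0|m'n0]; last first.
  rewrite mulr0 mcoeff0; case: eqP => // eqm.
  by rewrite eqm mnmwiden_ordmax eqxx in m'n0.
rewrite mulr1 mcoeffX; congr (_%:R); congr (nat_of_bool _); apply/eqP/eqP => [<-|eqm].
  apply/mnmP => i; case: (unliftP ord_max i) => [j|] ->; last first.
    by rewrite mnmwiden_ordmax.
  have -> : lift ord_max j = widen_ord (leqnSn n) j.
    exact/val_inj/lift_max.
  by rewrite mnmwiden_widen mnmE.
by apply/mnmP => i; rewrite mnmE eqm mnmwiden_widen.
Qed.

Definition symfun_axiom (f : mfam R) : Prop :=
  [/\ forall n, f n \is symmetric,
      forall n, restr (f n.+1) = f n &
      exists d, forall n, (msize (f n) <= d)%N].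

Definition symfun_pred : pred (mfam R) := fun f => `[< symfun_axiom f >].

Lemma symfun_subalg : subalg_closed symfun_pred.
Proof.
split=> [|c f g /asboolP[sf cf [d df]] /asboolP[sg cg [e eg]]
        |f g /asboolP[sf cf [d df]] /asboolP[sg cg [e eg]]]; apply/asboolP.
- split=> [n|n|]; [|exact: rmorph1|].
    by rewrite [X in X \is _](_ : _ = 1) // rpred1.
  by exists 1%N => n; rewrite msize1.
- split=> [n|n|].
  + by rewrite [X in X \is _](_ : _ = c *: f n + g n) ?rpredD ?sg // rpredZ ?sf.
  + rewrite [RHS](_ : _ = c *: f n + g n) //.
    by rewrite -[in RHS]cf -[in RHS]cg; exact: linearP.
  + exists (maxn d e) => n; apply: leq_trans (msizeD_le _ _) _.
    rewrite geq_max !leq_max; apply/andP; split; last by rewrite eg orbT.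
    by apply/orP; left; exact: leq_trans (msizeZ_le _ _) (df n).
- split=> [n|n|].
  + rewrite [X in X \is _](_ : _ = f n * g n) //.
    by apply: rpredM; [exact: sf | exact: sg].
  + rewrite [RHS](_ : _ = f n * g n) //.
    by rewrite -[in RHS]cf -[in RHS]cg; exact: rmorphM.
  + exists (d + e).+1%N => n; have -> : (f * g) n = f n * g n by [].
    by rewrite (leq_trans (msizeM_le _ _)) // ltnS leq_add.
Qed.

HB.instance Definition _ :=
  GRing.isSubalgClosed.Build R (mfam R) symfun_pred symfun_subalg.

Record symfun := SymFun { sf_fam :> mfam R; _ : symfun_pred sf_fam }.

HB.instance Definition _ := [isSub for sf_fam].
HB.instance Definition _ := [Choice of symfun by <:].
HB.instance Definition _ := [SubChoice_isSubComNzRing of symfun by <:].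
HB.instance Definition _ := [SubZmodule_isSubLmodule of symfun by <:].
HB.instance Definition _ := [SubNzRing_SubLmodule_isSubLalgebra of symfun by <:].
HB.instance Definition _ := GRing.Lalgebra_isComAlgebra.Build R symfun.

Lemma msize_dhomog_le n d (p : {mpoly R[n]}) :
  p \is d.-homog -> (msize p <= d.+1)%N.
Proof.
by move/dhomogP => hp; rewrite msizeE; apply/bigmax_leqP_seq => m /hp ->.
Qed.

Lemma mdeg_mnmwiden n (m : 'X_{1..n}) : mdeg (mnmwiden m) = mdeg m.
Proof.
rewrite !mdegE big_ord_recr /= mnmwiden_ordmax addn0.
by apply: eq_bigr => i _; rewrite mnmwiden_widen.
Qed.

Lemma restr_mesym n k : restr (mesym n.+1 R k) = mesym n R k.
Proof.
apply/mpolyP => m; rewrite mcoeff_restr !mcoeff_mesym; congr (_%:R).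
rewrite /mechar mdeg_mnmwiden; congr (nat_of_bool (_ && _)).
apply/forallP/forallP => le1 i; first by rewrite -mnmwiden_widen.
case: (unliftP ord_max i) => [j|] ->; last by rewrite mnmwiden_ordmax.
have -> : lift ord_max j = widen_ord (leqnSn n) j.
  exact/val_inj/lift_max.
by rewrite mnmwiden_widen.
Qed.

Lemma sf_e_subproof k : symfun_pred (fun n => mesym n R k : {mpoly R[n]}).
Proof.
apply/asboolP; split=> [n|n|]; [exact: mesym_sym|exact: restr_mesym|].
by exists k.+1 => n; apply: msize_dhomog_le; exact: dhomog_mesym.
Qed.
Definition sf_e k : symfun := SymFun (sf_e_subproof k).

Definition mcompl n k : {mpoly R[n]} :=
  \sum_(m : 'X_{1..n < k.+1} | mdeg m == k) 'X_[m].

Lemma mcoeff_mcompl n k (m : 'X_{1..n}) : (mcompl n k)@_m = (mdeg m == k)%:R.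
Proof.
rewrite /mcompl raddf_sum /=; case: (eqVneq (mdeg m) k) => [mk|mk].
  have mlt : (mdeg m < k.+1)%N by rewrite mk.
  rewrite (bigD1 (BMultinom mlt)) /= ?mk // mcoeffX eqxx big1 ?addr0 // => m'.
  case/andP => _ ne; rewrite mcoeffX; case: eqP => // eqm.
  by case/eqP: ne; apply: val_inj.
rewrite big1 // => m' m'k; rewrite mcoeffX; case: eqP => // eqm.
by case/eqP: mk; rewrite -eqm (eqP m'k).
Qed.

Lemma sf_h_subproof k : symfun_pred (fun n => mcompl n k).
Proof.
apply/asboolP; split=> [n|n|].
- apply/issymP => s; apply/mpolyP => m; rewrite mcoeff_sym !mcoeff_mcompl.
  by rewrite mdeg_mperm.
- by apply/mpolyP => m; rewrite mcoeff_restr !mcoeff_mcompl mdeg_mnmwiden.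
- exists k.+1 => n; apply/msize_dhomog_le/rpred_sum => m mk.
  by rewrite dhomogX /= mk.
Qed.
Definition sf_h k : symfun := SymFun (sf_h_subproof k).

Definition mpsum n k : {mpoly R[n]} := \sum_(i < n) 'X_i ^+ k.

Lemma sf_p_subproof k : symfun_pred (fun n => mpsum n k.+1).
Proof.
apply/asboolP; split=> [n|n|].
- apply/issymP => s.
  rewrite /mpsum [RHS](reindex_inj (@perm_inj _ s)) raddf_sum /=.
  apply: eq_bigr => i _; rewrite rmorphXn /=; congr (_ ^+ _).
  by rewrite /msym mmapX mmap1U.
- rewrite /mpsum big_ord_recr raddfD raddf_sum /=.
  rewrite [X in _ + X](_ : _ = 0) ?addr0; last first.
    rewrite rmorphXn /= /restr comp_mpolyXU -tnth_nth tnth_mktuple.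
    by rewrite unlift_none expr0n.
  apply: eq_bigr => i _; rewrite rmorphXn /= /restr comp_mpolyXU -tnth_nth.
  rewrite tnth_mktuple; have -> : widen_ord (leqnSn n) i = lift ord_max i.
    exact/val_inj/esym/lift_max.
  by rewrite liftK.
- exists k.+2 => n; apply/msize_dhomog_le/rpred_sum => i _.
  by rewrite mpolyXn dhomogX /= mdegMn mdeg1 mul1n.
Qed.

(* p_k for k > 0; sf_p 0 is a junk value, the power sum of degree 0 being     *)
(* undefined in infinitely many variables.                                    *)
Definition sf_p k : symfun := SymFun (sf_p_subproof k.-1).

Definition sf_homog (d : nat) (f : symfun) : Prop :=
  forall n, sf_fam f n \is d.-homog.

End SymFun.

Definition is_part (s : seq nat) : bool := sorted geq s && (0%N \notin s).

Record intpart := IntPart { parts :> seq nat; _ : is_part parts }.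
HB.instance Definition _ := [isSub for parts].
HB.instance Definition _ := [Countable of intpart by <:].

Lemma is_part_21 a b : is_part (nseq a 2 ++ nseq b 1)%N.
Proof.
rewrite /is_part mem_cat !mem_nseq /= !andbF andbT.
elim: a => [|[|a] IHa] //=; first by elim: b => [|[|b] IHb].
by case: b {IHa} => [|b] //=; elim: b.
Qed.

Lemma is_part_321 a b : is_part (3 :: nseq a 2 ++ nseq b 1)%N.
Proof.
have /andP[so n0] := is_part_21 a b.
rewrite /is_part inE (negPf n0) andbT.
by case: a so n0 => [|a] //; case: b.
Qed.

Definition part21 a b : intpart := IntPart (is_part_21 a b).
Definition part321 a b : intpart := IntPart (is_part_321 a b).

Definition zee (l : intpart) : nat :=
  (\prod_(i <- undup l) (i ^ count_mem i l * (count_mem i l)`!))%N.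

(* The cell in row i (counted from 0, the longest row) and column j. *)
Definition arm (l : intpart) (i j : nat) : nat := (nth 0 l i - j.+1)%N.
Definition leg (l : intpart) (i j : nat) : nat :=
  count (fun r => (j < r)%N) (drop i.+1 l).

Definition dominance_lt (m l : intpart) : Prop :=
  [/\ m <> l, sumn m = sumn l &
      forall k, (sumn (take k m) <= sumn (take k l))%N].

Section Operators.
Variable F : fieldType.
Implicit Types (f g : symfun F) (l m : intpart) (q t : F).

Definition psum l : symfun F := \prod_(k <- l) sf_p F k.

(* Jacobi-Trudi: det (h_(l_i - i + j)), with h_k = 0 for k < 0 *)
Definition schur l : symfun F :=
  \det (\matrix_(i < size l, j < size l)
    if (i <= nth 0 l i + j)%N then sf_h F (nth 0 l i + j - i)%N else 0).

Definition bilinear_form (B : symfun F -> symfun F -> F) : Prop :=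
  (forall f, scalar (B f)) /\ (forall g, scalar (B^~ g)).

(* The bilinear form for which the basis b is orthogonal, with squared norms  *)
(* given by w; b is instantiated below by bases only, so it is unique.        *)
Definition diag_form (b : intpart -> symfun F) (w : intpart -> F) :
    symfun F -> symfun F -> F :=
  xget (fun _ _ => 0) [set B | bilinear_form B /\
    forall l m, B (b l) (b m) = if l == m then w l else 0]%classic.

Definition hall := diag_form schur (fun=> 1).

Definition scal_qt q t := diag_form psum
  (fun l => (zee l)%:R * \prod_(k <- l) ((1 - q ^+ k) / (1 - t ^+ k))).

Definition scal_t t := diag_form psum
  (fun l => (zee l)%:R * \prod_(k <- l) (1 - t ^+ k)^-1).

Definition perp f : symfun F -> symfun F :=
  xget (fun=> 0)
    [set A | forall g h, hall (f * g) h = hall g (A h)]%classic.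

(* In the two sums below only finitely many terms are nonzero. *)
Definition Hop t (r : nat) f : symfun F :=
  \sum_(ij \in [set: nat * nat]%classic)
    (t ^+ ij.2 * (-1) ^+ ij.1) *:
      (sf_h F (r + ij.1 + ij.2)%N * perp (sf_e F ij.1) (perp (sf_h F ij.2) f)).

(* For j > n the term vanishes, so that truncation in n - j is harmless. *)
Definition Hbar_homog t (r n : nat) f : symfun F :=
  \sum_(ij \in [set: nat * nat]%classic)
    (t ^+ (n - ij.2)%N * (-1) ^+ ij.1) *:
      (sf_e F (r + ij.1 + ij.2)%N * perp (sf_h F ij.1) (perp (sf_e F ij.2) f)).

Definition Hbar t (r : nat) : symfun F -> symfun F :=
  xget (fun=> 0) [set A : symfun F -> symfun F | linear A /\
    forall n f, sf_homog n f -> A f = Hbar_homog t r n f]%classic.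

Definition H3qt q t f : symfun F :=
  Hop t 3 f + q *: (sf_e F 1 * Hop t 2 f - Hop t 3 f)
  + q ^+ 2 *: (sf_e F 1 * Hbar t 2 f - Hbar t 3 f) + q ^+ 3 *: Hbar t 3 f.

Definition integral_forms q t (J : intpart -> symfun F) : Prop :=
  (forall l, exists c : intpart -> F,
     J l = (\prod_(i < size l) \prod_(j < nth 0 l i)
              (1 - q ^+ arm l i j * t ^+ (leg l i j).+1)) *: schur l
           + \sum_(m \in [set m | dominance_lt m l]%classic) c m *: schur m) /\
  (forall l m, l <> m -> scal_qt q t (J l) (J m) = 0).

Definition macdonald_K t (J : intpart -> symfun F) l m : F := scal_t t (J m) (schur l).

Definition macdonald_H t (J : intpart -> symfun F) m : symfun F :=
  \sum_(l \in [set: intpart]%classic) macdonald_K t J l m *: schur l.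

End Operators.

(* Q(q,t) *)
Definition Qqt : fieldType := {fraction {mpoly rat[2]}}.
Definition Qqt_q : Qqt := FracField.tofrac ('X_(inord 0) : {mpoly rat[2]}).
Definition Qqt_t : Qqt := FracField.tofrac ('X_(inord 1) : {mpoly rat[2]}).

(* Main.v *)
Require Import Defs.
From HB Require Import structures.
From mathcomp Require Import all_boot all_order all_algebra perm.
From mathcomp Require Import boolp classical_sets fsbigop cardinality.
From mathcomp Require Import mpoly ring zify lra.

Set Implicit Arguments.
Unset Strict Implicit.
Unset Printing Implicit Defensive.

Import GRing.Theory.
Local Open Scope ring_scope.

(** Write E_k = e_k[X/(1-t)] and let D be Macdonald's operator transported by
    the plethysm X -> X/(1-t); that plethysm takes J_m to H_m. Write K for the
    operator H_3^qt. The proof shows that both sides of the theorem are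
    eigenvectors of D with the same eigenvalue and the same leading term.

    The H_m in question are eigenvectors. D is self-adjoint for the form that
    the plethysm transports from the one defining the J_m ([mac_selfadjoint],
    [form_pl]). It is triangular on the products E_k E_l and E_1 E_k E_l,
    suitably ordered ([mac_flag]). In the same order the J_m are triangular over
    the products e_k e_l and e_1 e_k e_l: this is a computation with the Pieri
    rule on alternants for the Schur functions indexed by (2^a 1^b) and
    (3 2^a 1^b), the only ones dominated by such partitions ([schur_flag],
    [integral_form_flag]). A self-adjoint triangular operator is diagonal on an
    orthogonal triangular family ([triangular_eigen], [mac_macdonald]).

    K preserves eigenvectors. On the span of the E_i E_j one has
    t D K = K D + q^3 (t - 1) K ([commutation]). On the generating series
    E(u) E(v) both operators act by rational expressions in u, v and the series
    E(t^i u), E(t^j v), because each is a vertex operator whose coefficients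
    telescope ([vgen_diff]); after clearing denominators the relation is an
    identity in a commutative ring ([commutation_num]). Hence K sends
    H_(2^a 1^b) to an eigenvector, with the eigenvalue of H_(3 2^a 1^b).

    The leading terms agree: K (E_k E_l) equals
    (1 - t)(1 - q t^(l+1))(1 - q^2 t^(k+1)) E_1 E_(k+1) E_(l+1) up to lower
    terms ([H3op_lead]), and for k = a + b, l = a this factor is the
    contribution of the first row of (3 2^a 1^b) to the normalization of J
    ([lead_coef321]). So the difference of the two sides is an eigenvector in the
    span of the lower products, where its eigenvalue does not occur, and it
    vanishes ([eigen_eq0]).

    This rests on the structure of the ring of symmetric functions: it is free
    on the power sums ([symfun_ind], [hom_p]); multiplication by the terms of an
    exponential series in the power sums is adjoint to taking coefficients of a
    translation of the power sums ([sprod_weighted]); Schur functions are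
    orthonormal ([sprod_schur]). These facts turn the series defining H_m^t and
    its conjugate into vertex operators ([HopE], [HbarE]). *)

(** * Formal power series *)

(** Plain coefficient sequences, so that families such as e_n or h_n are power
    series without any conversion. *)
Definition fps (A : comNzRingType) := nat -> A.

Section Fps.
Variable A : comNzRingType.

HB.instance Definition _ := Choice.on (fps A).

Definition fps_zero : fps A := fun=> 0.
Definition fps_const (c : A) : fps A := fun n => if n is 0 then c else 0.
Definition fps_add (f g : fps A) : fps A := fun n => f n + g n.
Definition fps_opp (f : fps A) : fps A := fun n => - f n.
Definition fps_mul (f g : fps A) : fps A :=
  fun n => \sum_(i < n.+1) f i * g (n - i)%N.
Definition fps_trunc N (f : fps A) : {poly A} := \poly_(i < N) f i.

Lemma fps_ext (f g : fps A) : (forall n, f n = g n) -> f = g.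
Proof. exact: functional_extensionality_dep. Qed.

Lemma fps_addA : associative fps_add.
Proof. by move=> f g h; apply: fps_ext => n; exact: addrA. Qed.
Lemma fps_addC : commutative fps_add.
Proof. by move=> f g; apply: fps_ext => n; exact: addrC. Qed.
Lemma fps_add0 : left_id fps_zero fps_add.
Proof. by move=> f; apply: fps_ext => n; exact: add0r. Qed.
Lemma fps_addN : left_inverse fps_zero fps_opp fps_add.
Proof. by move=> f; apply: fps_ext => n; exact: addNr. Qed.

HB.instance Definition _ := GRing.isZmodule.Build (fps A)
  fps_addA fps_addC fps_add0 fps_addN.

(** The ring axioms of the convolution product are inherited from polynomials,
    since each coefficient depends on finitely many coefficients only. *)
Lemma fps_mul_trunc f g N n : (n < N)%N ->
  fps_mul f g n = (fps_trunc N f * fps_trunc N g)`_n.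
Proof.
move=> ltnN; rewrite coefM; apply: eq_bigr => i _.
rewrite !coef_poly (leq_ltn_trans (leq_subr _ _) ltnN).
by rewrite (leq_ltn_trans _ ltnN) // -ltnS.
Qed.

Lemma fps_trunc_mul f g N n : (n < N)%N ->
  (fps_trunc N (fps_mul f g))`_n = (fps_trunc N f * fps_trunc N g)`_n.
Proof. by move=> ltnN; rewrite coef_poly ltnN (fps_mul_trunc _ _ ltnN). Qed.

Lemma fps_mulC : commutative fps_mul.
Proof.
by move=> f g; apply: fps_ext => n; rewrite !(@fps_mul_trunc _ _ n.+1) // mulrC.
Qed.

Lemma fps_mulA : associative fps_mul.
Proof.
move=> f g h; apply: fps_ext => n; rewrite !(@fps_mul_trunc _ _ n.+1) //.
transitivity (fps_trunc n.+1 f * (fps_trunc n.+1 g * fps_trunc n.+1 h))`_n.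
  rewrite !coefM; apply: eq_bigr => i _; congr (_ * _).
  by rewrite fps_trunc_mul // ltnS leq_subr.
rewrite mulrA !coefM; apply: eq_bigr => i _; congr (_ * _).
by rewrite fps_trunc_mul // ltn_ord.
Qed.

Lemma fps_mulDl : left_distributive fps_mul +%R.
Proof.
move=> f g h; apply: fps_ext => n; rewrite /fps_mul /=.
rewrite [RHS](_ : _ = fps_mul f h n + fps_mul g h n) //.
by rewrite -big_split /=; apply: eq_bigr => i _; rewrite -mulrDl.
Qed.

Lemma fps_constM c f n : fps_mul (fps_const c) f n = c * f n.
Proof.
rewrite /fps_mul big_ord_recl subn0 big1 ?addr0 // => i _.
by rewrite mul0r.
Qed.

Lemma fps_mul1 : left_id (fps_const 1) fps_mul.
Proof. by move=> f; apply: fps_ext => n; rewrite fps_constM mul1r. Qed.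

Lemma fps_one_neq0 : fps_const 1 != 0.
Proof.
by apply/eqP => /(congr1 (fun f : fps A => f 0%N)) /eqP; apply/negP/oner_neq0.
Qed.

HB.instance Definition _ := GRing.Zmodule_isComNzRing.Build (fps A)
  fps_mulA fps_mulC fps_mul1 fps_mulDl fps_one_neq0.

Lemma fpsD (f g : fps A) n : (f + g) n = f n + g n. Proof. by []. Qed.
Lemma fpsN (f : fps A) n : (- f) n = - f n. Proof. by []. Qed.
Lemma fpsB (f g : fps A) n : (f - g) n = f n - g n. Proof. by []. Qed.
Lemma fps0 n : (0 : fps A) n = 0. Proof. by []. Qed.
Lemma fps1 n : (1 : fps A) n = (n == 0%N)%:R. Proof. by case: n. Qed.
Lemma fpsM (f g : fps A) n : (f * g) n = \sum_(i < n.+1) f i * g (n - i)%N.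
Proof. by []. Qed.
Lemma fpsMr (f g : fps A) n : (f * g) n = \sum_(i < n.+1) f (n - i)%N * g i.
Proof. by rewrite mulrC fpsM; apply: eq_bigr => i _; rewrite mulrC. Qed.

Lemma fps_const_is_zmod : zmod_morphism fps_const.
Proof. by move=> c d; apply: fps_ext => -[|n] //; rewrite fpsB subr0. Qed.
Lemma fps_const_is_monoid : monoid_morphism fps_const.
Proof.
split=> // c d; apply: fps_ext => n.
by rewrite [RHS]fps_constM; case: n => [|n] //=; rewrite mulr0.
Qed.
HB.instance Definition _ :=
  GRing.isZmodMorphism.Build A (fps A) fps_const fps_const_is_zmod.
HB.instance Definition _ :=
  GRing.isMonoidMorphism.Build A (fps A) fps_const fps_const_is_monoid.

Lemma fpsCM c (f : fps A) n : (fps_const c * f) n = c * f n.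
Proof. exact: fps_constM. Qed.

Definition fpsX : fps A := fun n => (n == 1%N)%:R.

Lemma fpsXM (f : fps A) n : (fpsX * f) n = if n is m.+1 then f m else 0.
Proof.
rewrite fpsM; case: n => [|n]; first by rewrite big_ord1 mul0r.
rewrite big_ord_recl mul0r add0r big_ord_recl /= mul1r subSS subn0.
by rewrite big1 ?addr0 // => i _; rewrite /fpsX /= mul0r.
Qed.

Lemma fpsX_inj : injective ( *%R fpsX).
Proof.
move=> f g eqfg; apply: fps_ext => n.
by have /= := congr1 (fun h : fps A => h n.+1) eqfg; rewrite !fpsXM.
Qed.

Definition fps_euler (f : fps A) : fps A := fun n => f n *+ n.

Lemma fps_eulerM f g :
  fps_euler (f * g) = fps_euler f * g + f * fps_euler g.
Proof.
apply: fps_ext => n; rewrite fpsD !fpsM /fps_euler -big_split -sumrMnl /=.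
apply: eq_bigr => i _; rewrite mulrnAl mulrnAr -mulrnDr subnKC //.
by rewrite -ltnS.
Qed.

Definition fps_scale (s : A) (f : fps A) : fps A := fun n => s ^+ n * f n.

Lemma fps_scale_is_zmod s : zmod_morphism (fps_scale s).
Proof. by move=> f g; apply: fps_ext => n; rewrite /fps_scale !fpsB mulrBr. Qed.
Lemma fps_scale_is_monoid s : monoid_morphism (fps_scale s).
Proof.
split=> [|f g]; apply: fps_ext => n; rewrite /fps_scale.
  by rewrite fps1; case: n => [|n]; rewrite ?expr0 ?mulr1 // mulr0.
rewrite !fpsM big_distrr; apply: eq_bigr => i _ /=.
by rewrite mulrACA -exprD subnKC // -ltnS.
Qed.
HB.instance Definition _ s :=
  GRing.isZmodMorphism.Build (fps A) (fps A) (fps_scale s) (fps_scale_is_zmod s).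
HB.instance Definition _ s :=
  GRing.isMonoidMorphism.Build (fps A) (fps A) (fps_scale s)
    (fps_scale_is_monoid s).

Lemma fps_scaleC s c : fps_scale s (fps_const c) = fps_const c.
Proof. by apply: fps_ext => -[|n]; rewrite /fps_scale ?mul1r ?mulr0. Qed.
Lemma fps_scaleX s : fps_scale s fpsX = fps_const s * fpsX.
Proof.
apply: fps_ext => n; rewrite /fps_scale fpsCM /fpsX.
by case: n => [|[|n]]; rewrite ?mulr0.
Qed.
End Fps.

Section FpsMap.
Variables (A B : comNzRingType) (phi : {rmorphism A -> B}).

Definition fps_map (f : fps A) : fps B := fun n => phi (f n).

Lemma fps_map_is_zmod : zmod_morphism fps_map.
Proof. by move=> f g; apply: fps_ext => n; exact: rmorphB. Qed.
Lemma fps_map_is_monoid : monoid_morphism fps_map.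
Proof.
split=> [|f g]; apply: fps_ext => n; rewrite /fps_map.
  by rewrite !fps1 rmorph_nat.
by rewrite !fpsM rmorph_sum; apply: eq_bigr => i _; rewrite rmorphM.
Qed.
HB.instance Definition _ :=
  GRing.isZmodMorphism.Build (fps A) (fps B) fps_map fps_map_is_zmod.
HB.instance Definition _ :=
  GRing.isMonoidMorphism.Build (fps A) (fps B) fps_map fps_map_is_monoid.

Lemma fps_mapX : fps_map (fpsX A) = fpsX B.
Proof. by apply: fps_ext => n; rewrite /fps_map rmorph_nat. Qed.
Lemma fps_mapC c : fps_map (fps_const c) = fps_const (phi c).
Proof. by apply: fps_ext => -[|n] //; rewrite /fps_map /= rmorph0. Qed.
End FpsMap.

(** * Newton sequences *)

(** The relation between power sums and complete functions: f is the
    exponential of the series with coefficients a_n / n. It is stated without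
    division, so that it makes sense over every commutative ring. *)
Definition newton (A : comNzRingType) (a f : fps A) : Prop :=
  f 0%N = 1 /\ fps_euler f = (fpsX A * a) * f.

Section Newton.
Variable A : comNzRingType.
Implicit Types a b f g : fps A.

Lemma newtonE a f : newton a f <->
  f 0%N = 1 /\ forall n, f n.+1 *+ n.+1 = \sum_(i < n.+1) a i * f (n - i)%N.
Proof.
split=> -[f0 eqf]; split=> //.
  move=> n; have := congr1 (fun h : fps A => h n.+1) eqf; rewrite -mulrA fpsXM.
  by rewrite fpsM.
by apply: fps_ext => -[|n]; rewrite -mulrA fpsXM // fpsM -eqf.
Qed.

(** The Euler derivation is a derivation, so exponentials multiply. *)
Lemma newton_mul a b f g : newton a f -> newton b g -> newton (a + b) (f * g).
Proof.
move=> [f0 ef] [g0 eg]; split; first by rewrite fpsM big_ord1 f0 g0 mulr1.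
rewrite fps_eulerM ef eg; ring.
Qed.

Lemma newton1 : newton 0 (1 : fps A).
Proof.
split=> //; rewrite mulr0 mul0r; apply: fps_ext => n.
by rewrite /fps_euler fps1; case: n => [|n]; rewrite // mul0rn.
Qed.

Lemma newton_geom (x : A) : newton (fun n => x ^+ n.+1) (fun n => x ^+ n).
Proof.
apply/newtonE; split=> [|n]; first exact: expr0.
rewrite (eq_bigr (fun=> x ^+ n.+1)); first by rewrite sumr_const card_ord.
by move=> i _; rewrite -exprD addSn subnKC // -ltnS.
Qed.

Lemma newton_lin (x : A) :
  newton (fun n => - (- x) ^+ n.+1) (1 + fps_const x * fpsX A).
Proof.
apply/newtonE; split=> [|n].
  by rewrite fpsD fpsCM fps1 mulr0 addr0.
rewrite fpsD fps1 add0r fpsCM big_ord_recr /= subnn fpsD fpsCM fps1 mulr0 addr0.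
case: n => [|n]; first by rewrite big_ord0 add0r mulr1 opprK mulr1.
rewrite big_ord_recr big1 /= => [|i _]; last first.
  rewrite fpsD fpsCM fps1 /fpsX (subSn (ltnW (ltn_ord i))).
  have := ltn_ord i; rewrite -subn_gt0; case: (n - i)%N => // k _.
  by rewrite /= mulr0 addr0 mulr0.
rewrite subSnn fpsD fpsCM fps1 /fpsX /= mulr0 mul0rn !add0r !mulr1.
rewrite [in X in _ + X]exprS; ring.
Qed.

Lemma newton_scale s a f : newton a f ->
  newton (fun n => s ^+ n.+1 * a n) (fps_scale s f).
Proof.
move=> /newtonE[f0 ef]; apply/newtonE; split=> [|n].
  by rewrite /fps_scale f0 mulr1.
rewrite /fps_scale -mulrnAr ef big_distrr; apply: eq_bigr => i _ /=.
by rewrite mulrACA -exprD addSn subnKC // -ltnS.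
Qed.

Lemma eq_newton a b f : a = b -> newton a f -> newton b f.
Proof. by move=> ->. Qed.
End Newton.

Lemma newton_map (A B : comNzRingType) (phi : {rmorphism A -> B}) a f :
  newton a f -> newton (fps_map phi a) (fps_map phi f).
Proof.
move=> /newtonE[f0 ef]; apply/newtonE; split=> [|n].
  by rewrite /fps_map f0 rmorph1.
rewrite /fps_map -rmorphMn ef rmorph_sum.
by apply: eq_bigr => i _; rewrite rmorphM.
Qed.

(** The recursion determines n f_n. *)
Lemma newton_uniq (A : comNzRingType) (a f g : fps A) :
  (forall n, injective (fun x : A => x *+ n.+1)) ->
  newton a f -> newton a g -> f = g.
Proof.
move=> inj /newtonE[f0 ef] /newtonE[g0 eg]; apply: fps_ext => n.
elim/ltn_ind: n => -[|n] IH; first by rewrite f0 g0.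
apply: (inj n); rewrite ef eg; apply: eq_bigr => i _; congr (_ * _).
by apply: IH; rewrite ltnS leq_subr.
Qed.

Section NewtonSol.
Variables (F : fieldType) (A : comNzRingType) (io : {rmorphism F -> A}).
Hypothesis natF_neq0 : forall n, n.+1%:R != 0 :> F.

Lemma natK n : n.+1%:R * io n.+1%:R^-1 = 1.
Proof. by rewrite -(rmorph_nat io) -rmorphM divff // rmorph1. Qed.

Lemma mulrnS_inj n : injective (fun x : A => x *+ n.+1).
Proof.
move=> x y eqxy; rewrite -[x]mul1r -[y]mul1r -(natK n) mulrC [RHS]mulrC.
by rewrite !mulrA ![_ * n.+1%:R]mulr_natr eqxy.
Qed.

(** Newton's recursion is a course-of-values recursion: the list carries the
    values already computed, latest first. *)
Fixpoint newton_list (a : fps A) n : seq A :=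
  if n is m.+1 then
    (io m.+1%:R^-1 * \sum_(i < m.+1) a i * (newton_list a m)`_i)
      :: newton_list a m
  else [:: 1].
Definition newton_sol a : fps A := fun n => (newton_list a n)`_0.

Lemma newton_list_nth a n i : (i <= n)%N ->
  (newton_list a n)`_i = newton_sol a (n - i)%N.
Proof. by elim: n i => [|n IH] [|i] //=; rewrite ltnS subSS => /IH. Qed.

Lemma newton_solS a n : newton_sol a n.+1 =
  io n.+1%:R^-1 * \sum_(i < n.+1) a i * newton_sol a (n - i)%N.
Proof.
rewrite [LHS]/=; congr (_ * _); apply: eq_bigr => i _.
by rewrite newton_list_nth // -ltnS.
Qed.

Lemma newton_solP a : newton a (newton_sol a).
Proof.
apply/newtonE; split=> // n.
by rewrite newton_solS -[LHS]mulr_natl mulrA natK mul1r.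
Qed.
End NewtonSol.

(** * The ring of symmetric functions is free on the power sums *)

Section MpolyExtra.
Variable R : comNzRingType.

Lemma mcoeffMX_le n (p : {mpoly R[n]}) (m k : 'X_{1..n}) :
  (p * 'X_[m])@_k = if (m <= k)%MM then p@_(k - m) else 0.
Proof.
case: ifP => [le_mk|nle]; first by rewrite -{1}(submK le_mk) addmC mcoeffMX.
apply: memN_msupp_eq0; apply/negP; rewrite (perm_mem (msuppMX p m)).
by case/mapP => m' _ eqk; move: nle; rewrite eqk lem_addr.
Qed.

Lemma rmorph_mmap n (S T : comNzRingType) (f : {rmorphism R -> S})
    (h : 'I_n -> S) (phi : {rmorphism S -> T}) p :
  phi (mmap f h p) = mmap (phi \o f) (phi \o h) p.
Proof.
rewrite /mmap rmorph_sum; apply: eq_bigr => m _; rewrite rmorphM.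
congr (_ * _); rewrite /mmap1 rmorph_prod.
by apply: eq_bigr => i _; rewrite rmorphXn.
Qed.

Lemma eq_mmap n (S : comNzRingType) (f f' : R -> S) (h h' : 'I_n -> S) p :
  f =1 f' -> h =1 h' -> mmap f h p = mmap f' h' p.
Proof.
move=> eqf eqh; apply: eq_bigr => m _; rewrite eqf; congr (_ * _).
by apply: eq_bigr => i _; rewrite eqh.
Qed.

(** Evaluation of a polynomial does not see how many variables it is
    regarded in; this reconciles polynomials in different e_1, ..., e_n. *)
Lemma mmap_widen n N (le_nN : (n <= N)%N) (S : comNzRingType)
    (f : {rmorphism R -> S}) (h : nat -> S) (p : {mpoly R[n]}) :
  mmap f (fun i : 'I_N => h i)
    (mmap (@mpolyC N R) (fun i => 'X_(widen_ord le_nN i)) p) =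
  mmap f (fun i : 'I_n => h i) p.
Proof.
rewrite rmorph_mmap; apply: eq_mmap => [c|i] /=; first exact: mmapC.
by rewrite mmapX mmap1U.
Qed.
End MpolyExtra.

Lemma newton_mesym (R : comNzRingType) n :
  newton (fun k => (-1) ^+ k *: mpsum R n k.+1) (mesym n R : nat -> {mpoly R[n]}).
Proof.
elim: n => [|n IH].
  have -> : (mesym 0 R : fps {mpoly R[0]}) = 1.
    apply: fps_ext => -[|k]; first by rewrite mesym0E.
    by rewrite mesym_geqnE.
  apply: eq_newton (newton1 _); apply: fps_ext => k.
  by rewrite /mpsum big_ord0 scaler0.
have -> : (mesym n.+1 R : fps {mpoly R[n.+1]}) =
    fps_map (@mwiden n R) (mesym n R) * (1 + fps_const 'X_ord_max * fpsX _).
  apply: fps_ext => k; rewrite mulrDr mulr1 mulrCA fpsD fpsCM.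
  rewrite [fps_map _ _ * _]mulrC fpsXM.
  case: k => [|k]; first by rewrite /fps_map !mesym0E rmorph1 mulr0 addr0.
  by rewrite mesymSS mulrC.
apply: eq_newton (newton_mul (newton_map _ IH) (newton_lin _)).
apply: fps_ext => k; rewrite fpsD /fps_map /= /mpsum mwidenZ big_ord_recr /=.
rewrite scalerDr rmorph_sum /=; congr (_ + _).
  congr (_ *: _); apply: eq_bigr => i _.
  by rewrite rmorphXn /= mwidenX mnmwiden1.
rewrite [(- 'X_ord_max) ^+ _]exprNn [(-1) ^+ k.+1]exprS mulN1r mulNr opprK.
by rewrite -signr_odd mulr_sign -[in RHS]signr_odd scaler_sign.
Qed.

Lemma mdegB n (m1 m2 : 'X_{1..n}) :
  (m2 <= m1)%MM -> mdeg (m1 - m2) = (mdeg m1 - mdeg m2)%N.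
Proof. by move=> le21; rewrite -[in RHS](submK le21) mdegD addnK. Qed.

Lemma mnmUMn_le n (i : 'I_n) k (m : 'X_{1..n}) :
  (U_(i) *+ k <= m)%MM = (k <= m i)%N.
Proof.
apply/mnm_lepP/idP => [/(_ i)|lek j]; rewrite mulmnE mnm1E ?eqxx ?mul1n //.
by case: eqVneq => [<-|]; rewrite ?mul1n ?mul0n.
Qed.

(** Both sides count the boxes of a monomial of degree k + 1, on the right
    variable by variable. *)
Lemma newton_mcompl (R : comNzRingType) n :
  newton (fun k => mpsum R n k.+1) (mcompl R n).
Proof.
apply/newtonE; split=> [|k].
  apply/mpolyP => m; rewrite mcoeff_mcompl mcoeff1.
  by rewrite mdeg_eq0.
apply/mpolyP => m; rewrite mcoeffMn mcoeff_mcompl raddf_sum /=.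
have coefE (i : 'I_k.+1) : (mpsum R n i.+1 * mcompl R n (k - i))@_m =
    \sum_(j < n) ((i < m j)%N && (mdeg m == k.+1))%:R.
  rewrite /mpsum mulr_suml raddf_sum; apply: eq_bigr => j _ /=.
  rewrite mpolyXn mulrC mcoeffMX_le mnmUMn_le mcoeff_mcompl.
  case: ifP => // lei; rewrite mdegB ?mnmUMn_le // mdegMn mdeg1 mul1n /=.
  congr (nat_of_bool _)%:R; rewrite -(eqn_add2r i.+1) subnK; last first.
    by rewrite (leq_trans lei) // mdegE (bigD1 j) //= leq_addr.
  by rewrite addnS subnK // -ltnS.
rewrite (eq_bigr _ (fun i _ => coefE i)) exchange_big /=.
case: (eqVneq (mdeg m) k.+1) => [degm|_]; last first.
  by rewrite mul0rn big1 // => i _; rewrite big1 // => j _; rewrite andbF.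
rewrite -[in LHS]degm mdegE natr_sum; apply: eq_bigr => j _.
under eq_bigr do rewrite andbT.
rewrite -natr_sum; congr (_%:R); rewrite -big_mkcond /=.
have lemj : (m j <= k.+1)%N by rewrite -degm mdegE (bigD1 j) //= leq_addr.
by rewrite -(big_ord_widen _ (fun=> 1%N) lemj) sum_nat_const card_ord muln1.
Qed.

Section Structure.
Variable F : fieldType.
Local Notation Sym := (symfun F).
Implicit Types f g : Sym.

Definition sf_proj n f : {mpoly F[n]} := sf_fam f n.

Lemma sf_proj_is_zmod n : zmod_morphism (sf_proj n).
Proof. by []. Qed.
Lemma sf_proj_is_monoid n : monoid_morphism (sf_proj n).
Proof. by []. Qed.
HB.instance Definition _ n :=
  GRing.isZmodMorphism.Build Sym {mpoly F[n]} (sf_proj n) (sf_proj_is_zmod n).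
HB.instance Definition _ n :=
  GRing.isMonoidMorphism.Build Sym {mpoly F[n]} (sf_proj n)
    (sf_proj_is_monoid n).

Lemma sf_projZ n c f : sf_proj n (c *: f) = c *: sf_proj n f.
Proof. by []. Qed.

Lemma sf_projA n c : sf_proj n c%:A = c%:MP.
Proof. by rewrite -[LHS]/(c *: (1 : {mpoly F[n]})) -mul_mpolyC mulr1. Qed.

Lemma symfun_ext f g : (forall n, sf_proj n f = sf_proj n g) -> f = g.
Proof. by move=> eqfg; apply: val_inj; apply: mfam_ext. Qed.

(** Identities between symmetric functions are checked in n variables for every
    n. *)
Lemma newton_proj (a b : fps Sym) :
  (forall n, newton (fps_map (sf_proj n) a) (fps_map (sf_proj n) b)) ->
  newton a b.
Proof.
move=> nwt; apply/newtonE; split=> [|k]; apply: symfun_ext => n.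
  by have /newtonE[] := nwt n.
have /newtonE[_ /(_ k) eqk] := nwt n; rewrite rmorph_sum rmorphMn [LHS]eqk.
by apply: eq_bigr => i _; rewrite rmorphM.
Qed.

Lemma newton_e : newton (fun k => (-1) ^+ k *: sf_p F k.+1) (sf_e F).
Proof.
apply: newton_proj => n; apply: eq_newton (newton_mesym F n).
exact: fps_ext.
Qed.

Lemma newton_h : newton (fun k => sf_p F k.+1) (sf_h F).
Proof. by apply: newton_proj => n; exact: newton_mcompl. Qed.

(** A symmetric function of degree at most N is determined by its N-variable
    component: a monomial of degree at most N omits one of n > N variables,
    which may be taken to be the last one by symmetry. *)
Lemma symfun_eq0_deg f N :
  (forall n (m : 'X_{1..n}), (N < mdeg m)%N -> (sf_fam f n)@_m = 0) ->
  sf_fam f N = 0 -> f = 0.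
Proof.
move=> degf fN0; have /asboolP[symf restrf _] : symfun_pred (sf_fam f) := valP f.
have stepf n : (N <= n)%N -> sf_fam f n = 0 -> sf_fam f n.+1 = 0.
  move=> leNn fn0; apply/mpolyP => m; rewrite mcoeff0.
  have [/degf //|lemN] := ltnP N (mdeg m).
  have /existsP[i /eqP mi0] : [exists i, m i == 0%N].
    apply: contraLR lemN; rewrite negb_exists => /forallP mn0.
    rewrite -ltnNge mdegE (leq_ltn_trans leNn) // -[X in (X <= _)%N]muln1.
    rewrite -[X in (X * _)%N]card_ord -sum_nat_const.
    by apply: leq_sum => i _; rewrite lt0n.
  pose s := tperm i ord_max; rewrite -(msym_coeff _ s) ?symf //.
  set m' := [multinom _ | _ < _].
  have m'max : m' ord_max = 0%N by rewrite mnmE tpermR.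
  pose m0 := [multinom m' (widen_ord (leqnSn _) j) | j < n].
  have -> : m' = mnmwiden m0.
    apply/mnmP => j; case: (unliftP ord_max j) => [j' ->|->]; last first.
      by rewrite mnmwiden_ordmax m'max.
    have -> : lift ord_max j' = widen_ord (leqnSn n) j'.
      exact/val_inj/lift_max.
    by rewrite mnmwiden_widen [RHS]mnmE.
  by rewrite -mcoeff_restr restrf fn0 mcoeff0.
apply: symfun_ext => n; have [lenN|ltNn] := leqP n N.
  have fS k : sf_fam f k.+1 = 0 -> sf_fam f k = 0.
    by move=> fk0; rewrite -restrf fk0 raddf0.
  by move: fN0; rewrite -(subnK lenN); elim: (N - n)%N => [|k IH] // /fS.
rewrite -(subnK (ltnW ltNn)); elim: (n - N)%N => [|k IH] //=.
by rewrite [LHS]stepf // leq_addl.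
Qed.

Definition poly_e n (p : {mpoly F[n]}) : Sym :=
  mmap (GRing.in_alg Sym) (fun i : 'I_n => sf_e F i.+1) p.
HB.instance Definition _ n := GRing.RMorphism.copy (@poly_e n)
  (mmap (GRing.in_alg Sym) (fun i : 'I_n => sf_e F i.+1)).

Lemma poly_e_proj n p : sf_fam (@poly_e n p) n =
  p \mPo [tuple mesym n F i.+1 | i < n].
Proof.
rewrite -/(sf_proj n _) rmorph_mmap; apply: eq_mmap => [c|i] /=.
  exact: sf_projA.
by rewrite tnth_mktuple.
Qed.

(** The fundamental theorem in n variables. *)
Lemma poly_e_eq0 n p : @poly_e n p = 0 -> p = 0.
Proof.
move=> p0; apply: (@msym_fundamental_un0 n F); rewrite -poly_e_proj p0.
exact: (rmorph0 (sf_proj n)).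
Qed.

Lemma sf_e_homog k : sf_homog k (sf_e F k).
Proof. by move=> n; exact: dhomog_mesym. Qed.

Lemma sf_homogM d e f g :
  sf_homog d f -> sf_homog e g -> sf_homog (d + e) (f * g).
Proof. by move=> hf hg n; apply: dhomogM. Qed.

Lemma sf_homog_lin d (c : F) f g :
  sf_homog d f -> sf_homog d g -> sf_homog d (c *: f + g).
Proof.
move=> hf hg n; rewrite [X in X \is _](_ : _ = c *: sf_fam f n + sf_fam g n) //.
by apply: rpredD; [apply: rpredZ; apply: hf|apply: hg].
Qed.

Lemma sf_homog1 : sf_homog 0 (1 : Sym).
Proof. by move=> n; exact: dhomog1. Qed.

Lemma sf_homog_mnm n (m : 'X_{1..n}) :
  sf_homog (mnmwgt m) (mmap1 (fun i : 'I_n => sf_e F i.+1) m).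
Proof.
rewrite /mmap1 /mnmwgt.
apply: (big_ind2 (fun d f => sf_homog d f)) => [||i _]; first exact: sf_homog1.
  by move=> d1 f1 d2 f2; exact: sf_homogM.
elim: (m i) => [|k IH]; first exact: sf_homog1.
by rewrite exprS mulSn; apply: sf_homogM (sf_e_homog _) IH.
Qed.

(** For a function of degree at most N, the fundamental theorem in N variables
    provides a polynomial that agrees with it in N variables, hence everywhere
    by [symfun_eq0_deg]. *)
Lemma poly_e_surj f : exists n p, f = @poly_e n p.
Proof.
have /asboolP[symf _ [N degf]] : symfun_pred (sf_fam f) := valP f.
have [t [eqt wt]] := sym_fundamental (symf N); exists N, t.
apply/eqP; rewrite -subr_eq0; apply/eqP; apply: (@symfun_eq0_deg _ N).
  move=> n m ltNm; rewrite [X in X@_m](_ : _ = sf_fam f n - sf_fam (poly_e t) n) //.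
  rewrite mcoeffB (memN_msupp_eq0 (p := sf_fam f n)) ?sub0r; last first.
    by apply: msize_mdeg_ge; rewrite (leq_trans (degf n)) // ltnW.
  rewrite -/(sf_proj n _) /poly_e /mmap rmorph_sum raddf_sum big_seq big1 ?oppr0 //.
  move=> m' m't; rewrite -[LHS]/((sf_proj n ((t@_m')%:A * mmap1 _ m'))@_m).
  rewrite mulr_algl sf_projZ mcoeffZ.
  rewrite (dhomog_nemf_coeff (sf_homog_mnm m' n)) ?mulr0 //=.
  rewrite neq_ltn orbC (leq_trans _ ltNm) // ltnS ltnW //.
  by rewrite (leq_trans (mmeasure_mnm_lt _ m't)) // (leq_trans wt).
rewrite [LHS](_ : _ = sf_fam f N - sf_fam (poly_e t) N) //.
by rewrite poly_e_proj eqt subrr.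
Qed.

Definition widen_p n N (le_nN : (n <= N)%N) (p : {mpoly F[n]}) : {mpoly F[N]} :=
  mmap (@mpolyC N F) (fun i => 'X_(widen_ord le_nN i)) p.

Lemma poly_e_widen n N (le_nN : (n <= N)%N) p :
  poly_e (widen_p le_nN p) = poly_e p.
Proof. exact: (mmap_widen le_nN _ (fun i => sf_e F i.+1)). Qed.

Lemma poly_e_surj2 f g :
  exists n (p1 p2 : {mpoly F[n]}), f = poly_e p1 /\ g = poly_e p2.
Proof.
have [n [p ->]] := poly_e_surj f; have [m [p' ->]] := poly_e_surj g.
exists (n + m)%N, (widen_p (leq_addr m n) p), (widen_p (leq_addl n m) p').
by rewrite !poly_e_widen.
Qed.

Section UniversalE.
Variables (A : comNzRingType) (io : {rmorphism F -> A}) (a : nat -> A).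

Local Notation evA n p := (mmap io (fun i : 'I_n => a i) p).

Lemma ev_poly_e n m p p' : @poly_e n p = @poly_e m p' -> evA n p = evA m p'.
Proof.
move=> eqp; rewrite -[LHS](mmap_widen (leq_addr m n)).
rewrite -[RHS](mmap_widen (leq_addl n m)); congr (mmap _ _ _); apply/eqP; rewrite -subr_eq0; apply/eqP; apply: poly_e_eq0.
by rewrite rmorphB /= [X in X - _]poly_e_widen [X in _ - X]poly_e_widen eqp subrr.
Qed.

Lemma symfun_rep f : exists np : {n : nat & {mpoly F[n]}}, f = poly_e (projT2 np).
Proof. by have [n [p ->]] := poly_e_surj f; exists (existT _ n p). Qed.

(** The homomorphism out of the free ring on e_1, e_2, ...: evaluate a chosen
    polynomial representing f; by [ev_poly_e] the choice does not matter. *)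
Definition hom_e f : A :=
  let np := projT1 (cid (symfun_rep f)) in evA _ (projT2 np).

Lemma hom_eE n p : hom_e (@poly_e n p) = evA n p.
Proof. by apply: ev_poly_e; rewrite -(projT2 (cid (symfun_rep _))). Qed.

Lemma hom_e_is_zmod : zmod_morphism hom_e.
Proof.
move=> f g; have [n [p1 [p2 [-> ->]]]] := poly_e_surj2 f g.
by rewrite -rmorphB !hom_eE rmorphB.
Qed.
Lemma hom_e_is_monoid : monoid_morphism hom_e.
Proof.
split=> [|f g]; first by rewrite -(rmorph1 (@poly_e 0)) hom_eE rmorph1.
have [n [p1 [p2 [-> ->]]]] := poly_e_surj2 f g.
by rewrite -rmorphM !hom_eE rmorphM.
Qed.
HB.instance Definition _ := GRing.isZmodMorphism.Build Sym A hom_e hom_e_is_zmod.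
HB.instance Definition _ :=
  GRing.isMonoidMorphism.Build Sym A hom_e hom_e_is_monoid.

Lemma hom_e_alg c : hom_e c%:A = io c.
Proof.
have -> : c%:A = @poly_e 0 c%:MP by rewrite /poly_e mmapC.
by rewrite hom_eE mmapC.
Qed.
Lemma hom_e_e k : hom_e (sf_e F k.+1) = a k.
Proof.
have -> : sf_e F k.+1 = @poly_e k.+1 'X_ord_max.
  by rewrite /poly_e mmapX mmap1U.
by rewrite hom_eE mmapX mmap1U.
Qed.
End UniversalE.

End Structure.

(** * Homomorphisms and translations of the power sums *)

Lemma newton_inj (A : comNzRingType) (a b f : fps A) :
  newton a f -> newton b f -> a = b.
Proof.
move=> /newtonE[f0 ef] /newtonE[_ eg]; apply: fps_ext => n.
elim/ltn_ind: n => n IH; have := ef n; rewrite eg !big_ord_recr /= subnn f0.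
rewrite !mulr1 (eq_bigr (fun i : 'I_n => a i * f (n - i)%N)) => [/addrI //|i _].
by rewrite IH.
Qed.

Section Universal.
Variable F : fieldType.
Hypothesis natF_neq0 : forall n, n.+1%:R != 0 :> F.
Local Notation Sym := (symfun F).
Implicit Types f g : Sym.

(** Since n e_n is a polynomial in the power sums and smaller e's, the power
    sums generate. *)
Lemma symfun_ind (P : Sym -> Prop) :
  P 1 -> (forall f g, P f -> P g -> P (f + g)) ->
  (forall c f, P f -> P (c *: f)) ->
  (forall k f, P f -> P (sf_p F k.+1 * f)) -> forall f, P f.
Proof.
move=> P1 PD PZ Pp f; have P0 : P 0 by rewrite -(scale0r 1); apply: PZ.
pose Q f := forall g, P g -> P (f * g).
suff Qf : Q f by rewrite -[f]mulr1; apply: Qf.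
have Q1 : Q 1 by move=> g; rewrite mul1r.
have QM f1 f2 : Q f1 -> Q f2 -> Q (f1 * f2).
  by move=> Q1' Q2 g Pg; rewrite -mulrA; apply/Q1'/Q2.
have QZ c f1 : Q f1 -> Q (c *: f1).
  by move=> Q1' g Pg; rewrite -scalerAl; apply/PZ/Q1'.
have Qsum I (r : seq I) (h : I -> Sym) :
    (forall i, Q (h i)) -> Q (\sum_(i <- r) h i).
  move=> Qh; apply: big_ind => // [g _|f1 f2 Q1' Q2 g Pg]; first by rewrite mul0r.
  by rewrite mulrDl; apply: PD; [apply: Q1'|apply: Q2].
have Qe n : Q (sf_e F n).
  have /newtonE[e0 eS] := newton_e F; elim/ltn_ind: n => -[|n] IH.
    by rewrite e0.
  rewrite -[sf_e F _]scale1r -(mulVf (natF_neq0 n)) -scalerA scaler_nat eS.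
  apply/QZ/Qsum => i; apply: QM; last by apply: IH; rewrite ltnS leq_subr.
  by apply: QZ => g; exact: Pp.
have [n [p ->]] := poly_e_surj f; apply: Qsum => m.
rewrite mulr_algl; apply: QZ; rewrite /mmap1.
apply: big_ind => // i _; elim: (m i) => [//|k IH].
by rewrite exprS; apply: QM.
Qed.

Section HomP.
Variables (A : comNzRingType) (io : {rmorphism F -> A}).

Lemma hom_ext (phi psi : {rmorphism Sym -> A}) :
  (forall c, phi c%:A = psi c%:A) ->
  (forall k, phi (sf_p F k.+1) = psi (sf_p F k.+1)) -> phi =1 psi.
Proof.
move=> eqC eqp; elim/symfun_ind => [|f g IHf IHg|c f IHf|k f IHf].
- by rewrite !rmorph1.
- by rewrite !rmorphD IHf IHg.
- by rewrite -mulr_algl !rmorphM IHf eqC.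
- by rewrite !rmorphM IHf eqp.
Qed.

Variable a : nat -> A.

(** The ring homomorphism with prescribed values a_k on the power sums p_k,
    k > 0; the values on the e_k are found by Newton's recursion. *)
Definition hom_p : Sym -> A :=
  hom_e io (fun k => newton_sol io (fun k => (-1) ^+ k * a k.+1) k.+1).
HB.instance Definition _ := GRing.RMorphism.copy hom_p
  (hom_e io (fun k => newton_sol io (fun k => (-1) ^+ k * a k.+1) k.+1)).

Lemma hom_p_alg c : hom_p c%:A = io c.
Proof. exact: hom_e_alg. Qed.

Lemma hom_pZ c f : hom_p (c *: f) = io c * hom_p f.
Proof. by rewrite -mulr_algl [LHS]rmorphM; congr (_ * _); exact: hom_p_alg. Qed.

Lemma hom_p_p k : hom_p (sf_p F k.+1) = a k.+1.
Proof.
pose b : fps A := fun k => (-1) ^+ k * a k.+1.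
have nb : newton b (newton_sol io b) by apply: newton_solP.
have np := newton_map hom_p (newton_e F).
have eqf : fps_map hom_p (sf_e F) = newton_sol io b.
  apply: fps_ext => -[|n]; last exact: hom_e_e.
  by case: np => ->; case: nb => ->.
move: np; rewrite eqf => /newton_inj /(_ nb) /(congr1 (fun h : fps A => h k)).
rewrite [X in X = _](hom_pZ _ (sf_p F k.+1)) rmorphXn rmorphN1 /b.
move=> /(congr1 ( *%R ((-1) ^+ k))).
by rewrite !mulrA -!expr2 sqrr_sign !mul1r.
Qed.
End HomP.
End Universal.

Section Operators.
Variable F : fieldType.
Hypothesis natF_neq0 : forall n, n.+1%:R != 0 :> F.
Local Notation Sym := (symfun F).
Implicit Types (f g : Sym) (w v : nat -> F).

Definition rescale w : Sym -> Sym :=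
  hom_p (GRing.in_alg Sym) (fun k => w k *: sf_p F k).
HB.instance Definition _ w := GRing.RMorphism.copy (rescale w)
  (hom_p (GRing.in_alg Sym) (fun k => w k *: sf_p F k)).
Lemma rescaleZ w c f : rescale w (c *: f) = c *: rescale w f.
Proof. by rewrite [LHS]hom_pZ /= mulr_algl. Qed.
HB.instance Definition _ w :=
  GRing.isScalable.Build F Sym Sym *:%R (rescale w) (rescaleZ w).
Lemma rescale_p w k : rescale w (sf_p F k.+1) = w k.+1 *: sf_p F k.+1.
Proof. exact: (hom_p_p natF_neq0). Qed.

Definition in_polyC : F -> {poly Sym} := polyC \o GRing.in_alg Sym.
HB.instance Definition _ := GRing.RMorphism.copy in_polyC
  (polyC \o GRing.in_alg Sym).
(** In plethystic notation f |-> f[X + Y], with p_k[Y] = w_k X^k. *)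
Definition transl w : Sym -> {poly Sym} :=
  hom_p in_polyC (fun k => (sf_p F k)%:P + (w k)%:A *: 'X^k).
HB.instance Definition _ w := GRing.RMorphism.copy (transl w)
  (hom_p in_polyC (fun k => (sf_p F k)%:P + (w k)%:A *: 'X^k)).
Lemma translZ w c f : transl w (c *: f) = c%:A *: transl w f.
Proof. by rewrite [LHS]hom_pZ /= mul_polyC. Qed.
Lemma transl_p w k :
  transl w (sf_p F k.+1) = (sf_p F k.+1)%:P + (w k.+1)%:A *: 'X^(k.+1).
Proof. exact: (hom_p_p natF_neq0). Qed.

(** For w = 1 this is the operator h_j^perp, for w_k = (-1)^(k-1) it is
    e_j^perp; see [perp_weighted]. *)
Definition skew w j f : Sym := (transl w f)`_j.

Lemma skew_is_linear w j : linear (skew w j).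
Proof.
by move=> c f g; rewrite /skew rmorphD /= translZ coefD coefZ mulr_algl.
Qed.
HB.instance Definition _ w j :=
  GRing.isLinear.Build F Sym Sym *:%R (skew w j) (skew_is_linear w j).

Lemma skew1 w j : skew w j 1 = (j == 0%N)%:R.
Proof. by rewrite /skew rmorph1 coef1. Qed.

Lemma skew_p w j k f : skew w j (sf_p F k.+1 * f) =
  sf_p F k.+1 * skew w j f +
  (if (k < j)%N then w k.+1 *: skew w (j - k.+1) f else 0).
Proof.
rewrite /skew rmorphM /= transl_p mulrDl coefD mul_polyC coefZ -scalerAl coefZ.
rewrite mulr_algl coefXnM ltnS; case: leqP => // _; by rewrite scaler0.
Qed.

Lemma skewM w j f g :
  skew w j (f * g) = \sum_(i < j.+1) skew w i f * skew w (j - i)%N g.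
Proof. by rewrite /skew rmorphM coefM. Qed.

(** The derivation k d/dp_k, as the first-order term of p_k -> p_k + k X. *)
Definition shift1 k : Sym -> {poly Sym} :=
  hom_p in_polyC (fun j => (sf_p F j)%:P + (j == k)%:R *: (k%:R *: 'X)).
HB.instance Definition _ k := GRing.RMorphism.copy (shift1 k)
  (hom_p in_polyC (fun j => (sf_p F j)%:P + (j == k)%:R *: (k%:R *: 'X))).
Lemma shift1Z k c f : shift1 k (c *: f) = c%:A *: shift1 k f.
Proof. by rewrite [LHS]hom_pZ /= mul_polyC. Qed.
Lemma shift1_p k j : shift1 k (sf_p F j.+1) =
  (sf_p F j.+1)%:P + (j.+1 == k)%:R *: (k%:R *: 'X).
Proof. exact: (hom_p_p natF_neq0). Qed.

Definition der_p k f : Sym := (shift1 k f)`_1.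
Lemma der_p_is_linear k : linear (der_p k).
Proof.
by move=> c f g; rewrite /der_p rmorphD /= shift1Z coefD coefZ mulr_algl.
Qed.
HB.instance Definition _ k :=
  GRing.isLinear.Build F Sym Sym *:%R (der_p k) (der_p_is_linear k).

Lemma shift1_0 k f : (shift1 k f)`_0 = f.
Proof.
elim/(symfun_ind natF_neq0): f => [|f g IHf IHg|c f IHf|j f IHf].
- by rewrite rmorph1 coef1.
- by rewrite rmorphD /= coefD IHf IHg.
- by rewrite shift1Z coefZ IHf mulr_algl.
- by rewrite rmorphM /= coefM big_ord1 subn0 IHf shift1_p coefD coefC !coefZ
    coefX !mulr0 addr0.
Qed.

Lemma der_pM k f g : der_p k (f * g) = der_p k f * g + f * der_p k g.
Proof.
rewrite /der_p rmorphM /= coefM !big_ord_recl big_ord0 addr0 /= !shift1_0 addrC.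
by [].
Qed.
Lemma der_p1 k : der_p k 1 = 0.
Proof. by rewrite /der_p rmorph1 coef1. Qed.
Lemma der_p_p k j : der_p k (sf_p F j.+1) = (if j.+1 == k then k else 0)%:R.
Proof.
rewrite /der_p shift1_p coefD coefC !coefZ coefX add0r mulr1.
by case: eqP; rewrite ?mul1r ?mul0r.
Qed.

(** The generating series of c is exp (sum_k w_k p_k / k); the cases used are
    h_n, e_n and their plethystic images. *)
Definition weighted w (c : nat -> Sym) :=
  newton (fun k => w k.+1 *: sf_p F k.+1) c.

Lemma weighted_h : weighted (fun=> 1) (sf_h F).
Proof.
apply: eq_newton (newton_h F); apply: fps_ext => k; exact/esym/scale1r.
Qed.

Lemma weighted_e : weighted (fun k => (-1) ^+ k.-1) (sf_e F).
Proof. exact: newton_e. Qed.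

Lemma weighted_rescale w v c : weighted w c ->
  weighted (fun k => v k * w k) (fun n => rescale v (c n)).
Proof.
move=> /(newton_map (rescale v : {rmorphism _ -> _})); apply: eq_newton; apply: fps_ext => k.
by rewrite /fps_map /= rescaleZ rescale_p scalerA mulrC.
Qed.

Lemma weighted_scale w s c : weighted w c ->
  weighted (fun k => s ^+ k * w k) (fun n => s ^+ n *: c n).
Proof.
move=> /(newton_scale s%:A) nw; rewrite /weighted.
have -> : (fun n => s ^+ n *: c n) = fps_scale s%:A c.
  by apply: fps_ext => n; rewrite /fps_scale exprZn expr1n mulr_algl.
apply: eq_newton nw; apply: fps_ext => k.
by rewrite exprZn expr1n mulr_algl scalerA.
Qed.

Lemma weighted_mul w v c d : weighted w c -> weighted v d ->
  weighted (fun k => w k + v k)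
    (fun n => \sum_(i < n.+1) c i * d (n - i)%N).
Proof.
move=> nc nd; apply: eq_newton (newton_mul nc nd); apply: fps_ext => k.
by rewrite fpsD -scalerDl.
Qed.

Lemma weighted_uniq w c d : weighted w c -> weighted w d -> forall n, c n = d n.
Proof.
move=> nc nd n; rewrite (newton_uniq _ nc nd) // => k.
exact: (mulrnS_inj (GRing.in_alg Sym)).
Qed.

Lemma eq_weighted w v c : (forall k, w k.+1 = v k.+1) -> weighted w c ->
  weighted v c.
Proof.
by move=> eqw; apply: eq_newton; apply: fps_ext => k; rewrite eqw.
Qed.

Lemma weighted0 w c : weighted w c -> c 0%N = 1.
Proof. by case. Qed.

Lemma weightedS w c n : weighted w c ->
  c n.+1 *+ n.+1 = \sum_(i < n.+1) w i.+1 *: sf_p F i.+1 * c (n - i)%N.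
Proof. by move=> /newtonE[]. Qed.

Lemma weightedS_div w c n : weighted w c ->
  c n.+1 = n.+1%:R^-1 *: \sum_(i < n.+1) w i.+1 *: sf_p F i.+1 * c (n - i)%N.
Proof.
by move=> nc; rewrite -(weightedS _ nc) -scaler_nat scalerA mulVf ?scale1r.
Qed.
End Operators.

(** * The scalar product of power sums *)

Lemma geq_anti_sorted (s1 s2 : seq nat) :
  sorted geq s1 -> sorted geq s2 -> perm_eq s1 s2 -> s1 = s2.
Proof.
apply: sorted_eq => [y x z lexy leyz|x y /andP[]]; first exact: leq_trans leyz lexy.
by move=> *; apply/anti_leq/andP.
Qed.

Lemma part_eq (l m : intpart) : perm_eq l m -> l = m.
Proof.
move=> eqlm; apply: val_inj; apply: geq_anti_sorted => //.
  by case: l {eqlm} => l /= /andP[].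
by case: m {eqlm} => m /= /andP[].
Qed.

Lemma part_pos (l : intpart) k : k \in (l : seq nat) -> (0 < k)%N.
Proof.
by case: l k => l /= /andP[_ l0] k kl; rewrite lt0n; apply: contraNneq l0 => <-.
Qed.

Lemma part_of_subproof (s : seq nat) :
  is_part (sort geq [seq k <- s | (0 < k)%N]).
Proof.
rewrite /is_part sort_sorted ?mem_sort ?mem_filter ?ltnn //.
Qed.
(** Zeros are dropped and the rest sorted, so that every sequence is allowed. *)
Definition part_of s := IntPart (part_of_subproof s).

Lemma part_ofP s : all (fun k => (0 < k)%N) s -> perm_eq (part_of s) s.
Proof. by move=> /all_filterP eqs; rewrite /= eqs perm_sort. Qed.

Lemma perm_zee (s1 s2 : seq nat) : perm_eq s1 s2 ->
  (\prod_(i <- undup s1) (i ^ count_mem i s1 * (count_mem i s1)`!) =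
   \prod_(i <- undup s2) (i ^ count_mem i s2 * (count_mem i s2)`!))%N.
Proof.
move=> eqs; rewrite (perm_big _ (perm_undup (perm_mem eqs))).
by apply: eq_bigr => i _; move/seq.permP: eqs => ->.
Qed.

Lemma zee_cons k (l m : intpart) : perm_eq l (k :: m) ->
  zee l = (k * (count_mem k m).+1 * zee m)%N.
Proof.
move=> eql; rewrite /zee (perm_zee eql) /=.
have othE (s : seq nat) : k \notin s ->
    (\prod_(j <- s) (j ^ ((k == j) + count_mem j m) *
       ((k == j) + count_mem j m)`!) =
     \prod_(j <- s) (j ^ count_mem j m * (count_mem j m)`!))%N.
  move=> ks; rewrite !big_seq; apply: eq_bigr => j js.
  by case: eqVneq => // eqkj; rewrite eqkj js in ks.
have [km|km] := boolP (k \in (m : seq nat)); last first.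
  rewrite big_cons eqxx othE ?mem_undup //; congr (_ * _)%N.
  by rewrite (count_memPn km) addn0 expn1 muln1.
have mu : k \in undup m by rewrite mem_undup.
rewrite (perm_big _ (perm_to_rem mu)) [in RHS](perm_big _ (perm_to_rem mu)).
rewrite !big_cons eqxx othE ?mem_rem_uniq ?undup_uniq ?inE ?eqxx //.
rewrite add1n expnS factS /= -!mulnA; congr (_ * _)%N.
by rewrite mulnCA; congr (_ * _)%N; rewrite -!mulnA mulnCA.
Qed.

Section Coord.
Variable F : fieldType.
Hypothesis natF_neq0 : forall n, n.+1%:R != 0 :> F.
Local Notation Sym := (symfun F).
Implicit Types (f g : Sym) (l m : intpart).

Lemma psum_perm l (s : seq nat) : perm_eq l s ->
  psum F l = \prod_(k <- s) sf_p F k.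
Proof. by move=> eqls; rewrite /psum (perm_big _ eqls). Qed.

Lemma psum_cons k l : sf_p F k.+1 * psum F l = psum F (part_of (k.+1 :: l)).
Proof.
rewrite (psum_perm (part_ofP _)) ?big_cons //=.
by apply/allP => j /part_pos.
Qed.

(** The coordinate of f on p_l is a coefficient of its image in a polynomial
    ring, under the homomorphism that sends p_1, ..., p_N to the variables and
    the other power sums to 0; N need not exceed the largest part of l. *)
Definition to_mpoly N : Sym -> {mpoly F[N]} :=
  hom_p (@mpolyC N F) (fun k => oapp (fun i => 'X_i) 0 (insub k.-1 : option 'I_N)).
HB.instance Definition _ N := GRing.RMorphism.copy (to_mpoly N)
  (hom_p (@mpolyC N F) (fun k => oapp (fun i => 'X_i) 0 (insub k.-1 : option 'I_N))).

Definition mult_mnm N (s : seq nat) : 'X_{1..N} :=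
  [multinom count_mem i.+1 s | i < N].

Lemma to_mpoly_psum N (s : seq nat) : all (fun k => (0 < k)%N) s ->
  to_mpoly N (\prod_(k <- s) sf_p F k) =
  if all (fun k => (k <= N)%N) s then 'X_[mult_mnm N s] else 0.
Proof.
elim: s => [_|k s IH /= /andP[k0 s0]].
  have -> : mult_mnm N [::] = 0%MM by apply/mnmP => i; rewrite !mnmE.
  by rewrite big_nil rmorph1 mpolyX0.
rewrite big_cons rmorphM /= IH //; case: k k0 => // k _.
rewrite [to_mpoly _ _](hom_p_p natF_neq0) /=.
case: insubP => [i ltkN ik|] /=; last by rewrite -leqNgt leqNgt => /negPf->; rewrite mul0r.
rewrite ltkN /=; case: ifP => _; last by rewrite mulr0.
rewrite -mpolyXD; congr (mpolyX _ _); apply/mnmP => j.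
by rewrite mnmDE !mnmE -ik -val_eqE.
Qed.

Definition coord l f : F := (to_mpoly (head 0%N l) f)@_(mult_mnm _ l).

Lemma coord_is_scalar l : scalar (coord l).
Proof.
move=> c f g; rewrite /coord rmorphD mcoeffD; congr (_ + _).
by rewrite [X in X@__](hom_pZ (@mpolyC _ F)) mcoeffCM.
Qed.
HB.instance Definition _ l :=
  GRing.isLinear.Build F Sym F *%R (coord l) (coord_is_scalar l).

Lemma part_head_max l : all (fun k => (k <= head 0 l)%N) l.
Proof.
case: l => -[|x s] //= /andP[px _]; rewrite leqnn.
by apply: order_path_min px => y z w lezy ley; exact: leq_trans ley lezy.
Qed.

Lemma coord_psum l m : coord l (psum F m) = (l == m)%:R.
Proof.
rewrite /coord /psum to_mpoly_psum; last by apply/allP => k /part_pos.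
case: ifP => [lem|/negP nle]; last first.
  by rewrite mcoeff0; case: eqP => // eqlm; case: nle; rewrite -eqlm part_head_max.
rewrite mcoeffX; congr (nat_of_bool _)%:R; apply/eqP/eqP => [eqlm|->//].
apply: part_eq; rewrite /perm_eq; apply/allP => k kl /=; case: k kl => [|k] kl.
  by move: kl; rewrite mem_cat => /orP[] /part_pos.
have lek : (k < head 0 l)%N.
  move: kl; rewrite mem_cat => /orP[] kl; first exact: (allP (part_head_max l)).
  exact: (allP lem).
by have := congr1 (fun f : 'X_{1.._} => f (Ordinal lek)) eqlm; rewrite !mnmE => ->.
Qed.

Lemma symfun_expand f : exists r : seq (F * intpart),
  f = \sum_(x <- r) x.1 *: psum F x.2.
Proof.
elim/(symfun_ind natF_neq0): f => [|f g [r ->] [r' ->]|c f [r ->]|k f [r ->]].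
- exists [:: (1, part_of [::])]; rewrite big_seq1 scale1r.
  by rewrite (psum_perm (part_ofP _)) ?big_nil.
- by exists (r ++ r'); rewrite big_cat.
- exists [seq (c * x.1, x.2) | x <- r]; rewrite big_map scaler_sumr.
  by apply: eq_bigr => x _; rewrite scalerA.
- exists [seq (x.1, part_of (k.+1 :: x.2)) | x : F * intpart <- r]; rewrite big_map mulr_sumr.
  by apply: eq_bigr => x _; rewrite -scalerAr psum_cons.
Qed.

Lemma symfun_ind_psum (P : Sym -> Prop) :
  (forall f g, P f -> P g -> P (f + g)) -> (forall c f, P f -> P (c *: f)) ->
  (forall l, P (psum F l)) -> forall f, P f.
Proof.
move=> PD PZ Pp f; have [r ->] := symfun_expand f.
apply: big_ind => // [|x _]; last exact/PZ/Pp.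
by rewrite -(scale0r (psum F (part_of [::]))); apply: PZ.
Qed.

Lemma coord_finite f : exists r : seq intpart,
  uniq r /\ forall l, l \notin r -> coord l f = 0.
Proof.
have [r ->] := symfun_expand f; exists (undup [seq x.2 | x <- r]).
split=> [|l]; first exact: undup_uniq.
rewrite mem_undup => lr; rewrite linear_sum big_seq big1 // => x xr.
rewrite linearZ /= coord_psum; case: eqP => [eql|_]; last exact: mulr0.
by rewrite eql map_f in lr.
Qed.

Lemma coord_inj f : (forall l, coord l f = 0) -> f = 0.
Proof.
have [r ->] := symfun_expand f => eq0.
pose ls := undup [seq x.2 | x <- r].
have {}eq0 l : \sum_(x <- r | x.2 == l) x.1 = 0.
  rewrite -[RHS](eq0 l) linear_sum big_mkcond; apply: eq_bigr => x _ /=.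
  by rewrite linearZ /= coord_psum eq_sym; case: eqP; rewrite ?mulr1 ?mulr0.
have -> : \sum_(x <- r) x.1 *: psum F x.2 =
    \sum_(l <- ls) \sum_(x <- r | x.2 == l) x.1 *: psum F l.
  rewrite (exchange_big_dep xpredT) //= big_seq [RHS]big_seq.
  apply: eq_bigr => x xr; rewrite -big_filter.
  have -> : [seq l <- ls | x.2 == l] = [:: x.2].
    have -> : [seq l <- ls | x.2 == l] = filter (pred1 x.2) ls.
      by apply: eq_filter => l; rewrite eq_sym.
    rewrite filter_pred1_uniq ?undup_uniq // mem_undup.
    exact: map_f.
  by rewrite big_seq1.
by rewrite big1 // => l _; rewrite -scaler_suml eq0 scale0r.
Qed.

(** The Hall inner product, see [hallE]. *)
Definition sprod f g : F :=
  \sum_(l \in [set: intpart]%classic) ((zee l)%:R * coord l f * coord l g).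

Lemma sprod_seq g : exists r : seq intpart, uniq r /\ forall f,
  sprod f g = \sum_(l <- r) (zee l)%:R * coord l f * coord l g.
Proof.
have [r [ur r0]] := coord_finite g; exists r; split=> // f.
rewrite /sprod (fsbigE r) //; first by apply: eq_bigl => l; rewrite in_setT.
by move=> l _ /r0 ->; rewrite mulr0.
Qed.

Lemma sprodC f g : sprod f g = sprod g f.
Proof. by apply: eq_fsbigr => l _; rewrite mulrAC. Qed.

Lemma sprod_scalar g : scalar (sprod^~ g).
Proof.
have [r [_ rE]] := sprod_seq g; move=> c f1 f2; rewrite !rE mulr_sumr -big_split.
apply: eq_bigr => l _ /=; rewrite linearP /=; ring.
Qed.

Lemma sprod_psum l m : sprod (psum F l) (psum F m) = (l == m)%:R * (zee l)%:R.
Proof.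
rewrite /sprod (fsbigE [:: l]) //; last first.
  move=> i _; rewrite inE coord_psum => /negPf->; by rewrite mulr0 mul0r.
by rewrite big_mkcond big_seq1 in_setT !coord_psum eqxx mulr1 mulrC eq_sym.
Qed.
End Coord.

(** * Adjoints of multiplications *)

Section Adjoint.
Variable F : fieldType.
Hypothesis natF_neq0 : forall n, n.+1%:R != 0 :> F.
Local Notation Sym := (symfun F).
Implicit Types (f g : Sym) (l m : intpart) (w v : nat -> F) (c : nat -> Sym).

Lemma sprodDl f1 f2 g : sprod (f1 + f2) g = sprod f1 g + sprod f2 g.
Proof. by have := sprod_scalar natF_neq0 g 1 f1 f2; rewrite scale1r mul1r. Qed.
Lemma sprod0l g : sprod 0 g = 0.
Proof. by apply: (addrI (sprod 0 g)); rewrite -sprodDl !addr0. Qed.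
Lemma sprodZl a f g : sprod (a *: f) g = a * sprod f g.
Proof.
by have := sprod_scalar natF_neq0 g a f 0; rewrite addr0 sprod0l addr0.
Qed.
Lemma sprodDr f g1 g2 : sprod f (g1 + g2) = sprod f g1 + sprod f g2.
Proof. by rewrite sprodC sprodDl ![sprod _ f]sprodC. Qed.
Lemma sprodZr a f g : sprod f (a *: g) = a * sprod f g.
Proof. by rewrite sprodC sprodZl sprodC. Qed.
Lemma sprod0r f : sprod f 0 = 0.
Proof. by rewrite sprodC sprod0l. Qed.
Lemma sprod_suml I (r : seq I) (P : pred I) (h : I -> Sym) g :
  sprod (\sum_(i <- r | P i) h i) g = \sum_(i <- r | P i) sprod (h i) g.
Proof.
by elim/big_rec2: _ => [|i y x _ <-]; rewrite ?sprod0l ?sprodDl.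
Qed.
Lemma sprod_sumr I (r : seq I) (P : pred I) (h : I -> Sym) f :
  sprod f (\sum_(i <- r | P i) h i) = \sum_(i <- r | P i) sprod f (h i).
Proof.
by elim/big_rec2: _ => [|i y x _ <-]; rewrite ?sprod0r ?sprodDr.
Qed.

Lemma zeeF_neq0 l : (zee l)%:R != 0 :> F.
Proof.
have : (0 < zee l)%N.
  rewrite /zee big_seq; apply: prodn_cond_gt0 => i.
  rewrite mem_undup => /part_pos i0.
  by rewrite muln_gt0 expn_gt0 i0 fact_gt0.
by case: (zee l).
Qed.

Lemma sprod_psum_coord l g : sprod (psum F l) g = (zee l)%:R * coord l g.
Proof.
rewrite /sprod (fsbigE [:: l]) //; last first.
  move=> i _; rewrite inE (coord_psum natF_neq0) => /negPf->.
  by rewrite mulr0 mul0r.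
by rewrite big_mkcond big_seq1 in_setT (coord_psum natF_neq0) eqxx mulr1.
Qed.

Lemma sprod_nondeg g : (forall f, sprod f g = 0) -> g = 0.
Proof.
move=> g0; apply: (coord_inj natF_neq0) => l; have := g0 (psum F l).
rewrite sprod_psum_coord.
by move/eqP; rewrite mulf_eq0 (negPf (zeeF_neq0 l)) => /eqP.
Qed.

Lemma der_p_psum k (s : seq nat) : all (fun j => (0 < j)%N) s ->
  der_p k.+1 (\prod_(j <- s) sf_p F j) =
  (k.+1 * count_mem k.+1 s)%:R *: \prod_(j <- rem k.+1 s) sf_p F j.
Proof.
elim: s => [_|j s IH /= /andP[j0 /IH {}IH]].
  by rewrite big_nil der_p1 // muln0 scale0r.
rewrite big_cons der_pM // {}IH; case: j j0 => // j _.
rewrite (der_p_p natF_neq0) eqSS -scalerAr; case: eqVneq => [->|_]; last first.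
  by rewrite mul0r add0r big_cons.
rewrite -scaler_nat -scalerAl mul1r.
have [ks|ks] := boolP (k.+1 \in s).
  rewrite -[sf_p F k.+1 * _](big_cons _ _ _ _ xpredT) -(perm_big _ (perm_to_rem ks)).
  by rewrite -scalerDl -natrD mulnDr muln1.
by rewrite (count_memPn ks) !muln0 scale0r addr0 addn0 muln1.
Qed.

(** Inserting a part k into l multiplies z_l by k times the new multiplicity of
    k, and so does the derivation on the power sum products. *)
Lemma sprod_p k f g : sprod (sf_p F k.+1 * f) g = sprod f (der_p k.+1 g).
Proof.
elim/(symfun_ind_psum natF_neq0): f g => [f f' IH IH' g|a f IH g|l g].
- by rewrite mulrDr !sprodDl IH IH'.
- by rewrite -scalerAr !sprodZl IH.
elim/(symfun_ind_psum natF_neq0): g => [g g' IH IH'|a g IH|m].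
- by rewrite linearD !sprodDr IH IH'.
- by rewrite linearZ !sprodZr IH.
rewrite (psum_cons F) (sprod_psum natF_neq0) /psum der_p_psum; last first.
  by apply/allP => j /part_pos.
have posrem : all (fun j => (0 < j)%N) (rem k.+1 m).
  by apply/allP => j /mem_rem /part_pos.
rewrite -(psum_perm F (part_ofP posrem)) sprodZr (sprod_psum natF_neq0).
have posl : all (fun j => (0 < j)%N) (k.+1 :: l) by apply/allP => j; rewrite inE => /orP[/eqP->|/part_pos].
have [km|km] := boolP (k.+1 \in (m : seq nat)); last first.
  rewrite (count_memPn km) muln0 mul0r; case: eqP => [eqm|_]; last by rewrite mul0r.
  case/negP: km; rewrite -eqm (perm_mem (part_ofP posl)) inE eqxx //.
set m' := part_of (rem k.+1 m).
have eqm : perm_eq m (k.+1 :: m').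
  rewrite (perm_trans (perm_to_rem km)) // perm_cons perm_sym.
  exact: part_ofP.
have -> : (part_of (k.+1 :: l) == m) = (l == m').
  apply/eqP/eqP => [eq1|->].
    apply: part_eq; rewrite -(perm_cons k.+1); apply: perm_trans eqm.
    by rewrite -eq1 perm_sym; apply: part_ofP.
  apply: part_eq; rewrite (perm_trans (part_ofP _)) 1?perm_sym //.
  by apply/allP => j; rewrite inE => /orP[/eqP->|/part_pos].
case: eqP => [eql|_]; last by rewrite !mul0r mulr0.
rewrite !mul1r eql -natrM (seq.permP eqm) /= eqxx add1n.
have -> : part_of (k.+1 :: m') = m.
  apply: part_eq; rewrite (perm_trans (part_ofP _)) 1?perm_sym //.
  by apply/allP => j; rewrite inE => /orP[/eqP->|/part_pos].
by rewrite (zee_cons eqm).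
Qed.

Lemma der_p_weighted w c k n : weighted w c ->
  der_p k.+1 (c n) = if (k < n)%N then w k.+1 *: c (n - k.+1)%N else 0.
Proof.
move=> nc; elim/ltn_ind: n => -[|n] IH.
  by rewrite (weighted0 nc) der_p1.
rewrite (weightedS_div natF_neq0 n nc) linearZ linear_sum /=.
rewrite (eq_bigr (fun i : 'I_n.+1 =>
    (if i == k :> nat then (k.+1%:R * w k.+1) *: c (n - k)%N else 0) +
    w i.+1 *: sf_p F i.+1 * (if (k < n - i)%N then w k.+1 *: c (n - i - k.+1)%N
                         else 0))); last first.
  move=> i _; rewrite der_pM // IH ?ltnS ?leq_subr //; congr (_ + _).
  rewrite linearZ /= (der_p_p natF_neq0) eqSS; case: eqP => [->|_].
    by rewrite -scalerAl [in LHS]mulr_natl -[RHS]scalerA scaler_nat scalerMnr.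
  by rewrite mulr0n scaler0 mul0r.
rewrite big_split /= ltnS; case: leqP => [lekn|ltnk]; last first.
  rewrite !big1 ?addr0 ?scaler0 // => i _.
    by rewrite ltnNge (leq_trans (leq_subr _ _) (ltnW ltnk)) mulr0.
  by case: eqP => // eqik; move: (ltn_ord i); rewrite eqik ltnNge ltnk.
rewrite -(big_mkcond (fun i : 'I_n.+1 => i == k :> nat)) /=.
have ltkn : (k < n.+1)%N by [].
rewrite (big_pred1 (Ordinal ltkn)) //.
have [m eqn] : exists m : nat, n = (k + m)%N by exists (n - k)%N; rewrite subnKC.
rewrite eqn subSS addKn.
have -> : \sum_(i < (k + m).+1) w i.+1 *: sf_p F i.+1 *
      (if (k < k + m - i)%N then w k.+1 *: c (k + m - i - k.+1)%N else 0) =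
    (m%:R * w k.+1) *: c m.
  transitivity (w k.+1 *: (\sum_(i < m) w i.+1 *: sf_p F i.+1 * c (m.-1 - i)%N)).
    rewrite scaler_sumr.
    rewrite (big_ord_widen_cond (k + m).+1 xpredT
      (fun i => w k.+1 *: (w i.+1 *: sf_p F i.+1 * c (m.-1 - i)%N))); last first.
      by rewrite leqW // leq_addl.
    rewrite big_mkcond /= [RHS]big_mkcond; apply: eq_bigr => i _ /=.
    have -> : (k < k + m - i)%N = (i < m)%N.
      by rewrite -{1}[k]addn0 ltn_subRL addnCA ltn_add2l addn0.
    case: ifP => ltim; last by rewrite mulr0.
    rewrite -scalerAr; congr (_ *: (_ * c _)).
    by lia.
  case: m eqn => [|m] _; first by rewrite big_ord0 scaler0 mul0r scale0r.
  by rewrite -(weightedS m nc) -scaler_nat scalerA mulrC.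
rewrite -scalerDl -mulrDl -natrD addSn scalerA mulrA mulVf ?mul1r //.
Qed.

(** The skewing operator obeys Newton's recursion in the same way as c; the
    adjunction for power sums carries the induction on g. *)
Lemma sprod_weighted w c j f g : weighted w c ->
  sprod (c j * f) g = sprod f (skew w j g).
Proof.
move=> nc; elim/(symfun_ind natF_neq0): g j f => [j f|g g' IH IH' j f|a g IH j f|k g IH j f].
- rewrite skew1; case: j => [|j]; first by rewrite (weighted0 nc) mul1r.
  rewrite sprod0r (weightedS_div natF_neq0 _ nc) -scalerAl sprodZl mulr_suml.
  rewrite sprod_suml big1 ?mulr0 // => i _.
  by rewrite -mulrA -scalerAl sprodZl sprod_p der_p1 // sprod0r mulr0.
- by rewrite linearD !sprodDr IH IH'.
- by rewrite linearZ !sprodZr IH.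
rewrite (skew_p natF_neq0) sprodDr.
rewrite sprodC sprod_p der_pM // sprodDr addrC; congr (_ + _).
  by rewrite sprodC IH [RHS]sprodC sprod_p sprodC.
rewrite (der_p_weighted _ _ nc); case: ifP => _.
  by rewrite -scalerAl sprodZr sprodC IH sprodZr.
by rewrite mul0r !sprod0r.
Qed.

Lemma rescale_psum w l :
  rescale w (psum F l) = (\prod_(k <- l) w k) *: psum F l.
Proof.
rewrite /psum; have : all (fun k => (0 < k)%N) l by apply/allP => k /part_pos.
elim: (l : seq nat) => [_|k s IH /= /andP[k0 s0]].
  by rewrite !big_nil scale1r rmorph1.
rewrite !big_cons rmorphM /= IH //; case: k k0 => // k _.
by rewrite (rescale_p natF_neq0) -scalerAl -scalerAr scalerA.
Qed.

Lemma sprod_rescale w f g : sprod (rescale w f) g = sprod f (rescale w g).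
Proof.
elim/(symfun_ind_psum natF_neq0): f => [f f' IH IH'|a f IH|l].
- by rewrite linearD !sprodDl IH IH'.
- by rewrite linearZ !sprodZl IH.
elim/(symfun_ind_psum natF_neq0): g => [g g' IH IH'|a g IH|m].
- by rewrite linearD !sprodDr IH IH'.
- by rewrite linearZ !sprodZr IH.
rewrite !rescale_psum sprodZl sprodZr (sprod_psum natF_neq0).
by case: eqP => [->//|_]; rewrite mul0r !mulr0.
Qed.

Lemma rescale_comp w v f :
  rescale w (rescale v f) = rescale (fun k => v k * w k) f.
Proof.
elim/(symfun_ind_psum natF_neq0): f => [f f' IH IH'|a f IH|l].
- by rewrite !linearD /= IH IH'.
- by rewrite !linearZ /= IH.
by rewrite !rescale_psum linearZ /= rescale_psum scalerA -big_split.
Qed.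

Lemma eq_rescale w v f : (forall k, w k.+1 = v k.+1) -> rescale w f = rescale v f.
Proof.
move=> eqw; apply: (hom_ext natF_neq0 (phi := rescale w) (psi := rescale v)).
  by move=> a /=; rewrite !rescaleZ !rmorph1.
by move=> k /=; rewrite !(rescale_p natF_neq0) eqw.
Qed.

Lemma diag_form_uniq (B B' : Sym -> Sym -> F) :
  bilinear_form B -> bilinear_form B' ->
  (forall l m, B (psum F l) (psum F m) = B' (psum F l) (psum F m)) ->
  forall f g, B f g = B' f g.
Proof.
move=> [Br Bl] [Br' Bl'] eqB f g.
have D (C : Sym -> F) : scalar C -> forall x y, C (x + y) = C x + C y.
  by move=> sC x y; have := sC 1 x y; rewrite scale1r mul1r.
have Z (C : Sym -> F) : scalar C -> forall a x, C (a *: x) = a * C x.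
  move=> sC a x; have := sC a x 0; rewrite !addr0 => ->.
  have := D _ sC 0 0; rewrite addr0 -{1}[C 0]addr0 => /addrI <-.
  by rewrite addr0.
elim/(symfun_ind_psum natF_neq0): f => [f f' IH IH'|a f IH|l].
- by rewrite (D _ (Bl g)) (D _ (Bl' g)) IH IH'.
- by rewrite (Z _ (Bl g)) (Z _ (Bl' g)) IH.
elim/(symfun_ind_psum natF_neq0): g => [g g' IH IH'|a g IH|m] //.
- by rewrite (D _ (Br _)) (D _ (Br' _)) IH IH'.
- by rewrite (Z _ (Br _)) (Z _ (Br' _)) IH.
Qed.

Lemma sprod_bilinear w : bilinear_form (fun f g => sprod f (rescale w g)).
Proof.
split=> [f a x y|g a x y] /=; last by rewrite sprodDl sprodZl.
by rewrite linearP sprodDr sprodZr.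
Qed.

(** Both forms are bilinear and take the same values on the products of power
    sums. *)
Lemma diag_form_psum w f g :
  diag_form (psum F) (fun l => (zee l)%:R * \prod_(k <- l) w k) f g =
  sprod f (rescale w g).
Proof.
pose S := [set B : Sym -> Sym -> F | bilinear_form B /\ forall l m,
  B (psum F l) (psum F m) =
  if l == m then (zee l)%:R * \prod_(k <- l) w k else 0]%classic.
have SB : S (fun f g => sprod f (rescale w g)).
  split=> [|l m]; first exact: sprod_bilinear.
  rewrite rescale_psum sprodZr (sprod_psum natF_neq0).
  by case: eqP => [->|_]; rewrite ?mul1r ?mul0r ?mulr0 // mulrC.
have [bB eB] : S (diag_form (psum F) (fun l => (zee l)%:R * \prod_(k <- l) w k)).
  by apply: xgetPex; exists (fun f g => sprod f (rescale w g)).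
apply: (diag_form_uniq bB (sprod_bilinear w)) => l m.
by rewrite eB; case: SB => _ ->.
Qed.

(** An exponential series in the power sums is multiplied by the scalar series
    exp (sum_k w_k v_k X^k / k) under the translation. *)
Lemma transl_weighted w v c (rho : fps F) n : weighted v c ->
  newton (fun k => w k.+1 * v k.+1) rho ->
  transl w (c n) = \sum_(i < n.+1) (rho i)%:A *: 'X^i * (c (n - i)%N)%:P.
Proof.
move=> nc nrho; pose io : {rmorphism F -> {poly Sym}} := @in_polyC F.
have n1 := newton_map (transl w : {rmorphism _ -> _}) nc.
have n2 := newton_mul (newton_scale 'X (newton_map io nrho))
  (newton_map (polyC : {rmorphism _ -> _}) nc).
have inj := mulrnS_inj io natF_neq0.
have eqf : fps_map (transl w : {rmorphism _ -> _}) c =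
    fps_scale 'X (fps_map io rho) * fps_map polyC c.
  apply: newton_uniq inj n1 _; apply: eq_newton n2; apply: fps_ext => k.
  rewrite fpsD /fps_map /= translZ (transl_p natF_neq0).
  rewrite scalerDr addrC /in_polyC /= -mul_polyC -rmorphM /= mulr_algl.
  by rewrite mulrC mul_polyC scalerA -scalerAl mul1r scalerA mulrC.
have -> : transl w (c n) = (fps_scale 'X (fps_map io rho) * fps_map polyC c) n.
  exact: (congr1 (fun h : fps _ => h n) eqf).
rewrite [LHS]fpsM; apply: eq_bigr => i _.
by congr (_ * _); rewrite /fps_scale /fps_map /= /in_polyC /= mulrC mul_polyC.
Qed.

Lemma skew_weighted w v c (rho : fps F) n j : weighted v c ->
  newton (fun k => w k.+1 * v k.+1) rho ->
  skew w j (c n) = if (j <= n)%N then rho j *: c (n - j)%N else 0.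
Proof.
move=> nc nrho; rewrite /skew (transl_weighted n nc nrho) coef_sum.
have coefE i : ((rho i)%:A *: 'X^i * (c (n - i)%N)%:P)`_j =
    if i == j then rho i *: c (n - i)%N else 0.
  rewrite -scalerAl coefZ coefMC coefXn eq_sym; case: eqP => _.
    by rewrite mul1r mulr_algl.
  by rewrite mul0r mulr0.
under eq_bigr do rewrite coefE.
rewrite -big_mkcond /=; case: leqP => [lejn|ltnj].
  rewrite (big_pred1 (inord j)) ?inordK // => i.
  by rewrite /= -val_eqE /= inordK.
by rewrite big1 // => i /eqP eqij; move: (ltn_ord i); rewrite eqij ltnS leqNgt ltnj.
Qed.

Lemma der_p_prod n k (h : 'I_n -> Sym) : der_p k (\prod_i h i) =
  \sum_i \prod_j (if j == i then der_p k (h j) else h j).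
Proof.
elim: n h => [|n IH] h; first by rewrite !big_ord0 der_p1.
rewrite big_ord_recl der_pM // IH [RHS]big_ord_recl; congr (_ + _).
  by rewrite big_ord_recl eqxx; congr (_ * _); apply: eq_bigr => j _.
rewrite mulr_sumr; apply: eq_bigr => i _; rewrite [RHS]big_ord_recl /=.
congr (_ * _); apply: eq_bigr => j _; by rewrite (inj_eq lift_inj).
Qed.

(** Both sides obey the same rule when f is multiplied by p_k: on the left the
    derivation k d/dp_k lowers one index a_i by k, on the right p_k is the sum
    of the x_i^k. *)
Lemma sprod_h n (a : 'X_{1..n}) f :
  sprod (\prod_(i < n) sf_h F (a i)) f = (sf_proj n f)@_a.
Proof.
elim/(symfun_ind natF_neq0): f a => [a|f g IHf IHg a|c f IHf a|k f IHf a].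
- rewrite rmorph1 mcoeff1.
  have -> : (a == 0%MM) = [forall i, a i == 0%N].
    apply/eqP/forallP => [-> i|a0]; first by rewrite mnmE.
    by apply/mnmP => i; rewrite mnm0E; apply/eqP/a0.
  have [/forallP a0|] := boolP [forall i, a i == 0%N].
    rewrite big1 => [|i _]; last by rewrite (eqP (a0 i)) (weighted0 (weighted_h F)).
    have <- : psum F (part_of [::]) = 1.
      by rewrite (psum_perm F (part_ofP _)) ?big_nil.
    rewrite (sprod_psum natF_neq0) eqxx mul1r /zee.
    by rewrite (perm_zee (part_ofP (s := [::]) isT)) big_nil.
  rewrite negb_forall => /existsP[i ai]; rewrite (bigD1 i) //=.
  by rewrite (sprod_weighted _ _ _ (weighted_h F)) skew1 (negPf ai) sprod0r.
- by rewrite sprodDr IHf IHg rmorphD mcoeffD.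
- by rewrite sprodZr IHf sf_projZ mcoeffZ.
rewrite sprodC sprod_p sprodC der_p_prod sprod_suml rmorphM mulr_suml.
rewrite raddf_sum; apply: eq_bigr => i _ /=.
rewrite mpolyXn mulrC mcoeffMX_le mnmUMn_le.
under eq_bigr do rewrite (der_p_weighted _ _ (weighted_h F)) scale1r.
case: ltnP => [ltka|leak]; last first.
  by rewrite (bigD1 i) //= eqxx ltnNge leak /= mul0r sprod0l.
rewrite -IHf; have -> : \prod_j (if j == i
      then if (k < a j)%N then sf_h F (a j - k.+1) else 0 else sf_h F (a j)) =
    \prod_(j < n) sf_h F ((a - U_(i) *+ k.+1)%MM j); last by [].
apply: eq_bigr => j _; rewrite mnmBE mulmnE mnm1E [i == j]eq_sym; case: eqVneq => [->|_]; last by rewrite mul0n subn0.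
by rewrite ltka mul1n.
Qed.
End Adjoint.

(** * Schur functions are orthonormal *)

Section Bialternant.
Variable F : fieldType.
Hypothesis natF_neq0 : forall n, n.+1%:R != 0 :> F.
Local Notation Sym := (symfun F).
Implicit Types (f g : Sym) (l m : intpart).

(** Padding with zeros makes room for any number n of variables. *)
Definition jt n (l : seq nat) : 'M[Sym]_n :=
  \matrix_(i, j) if (i <= nth 0%N l i + j)%N
                 then sf_h F (nth 0%N l i + j - i)%N else 0.

Lemma det_jtS n (l : seq nat) : (size l <= n)%N -> \det (jt n.+1 l) = \det (jt n l).
Proof.
move=> szl; rewrite (expand_det_row _ ord_max) (bigD1 ord_max) //=.
rewrite big1 ?addr0 => [|j nj]; last first.
  rewrite mxE nth_default //= add0n leqNgt.
  by rewrite ltn_neqAle -ltnS ltn_ord andbT nj mul0r.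
rewrite mxE nth_default //= leqnn add0n subnn (weighted0 (weighted_h F)) mul1r.
rewrite /cofactor addnn -signr_odd odd_double expr0 mul1r; congr (\det _).
apply/matrixP => i j; rewrite !mxE.
have -> : lift ord_max i = widen_ord (leqnSn n) i by exact/val_inj/lift_max.
by have -> : lift ord_max j = widen_ord (leqnSn n) j by exact/val_inj/lift_max.
Qed.

Lemma det_jt n l : (size l <= n)%N -> \det (jt n l) = schur F l.
Proof.
move=> szl; rewrite -(subnK szl); elim: (n - size l)%N => [//|k IH].
by rewrite addSn det_jtS // leq_addl.
Qed.

(** The antisymmetrization of the monomial x^a. *)
Definition alt n (a : 'I_n -> nat) : {mpoly F[n]} :=
  \det (\matrix_(k, i) 'X_k ^+ a i).
Definition rho n (i : 'I_n) : nat := (n.-1 - i)%N.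
Definition rho_plus n (l : seq nat) (i : 'I_n) : nat := (nth 0 l i + rho i)%N.

Definition mono n (a : 'I_n -> nat) : 'X_{1..n} := [multinom a i | i < n].

Lemma alt_leibniz n (a : 'I_n -> nat) :
  alt a = \sum_(s : 'S_n) (-1) ^+ s *: 'X_[mono (a \o s)].
Proof.
apply: eq_bigr => s _; rewrite -signr_odd.
rewrite mulr_sign -scaler_sign signr_odd; congr (_ *: _).
rewrite mpolyXE_id; apply: eq_bigr => i _.
by rewrite mxE mnmE.
Qed.

Lemma fps_prod_deg (A : comNzRingType) (I : Type) (s : seq I) (c : I -> A) r :
  (size s < r)%N -> (\prod_(i <- s) (1 + fps_const (c i) * fpsX A)) r = 0.
Proof.
elim: s r => [|i s IH] r /= ltr; first by rewrite big_nil fps1; case: r ltr.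
rewrite big_cons mulrDl mul1r fpsD IH ?(ltnW ltr) // add0r -mulrA fpsCM fpsXM.
by case: r ltr => // r; rewrite ltnS => /IH ->; rewrite mulr0.
Qed.

Lemma alg_inj_mpoly n : forall k, injective (fun x : {mpoly F[n]} => x *+ k.+1).
Proof. by move=> k; exact: (mulrnS_inj (@mpolyC n F)). Qed.

(** Both factors are exponentials, with opposite power sums. *)
Lemma mcompl_prod n : (mcompl F n : fps {mpoly F[n]}) *
  \prod_(i < n) (1 + fps_const (- 'X_i) * fpsX _) = 1.
Proof.
apply: (newton_uniq (@alg_inj_mpoly n) _ (newton1 _)).
have nprod (s : seq 'I_n) : newton (\sum_(i <- s) ((fun k => - 'X_i ^+ k.+1) : fps {mpoly F[n]}))
    (\prod_(i <- s) (1 + fps_const (- 'X_i) * fpsX _)).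
  elim: s => [|i s IH]; first by rewrite !big_nil; apply: newton1.
  rewrite !big_cons; apply: newton_mul IH.
  apply: eq_newton (newton_lin _); apply: fps_ext => k.
  by rewrite opprK.
apply: eq_newton (newton_mul (newton_mcompl F n) (nprod _)).
apply: fps_ext => k; rewrite fpsD fps0 /mpsum.
elim: (index_enum _) => [|i s IH]; first by rewrite !big_nil addr0.
by rewrite !big_cons fpsD addrACA IH addr0 subrr.
Qed.

Lemma mcompl_prod_but n (k : 'I_n) : (mcompl F n : fps {mpoly F[n]}) *
  \prod_(i < n | i != k) (1 + fps_const (- 'X_i) * fpsX _) =
  (fun r => 'X_k ^+ r).
Proof.
set P := \prod_(i < n | _) _.
have geo : (1 + fps_const (- 'X_k) * fpsX _) * (fun r => 'X_k ^+ r : {mpoly F[n]}) = 1.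
  apply: (newton_uniq (@alg_inj_mpoly n) _ (newton1 _)).
  apply: eq_newton (newton_mul (newton_lin _) (newton_geom _)).
  by apply: fps_ext => r; rewrite fpsD opprK addNr.
have := mcompl_prod n; rewrite (bigD1 k) //= -/P => eq1.
rewrite -[LHS]mulr1 -geo mulrA -(mulrA _ P) (mulrC P) eq1 mul1r //.
Qed.

(** Jacobi-Trudi times Vandermonde: multiplying the matrix (h_(a_i - r)) by the
    matrix of the coefficients of prod_(i != k) (1 - x_i u) gives (x_k^(a_i)). *)
Lemma alt_jt n l : alt (rho_plus (l : seq nat)) =
  sf_proj n (\det (jt n l)) * alt (@rho n).
Proof.
pose P k := \prod_(i < n | i != k) (1 + fps_const (- 'X_i) * fpsX {mpoly F[n]}).
pose M : 'M[{mpoly F[n]}]_n := \matrix_(k, j) P k (rho j).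
have Pdeg k r : (n <= r)%N -> P k r = 0.
  move=> len; rewrite /P (eq_bigl (mem (predC1 k))) // -big_enum fps_prod_deg //.
  by rewrite -cardE cardC1 card_ord; have := ltn_ord k; lia.
have key (m : seq nat) : \matrix_(k, i) 'X_k ^+ rho_plus m i =
    M *m (map_mx (sf_proj n) (jt n m))^T.
  apply/matrixP => k i; rewrite !mxE.
  have := congr1 (fun f : fps _ => f (rho_plus m i)) (mcompl_prod_but k) => /= <-.
  rewrite fpsMr -/(P k).
  transitivity (\sum_(r < n) if (r <= rho_plus m i)%N
      then mcompl F n (rho_plus m i - r) * P k r else 0).
    rewrite -!(big_mkord xpredT (fun r => mcompl F n (rho_plus m i - r) * P k r)).
    rewrite -(big_mkord xpredT (fun r => if (r <= rho_plus m i)%N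
      then mcompl F n (rho_plus m i - r) * P k r else 0)).
    rewrite -big_mkcond /=.
    set N := maxn n (rho_plus m i).+1.
    rewrite (big_nat_widen _ n N) ?leq_maxl //= (big_nat_widen _ _.+1 N) ?leq_maxr //=.
    rewrite big_mkcond [RHS]big_mkcond /=; apply: eq_bigr => r _; rewrite ltnS.
    case: (ltnP r n) => [_|lenr]; first by rewrite andbT.
    by rewrite Pdeg // mulr0 !if_same.
  rewrite (reindex_inj rev_ord_inj); apply: eq_bigr => j _; rewrite !mxE mulrC.
  have -> : rev_ord j = rho j :> nat by rewrite /rho /=; have := ltn_ord j; lia.
  have leE : (rho j <= rho_plus m i)%N = (i <= nth 0 m i + j)%N.
    by rewrite /rho_plus /rho; have := ltn_ord j; have := ltn_ord i; lia.
  rewrite leE; case: ifP => leij; last by rewrite rmorph0 mulr0.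
  congr (_ * _); rewrite /sf_proj /=; congr (mcompl _ _ _).
  by move: leij; rewrite /rho_plus /rho; have := ltn_ord j; have := ltn_ord i; lia.
have det1 : \det (map_mx (sf_proj n) (jt n [::])) = 1.
  have -> : \det (map_mx (sf_proj n) (jt n [::])) = sf_proj n (\det (jt n [::])).
    by rewrite -det_map_mx.
  rewrite (_ : \det (jt n [::]) = 1) ?rmorph1 //.
  by elim: (n) => [|k IH]; [exact: det_mx00 | rewrite det_jtS].
have altE (m : seq nat) : alt (rho_plus m) = \det M * \det (map_mx (sf_proj n) (jt n m)).
  by rewrite /alt key det_mulmx det_tr.
have altrho : alt (@rho n) = \det M.
  rewrite -[RHS]mulr1 -det1 -altE; congr (\det _); apply/matrixP => k i.
  by rewrite !mxE /rho_plus nth_nil.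
by rewrite altE altrho mulrC det_map_mx.
Qed.

(** Expand the Jacobi-Trudi and the Vandermonde determinants over permutations
    and pair each product of complete functions by [sprod_h]. *)
Lemma sprod_schur_coef n l f : (size l <= n)%N ->
  sprod (schur F l) f = (alt (@rho n) * sf_proj n f)@_(mono (rho_plus (l : seq nat))).
Proof.
move=> szl; rewrite -(det_jt szl) alt_leibniz mulr_suml raddf_sum.
rewrite (sprod_suml natF_neq0); apply: eq_bigr => s _ /=.
rewrite -scalerAl mcoeffZ -signr_odd mulr_sign -[in RHS]signr_odd.
transitivity ((-1) ^+ (odd s) * sprod (\prod_i jt n l i (s i)) f).
  rewrite mulr_sign; case: (odd s) => //.
  by rewrite -scaleN1r (sprodZl natF_neq0) mulN1r.
congr (_ * _); rewrite mulrC mcoeffMX_le.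
have leE : (mono (@rho n \o s) <= mono (rho_plus l))%MM =
    [forall i : 'I_n, (i <= nth 0 l i + s i)%N].
  apply/mnm_lepP/forallP => le i; have := le i; rewrite !mnmE /rho_plus /rho /=;
    have := ltn_ord i; have := ltn_ord (s i); lia.
rewrite leE; case: ifP => [/forallP le|/negbT]; last first.
  rewrite negb_forall => /existsP[i nle].
  by rewrite (bigD1 i) //= mxE (negPf nle) mul0r (sprod0l natF_neq0).
rewrite -(sprod_h natF_neq0); congr (sprod _ _); apply: eq_bigr => i _.
rewrite mxE le mnmBE !mnmE; congr (sf_h _ _).
by have := le i; rewrite /rho_plus /rho /=; have := ltn_ord i; have := ltn_ord (s i); lia.
Qed.

Lemma rho_plus_anti n l (i j : 'I_n) :
  (i < j)%N -> (rho_plus (l : seq nat) j < rho_plus l i)%N.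
Proof.
move=> ltij; have := ltn_ord j; rewrite /rho_plus /rho.
have : (nth 0 l j <= nth 0 l i)%N.
  have [ltj|lej] := ltnP j (size l); last by rewrite [nth _ _ j]nth_default.
  apply: (sorted_leq_nth (leT := geq)) => //; rewrite ?inE.
  - by move=> y x z lexy leyz; exact: leq_trans leyz lexy.
  - by move=> x; exact: leqnn.
  - by case: (l) => s /= /andP[].
  - exact: ltn_trans ltj.
  - exact: ltnW.
by lia.
Qed.

Lemma perm_mono1 n (s : 'S_n) :
  (forall i j : 'I_n, (i < j)%N -> (s i < s j)%N) -> s = 1%g.
Proof.
have le (u : 'S_n) : (forall i j : 'I_n, (i < j)%N -> (u i < u j)%N) ->
    forall i : 'I_n, (i <= u i)%N.
  move=> mu [i lti]; elim: i lti => [//|i IH] lti.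
  have lti' : (i < n)%N by exact: ltnW.
  apply: leq_ltn_trans (IH lti') _; exact: mu.
move=> ms; apply/permP => i; apply/val_inj/anti_leq; rewrite perm1 le // andbT.
rewrite -{2}(permK s i); apply: le => j k ltjk; rewrite ltnNge; apply/negP.
rewrite leq_eqVlt => /orP[/eqP/val_inj/perm_inj eqjk|/ms].
  by rewrite eqjk ltnn in ltjk.
by rewrite !permKV ltnNge ltnW.
Qed.

Lemma part_nth_eq l m : (forall i, nth 0%N l i = nth 0%N m i) -> l = m.
Proof.
have pos (k : intpart) i : (i < size k)%N = (0 < nth 0 k i)%N.
  have [lti|lei] := ltnP i (size k); last by rewrite nth_default.
  by rewrite (part_pos (mem_nth 0%N lti)).
have szE (k k' : intpart) : (forall i, nth 0%N k i = nth 0%N k' i) ->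
    (size k <= size k')%N.
  by move=> eqk; rewrite leqNgt; apply/negP; rewrite pos eqk -pos ltnn.
move=> eqn; apply: val_inj; apply: (@eq_from_nth _ 0%N) => //.
by apply/anti_leq/andP; split; apply: szE => i; rewrite eqn.
Qed.

(** The exponents rho + l decrease strictly, so only the identity permutation
    can map one such vector to another. *)
Lemma alt_rho_coef n l m : (size l <= n)%N -> (size m <= n)%N ->
  (alt (rho_plus (m : seq nat)))@_(mono (@rho_plus n l)) = (l == m)%:R.
Proof.
move=> szl szm; rewrite alt_leibniz raddf_sum /=.
rewrite (bigD1 (1%g : 'S_n)) //= odd_perm1 expr0 scale1r mcoeffX.
rewrite big1 ?addr0 => [|s s1]; last first.
  rewrite mcoeffZ mcoeffX; case: eqP => [eqm|_]; last by rewrite mulr0.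
  case/eqP: s1; apply: perm_mono1 => i j ltij.
  have eqk k : rho_plus m (s k) = rho_plus l k.
    by have := congr1 (fun a : 'X_{1..n} => a k) eqm; rewrite !mnmE.
  rewrite ltnNge; apply/negP; rewrite leq_eqVlt => /orP[/eqP/val_inj/perm_inj eqij|].
    by rewrite eqij ltnn in ltij.
  move=> /(rho_plus_anti m); rewrite !eqk ltnNge ltnW //.
  exact: rho_plus_anti.
congr (nat_of_bool _)%:R; apply/eqP/eqP => [eqm|->]; last first.
  by apply/mnmP => i; rewrite !mnmE /= perm1.
apply: part_nth_eq => i.
have [lti|lei] := ltnP i n; last by rewrite !nth_default // (leq_trans _ lei).
have := congr1 (fun a : 'X_{1..n} => a (Ordinal lti)) eqm; rewrite !mnmE /= perm1.
by rewrite /rho_plus => /addIn ->.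
Qed.

Lemma sprod_schur l m : sprod (schur F l) (schur F m) = (l == m)%:R.
Proof.
pose n := maxn (size l) (size m).
rewrite (sprod_schur_coef (n := n)) ?leq_maxl // mulrC.
rewrite -(@det_jt n m) ?leq_maxr // -alt_jt.
by rewrite alt_rho_coef ?leq_maxl ?leq_maxr.
Qed.

End Bialternant.

(** * The Hall inner product *)

(** The partitions of d, found among the multisets of the entries of the
    vectors in {0, ..., d}^d. *)
Definition parts_of d : seq intpart :=
  [seq l : intpart <- undup [seq part_of (map val t) | t : d.-tuple 'I_d.+1]
  | sumn l == d].

Lemma parts_of_uniq d : uniq (parts_of d).
Proof. by rewrite filter_uniq ?undup_uniq. Qed.

Lemma part_sumn_ge (l : intpart) : (size l <= sumn l)%N.
Proof.
have : all (fun k => (0 < k)%N) l by apply/allP => k /part_pos.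
by elim: (l : seq nat) => [//|k s IH] /= /andP[k0 /IH]; lia.
Qed.

Lemma nth_sumn (s : seq nat) i : (nth 0 s i <= sumn s)%N.
Proof.
by elim: s i => [|k s IH] [|i] //=; rewrite ?leq_addr // (leq_trans (IH i)) ?leq_addl.
Qed.

Lemma mem_parts_of d (l : intpart) : (l \in parts_of d) = (sumn l == d).
Proof.
rewrite mem_filter andbC; case: eqP => [suml|_]; last by rewrite andbF.
rewrite andbT mem_undup; apply/mapP.
exists [tuple (inord (nth 0%N l i) : 'I_d.+1) | i < d]; first by rewrite mem_enum.
apply: part_eq; rewrite perm_sym /= perm_sort.
have -> : [seq val i | i <- [tuple (inord (nth 0%N l i) : 'I_d.+1) | i < d]] =
    (l : seq nat) ++ nseq (d - size l) 0%N.
  apply: (@eq_from_nth _ 0%N) => [|i].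
    by rewrite size_map size_tuple size_cat size_nseq subnKC // -suml part_sumn_ge.
  rewrite size_map size_tuple => ltid.
  rewrite (nth_map ord0) ?size_tuple // -[i in nth ord0 _ i]/(val (Ordinal ltid)).
  rewrite -tnth_nth tnth_mktuple /= inordK ?ltnS -?suml ?nth_sumn //.
  rewrite nth_cat; case: ltnP => // lei; rewrite nth_default // nth_nseq.
  by case: ifP.
rewrite filter_cat (all_filterP _); last by apply/allP => k /part_pos.
by rewrite filter_nseq /= cats0.
Qed.

Section HallForm.
Variable F : fieldType.
Hypothesis natF_neq0 : forall n, n.+1%:R != 0 :> F.
Local Notation Sym := (symfun F).
Implicit Types (f g : Sym) (l m : intpart) (w v : nat -> F).

Lemma dhomog_scale n d (s : F) (p : {mpoly F[n]}) : p \is d.-homog ->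
  p \mPo [tuple s *: 'X_i | i < n] = s ^+ d *: p.
Proof.
move=> hp; rewrite comp_mpolyEX {3}[p]mpolyE scaler_sumr big_seq [RHS]big_seq.
apply: eq_bigr => m mp; rewrite comp_mpolyX scalerA mulrC -scalerA; congr (_ *: _).
rewrite -(dhomog_mf hp mp) [X in s ^+ X]mdegE expr_sum mpolyXE_id -scaler_prod.
by apply: eq_bigr => i _; rewrite tnth_mktuple exprZn.
Qed.

Lemma rescale_homog s d f : sf_homog d f ->
  rescale (fun k => s ^+ k) f = s ^+ d *: f.
Proof.
move=> hf; apply: symfun_ext => n; rewrite sf_projZ -(dhomog_scale s (hf n)).
pose phi : {rmorphism Sym -> {mpoly F[n]}} :=
  (sf_proj n \o rescale (fun k => s ^+ k)).
pose psi : {rmorphism Sym -> {mpoly F[n]}} :=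
  (comp_mpoly [tuple s *: 'X_i | i < n] \o sf_proj n).
apply: (hom_ext natF_neq0 (phi := phi) (psi := psi)) => [c|k].
  change (sf_proj n (rescale (fun k => s ^+ k) c%:A) =
    sf_proj n c%:A \mPo [tuple s *: 'X_i | i < n]).
  by rewrite rescaleZ rmorph1 !sf_projA comp_mpolyC.
rewrite /=.
rewrite (rescale_p natF_neq0) sf_projZ /sf_proj /= /mpsum scaler_sumr rmorph_sum.
apply: eq_bigr => i _ /=.
by rewrite rmorphXn /= comp_mpolyXU -tnth_nth tnth_mktuple exprZn.
Qed.

Lemma coord_rescale w l f :
  coord l (rescale w f) = (\prod_(k <- l) w k) * coord l f.
Proof.
elim/(symfun_ind_psum natF_neq0): f => [f g IH IH'|a f IH|m].
- by rewrite !linearD /= IH IH' mulrDr.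
- by rewrite !linearZ /= IH mulrCA.
rewrite (rescale_psum natF_neq0) linearZ /= (coord_psum natF_neq0).
by case: eqP => [->//|_]; rewrite !mulr0.
Qed.

Lemma prod_expr_sumn (s : F) (r : seq nat) :
  \prod_(k <- r) s ^+ k = s ^+ sumn r.
Proof. by elim: r => [|k r IH]; rewrite ?big_nil ?big_cons //= IH exprD. Qed.

Lemma coord_homog d f l : sf_homog d f -> sumn l <> d -> coord l f = 0.
Proof.
move=> hf nd; have := coord_rescale (fun k => 2%:R ^+ k) l f.
rewrite (rescale_homog _ hf) linearZ /= prod_expr_sumn => /eqP.
rewrite -subr_eq0 -mulrBl mulf_eq0 => /orP[|/eqP//].
have natinj (a b : nat) : (a < b)%N -> b%:R - a%:R == 0 :> F -> False.
  move=> ltab; rewrite -natrB 1?ltnW // -(subnSK ltab).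
  by apply/negP/natF_neq0.
rewrite -!natrX; case: (ltngtP (sumn l) d) => // [ltd|gtd].
  by move/natinj; rewrite ltn_exp2l // => /(_ ltd).
by rewrite -opprB oppr_eq0 => /natinj; rewrite ltn_exp2l // => /(_ gtd).
Qed.

Lemma sf_homog0 d : sf_homog d (0 : Sym).
Proof. by move=> n; exact: dhomog0. Qed.

Lemma sf_homogZ d a f : sf_homog d f -> sf_homog d (a *: f).
Proof. by move=> hf; rewrite -[a *: f]addr0; apply: sf_homog_lin => //; apply: sf_homog0. Qed.

Lemma sf_homog_sum d I (r : seq I) (h : I -> Sym) :
  (forall i, sf_homog d (h i)) -> sf_homog d (\sum_(i <- r) h i).
Proof.
move=> hh; apply: big_ind => //; first exact: sf_homog0.
by move=> f g hf hg; rewrite -[f]scale1r; apply: sf_homog_lin.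
Qed.

Lemma sf_h_homog k : sf_homog k (sf_h F k).
Proof. by move=> n; apply: rpred_sum => m mk; rewrite dhomogX /= mk. Qed.

Lemma schur_homog l : sf_homog (sumn l) (schur F l).
Proof.
apply: sf_homog_sum => s.
rewrite -signr_odd mulr_sign -scaler_sign; apply: sf_homogZ.
set J := \matrix_(_, _) _.
have [/forallP le|] := boolP [forall i : 'I_(size l), (i <= nth 0 l i + s i)%N]; last first.
  rewrite negb_forall => /existsP[i nle].
  by rewrite (bigD1 i) //= mxE (negPf nle) mul0r; apply: sf_homog0.
have -> : sumn l = (\sum_(i < size l) (nth 0 l i + s i - i))%N.
  rewrite sumnB // big_split /=.
  have <- : (\sum_(i < size l) i = \sum_(i < size l) s i)%N.
    by rewrite (reindex_inj (@perm_inj _ s)).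
  rewrite addnK.
  by rewrite sumnE (big_nth 0%N) big_mkord.
apply: (big_ind2 (fun d f => sf_homog d f)) => [|d1 f1 d2 f2|i _].
- exact: sf_homog1.
- exact: sf_homogM.
by rewrite mxE le; exact: sf_h_homog.
Qed.

(** Orthonormality makes the square matrix of Schur functions of degree d in
    terms of power sums invertible. *)
Lemma psum_schur l : exists b : intpart -> F,
  psum F l = \sum_(m <- parts_of (sumn l)) b m *: schur F m.
Proof.
set L := parts_of _; set N := size L; pose p (i : 'I_N) := nth l L i.
have pL i : p i \in L by apply: mem_nth.
have pd i : sumn (p i) = sumn l by apply/eqP; rewrite -mem_parts_of.
have pinj i j : (p i == p j) = (i == j) by rewrite nth_uniq ?parts_of_uniq.
have ex_p m : m \in L -> exists i, m = p i.
  move=> mL; have lti : (index m L < N)%N by rewrite index_mem.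
  by exists (Ordinal lti); rewrite /p nth_index.
pose C : 'M[F]_N := \matrix_(i, j) coord (p j) (schur F (p i)).
pose Z : 'M[F]_N := diag_mx (\row_i (zee (p i))%:R).
have schurE i : schur F (p i) = \sum_j C i j *: psum F (p j).
  apply/eqP; rewrite -subr_eq0; apply/eqP/(coord_inj natF_neq0) => m.
  rewrite linearB /= [X in _ - X]linear_sum.
  under eq_bigr do rewrite linearZ /= (coord_psum natF_neq0) mxE.
  have [/ex_p[j ->]|mL] := boolP (m \in L).
    rewrite (bigD1 j) //= eqxx mulr1 big1 ?addr0 ?subrr // => k kj.
    by rewrite pinj eq_sym (negPf kj) mulr0.
  rewrite (coord_homog (schur_homog (p i))) ?sub0r; last first.
    by rewrite pd => /eqP; rewrite -mem_parts_of (negPf mL).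
  rewrite big1 ?oppr0 // => j _; case: eqP => [eqm|_]; last by rewrite mulr0.
  by rewrite eqm pL in mL.
(* Orthonormality in matrix form: Z C^T is inverse to C, on both sides. *)
have CZC : C *m (Z *m C^T) = 1%:M.
  apply/matrixP => i j; rewrite mxE [RHS]mxE -pinj -(sprod_schur natF_neq0).
  rewrite [in RHS](schurE i) (sprod_suml natF_neq0); apply: eq_bigr => k _.
  rewrite (sprodZl natF_neq0); congr (_ * _); rewrite mul_diag_mx !mxE.
  by rewrite (sprod_psum_coord natF_neq0).
have [i ->] : exists i, l = p i by apply: ex_p; rewrite mem_parts_of.
pose B := Z *m C^T.
exists (fun m => \sum_j (m == p j)%:R * B i j).
rewrite (big_nth l) big_mkord -/N.
have -> : psum F (p i) = \sum_k (B *m C) i k *: psum F (p k).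
  rewrite /B (mulmx1C CZC) (bigD1 i) //= mxE eqxx scale1r big1 ?addr0 // => k ki.
  by rewrite mxE eq_sym (negPf ki) scale0r.
under eq_bigr do rewrite mxE scaler_suml.
rewrite exchange_big /=; apply: eq_bigr => j _; rewrite -/(p j).
have -> : \sum_k (p j == p k)%:R * B i k = B i j.
  rewrite (bigD1 j) //= eqxx mul1r big1 ?addr0 // => k kj.
  by rewrite pinj eq_sym (negPf kj) mul0r.
by rewrite schurE scaler_sumr; apply: eq_bigr => k _; rewrite scalerA.
Qed.

Lemma symfun_ind_schur (P : Sym -> Prop) :
  (forall f g, P f -> P g -> P (f + g)) -> (forall c f, P f -> P (c *: f)) ->
  (forall l, P (schur F l)) -> forall f, P f.
Proof.
move=> PD PZ Ps; apply: (symfun_ind_psum natF_neq0) => // l.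
have [b ->] := psum_schur l; apply: big_ind => // [|m _]; last exact/PZ/Ps.
by rewrite -(scale0r (schur F l)); apply: PZ.
Qed.

Lemma sprod_schur_nondeg f : (forall l, sprod f (schur F l) = 0) -> f = 0.
Proof.
move=> f0; apply: (sprod_nondeg natF_neq0).
apply: symfun_ind_schur => [g g' IH IH'|a g IH|l].
- by rewrite (sprodDl natF_neq0) IH IH' addr0.
- by rewrite (sprodZl natF_neq0) IH mulr0.
- by rewrite sprodC f0.
Qed.

Lemma schur_expand f :
  \sum_(l \in [set: intpart]%classic) sprod f (schur F l) *: schur F l = f.
Proof.
have [r [ur r0]] : exists r : seq intpart, uniq r /\
    forall l, l \notin r -> sprod f (schur F l) = 0.
  elim/symfun_ind_schur: f => [f g [r [ur r0]] [r' [ur' r0']]|a f [r [ur r0]]|l].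
  - exists (undup (r ++ r')); split=> [|l]; first exact: undup_uniq.
    rewrite mem_undup mem_cat negb_or => /andP[/r0 e /r0' e'].
    by rewrite (sprodDl natF_neq0) e e' addr0.
  - by exists r; split=> // l /r0 e; rewrite (sprodZl natF_neq0) e mulr0.
  - exists [:: l]; split=> // m; rewrite inE eq_sym => /negPf ne.
    by rewrite (sprod_schur natF_neq0) ne.
rewrite (fsbigE r) //; last by move=> l _ /r0 ->; rewrite scale0r.
rewrite (eq_bigl xpredT) => [|l]; last by rewrite in_setT.
apply/eqP; rewrite -subr_eq0; apply/eqP/sprod_schur_nondeg => m.
rewrite (sprodDl natF_neq0) -scaleN1r (sprodZl natF_neq0) (sprod_suml natF_neq0).
under eq_bigr do rewrite (sprodZl natF_neq0) (sprod_schur natF_neq0).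
have [mr|/r0 m0] := boolP (m \in r).
  rewrite (bigD1_seq m) //= eqxx mulr1 big1 ?addr0 ?mulN1r ?subrr // => l lm.
  by rewrite (negPf lm) mulr0.
rewrite m0 mulr0 addr0 big_seq big1 // => l lr; case: eqP => [eql|_].
  by rewrite eql m0 mul0r.
by rewrite mulr0.
Qed.

(** Both forms make the Schur functions orthonormal, and these span. *)
Lemma hallE f g : hall f g = sprod f g.
Proof.
pose S := [set B : Sym -> Sym -> F | bilinear_form B /\ forall l m,
  B (schur F l) (schur F m) = if l == m then 1 else 0]%classic.
have bS : bilinear_form (@sprod F).
  split=> [x a y z|x a y z] /=; last by rewrite (sprodDl natF_neq0) (sprodZl natF_neq0).
  by rewrite (sprodDr natF_neq0) (sprodZr natF_neq0).
have [bB eB] : S (@hall F).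
  apply: xgetPex; exists (@sprod F); split=> // l m.
  by rewrite (sprod_schur natF_neq0); case: eqP.
apply: (diag_form_uniq natF_neq0 bB bS) => l m.
have D (C : Sym -> F) : scalar C -> forall x y, C (x + y) = C x + C y.
  by move=> sC x y; have := sC 1 x y; rewrite scale1r mul1r.
have Z (C : Sym -> F) : scalar C -> forall a x, C (a *: x) = a * C x.
  move=> sC a x; have := sC a x 0; rewrite !addr0 => ->.
  have := D _ sC 0 0; rewrite addr0 -{1}[C 0]addr0 => /addrI <-.
  by rewrite addr0.
elim/symfun_ind_schur: (psum F l) => [x x' IH IH'|a x IH|l'].
- by rewrite (D _ (bB.2 _)) (D _ (bS.2 _)) IH IH'.
- by rewrite (Z _ (bB.2 _)) (Z _ (bS.2 _)) IH.
elim/symfun_ind_schur: (psum F m) => [x x' IH IH'|a x IH|m'].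
- by rewrite (D _ (bB.1 _)) (D _ (bS.1 _)) IH IH'.
- by rewrite (Z _ (bB.1 _)) (Z _ (bS.1 _)) IH.
by rewrite eB (sprod_schur natF_neq0); case: eqP.
Qed.

Lemma perp_weighted w c j f : weighted w c -> perp (c j) f = skew w j f.
Proof.
move=> nc.
have : forall g h, hall (c j * g) h = hall g (perp (c j) h).
  apply: (@xgetPex _ _ [set A | forall g h, hall (c j * g) h = hall g (A h)]%classic).
  by exists (skew w j) => g h; rewrite !hallE; exact: sprod_weighted.
move=> adj; apply/eqP; rewrite -subr_eq0; apply/eqP/(sprod_nondeg natF_neq0) => g.
rewrite (sprodDr natF_neq0) -scaleN1r (sprodZr natF_neq0) -!hallE -adj !hallE.
by rewrite (sprod_weighted natF_neq0 _ _ _ nc) mulN1r subrr.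
Qed.
End HallForm.

(** * Vertex operators *)

Lemma antidiag_sum (V : nmodType) (T : nat -> nat -> V) M N : (M + M <= N)%N ->
  (forall i j, (M <= i)%N || (M <= j)%N -> T i j = 0) ->
  \sum_(k < N) \sum_(i < k.+1) T i (k - i)%N = \sum_(i < M) \sum_(j < M) T i j.
Proof.
move=> leMN T0.
transitivity (\sum_(i < N) \sum_(k < N | (i <= k)%N) T i (k - i)%N).
  rewrite (exchange_big_dep xpredT) //=; apply: eq_bigr => k _.
  by rewrite (big_ord_widen_cond N xpredT (fun i => T i (k - i)%N)).
transitivity (\sum_(i < M) \sum_(k < N | (i <= k)%N) T i (k - i)%N).
  rewrite [RHS](big_ord_widen_cond N xpredT
    (fun i => \sum_(k < N | (i <= k)%N) T i (k - i)%N)); last by lia.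
  rewrite [RHS]big_mkcond; apply: eq_bigr => i _ /=; case: ltnP => // leMi.
  by rewrite big1 // => k _; rewrite T0 // leMi.
apply: eq_bigr => -[i ltiM] _ /=.
rewrite -(big_mkord (fun k => (i <= k)%N) (fun k => T i (k - i)%N)).
rewrite -(big_nat_widenl i 0 N xpredT) // -{1}[i]add0n big_addn.
have -> : (N - i)%N = (M + (N - i - M))%N by lia.
rewrite big_mkord big_split_ord /= [X in _ + X]big1 ?addr0; last first.
  by move=> j _; rewrite T0 // addnK leq_addr orbT.
by apply: eq_bigr => j _; rewrite addnK.
Qed.

Section Vertex.
Variable F : fieldType.
Hypothesis natF_neq0 : forall n, n.+1%:R != 0 :> F.
Local Notation Sym := (symfun F).
Implicit Types (f g : Sym) (l m : intpart) (w v : nat -> F).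

Lemma eq_skew w v j f : (forall k, w k.+1 = v k.+1) -> skew w j f = skew v j f.
Proof.
move=> eqw; rewrite /skew; congr (nth _ (polyseq _) j).
pose phi : {rmorphism Sym -> {poly Sym}} := transl w.
pose psi : {rmorphism Sym -> {poly Sym}} := transl v.
apply: (hom_ext natF_neq0 (phi := phi) (psi := psi)) => [a|k] /=.
  by rewrite !translZ !rmorph1.
by rewrite !(transl_p natF_neq0) eqw.
Qed.

Definition weighted_seq w n : Sym := rescale w (sf_h F n).
Lemma weighted_seqP w : weighted w (weighted_seq w).
Proof.
apply: eq_weighted (weighted_rescale natF_neq0 w (weighted_h F)) => k.
by rewrite mulr1.
Qed.

Lemma sprod_inj f g : (forall x, sprod x f = sprod x g) -> f = g.
Proof.
move=> eqfg; apply/eqP; rewrite -subr_eq0; apply/eqP/(sprod_nondeg natF_neq0) => x.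
by rewrite (sprodDr natF_neq0) -scaleN1r (sprodZr natF_neq0) eqfg mulN1r subrr.
Qed.

(** Adjoint to the product of two exponential series. *)
Lemma skewD w v k f : skew (fun k => w k + v k) k f =
  \sum_(i < k.+1) skew w i (skew v (k - i)%N f).
Proof.
apply: sprod_inj => x; rewrite (sprod_sumr natF_neq0).
have nw := weighted_seqP w; have nv := weighted_seqP v.
rewrite -(sprod_weighted natF_neq0 _ _ _ (weighted_mul nw nv)) mulr_suml.
rewrite (sprod_suml natF_neq0); apply: eq_bigr => i _.
rewrite -(sprod_weighted natF_neq0 _ _ _ nw) -(sprod_weighted natF_neq0 _ _ _ nv).
by rewrite mulrA mulrC mulrA (mulrC (weighted_seq v _)) -mulrA mulrC.
Qed.

Lemma skewS w s k f : skew (fun k => s ^+ k * w k) k f = s ^+ k *: skew w k f.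
Proof.
apply: sprod_inj => x; rewrite (sprodZr natF_neq0).
have nw := weighted_seqP w.
rewrite -(sprod_weighted natF_neq0 _ _ _ (weighted_scale s nw)).
by rewrite -(sprod_weighted natF_neq0 _ _ _ nw) -scalerAl (sprodZl natF_neq0).
Qed.

Lemma skew_bound2 w v f : exists M, forall i j, (M <= i)%N || (M <= j)%N ->
  skew w i (skew v j f) = 0.
Proof.
pose N := size (transl v f).
exists (N + \sum_(j < N) size (transl w (skew v j f)))%N => i j le.
have [leNj|ltjN] := leqP N j.
  by rewrite [skew v j f]nth_default // linear0.
apply: nth_default; case/orP: le => [le|]; last by lia.
apply: leq_trans le; rewrite -[j in transl w (skew v j f)]/(val (Ordinal ltjN)).
by rewrite (bigD1 (Ordinal ltjN)) //= addnCA leq_addr.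
Qed.

(** The double sums of the definitions of H_m^t and its conjugate collapse,
    since translations compose. *)
Lemma fsum_vertex w v (a b : F) (H : nat -> Sym) r f :
  exists N0, forall N, (N0 <= N)%N ->
  \sum_(ij \in [set: nat * nat]%classic)
    (b ^+ ij.2 * a ^+ ij.1) *:
      (H (r + ij.1 + ij.2)%N * skew w ij.1 (skew v ij.2 f)) =
  \sum_(k < N) H (r + k)%N * skew (fun k => a ^+ k * w k + b ^+ k * v k) k f.
Proof.
have [M M0] := skew_bound2 w v f; exists (M + M)%N => N leMN.
pose T i j := (b ^+ j * a ^+ i) *: (H (r + i + j)%N * skew w i (skew v j f)).
have T0 i j : (M <= i)%N || (M <= j)%N -> T i j = 0.
  by move=> /M0; rewrite /T => ->; rewrite mulr0 scaler0.
transitivity (\sum_(i < M) \sum_(j < M) T i j); last first.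
  rewrite -(antidiag_sum leMN T0); apply: eq_bigr => k _; rewrite skewD mulr_sumr.
  apply: eq_bigr => i _; rewrite !skewS /T linearZ /= scalerA -scalerAr mulrC.
  by rewrite -addnA subnKC // -ltnS.
rewrite (fsbigE [seq (i, j) | i <- iota 0 M, j <- iota 0 M]) //.
- rewrite (eq_bigl xpredT) => [|ij]; last by rewrite in_setT.
  rewrite big_allpairs -(big_mkord xpredT (fun i => \sum_(j < M) T i j)).
  rewrite /index_iota subn0; apply: eq_bigr => i _.
  by rewrite -(big_mkord xpredT (fun j => T i j)) /index_iota subn0.
- by apply: allpairs_uniq; rewrite ?iota_uniq // => -[i j] [i' j'] _ _ [-> ->].
move=> [i j] _ nij; have := T0 i j; rewrite /T /= => -> //.
rewrite (leqNgt M i) (leqNgt M j) -negb_and; apply: contra nij => /andP[ltiM ltjM].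
by apply: (allpairs_f (fun i j => (i, j))); rewrite mem_iota.
Qed.

(** The translation is a polynomial, so its size bounds the sum. *)
Definition vertex (H : nat -> Sym) w (r : nat) f : Sym :=
  \sum_(k < size (transl w f)) H (r + k)%N * skew w k f.

Lemma vertexE H w r f N : (size (transl w f) <= N)%N ->
  vertex H w r f = \sum_(k < N) H (r + k)%N * skew w k f.
Proof.
move=> leN; rewrite /vertex (big_ord_widen N (fun k => H (r + k)%N * skew w k f)) //.
rewrite big_mkcond; apply: eq_bigr => k _; case: ltnP => // lek.
by rewrite /skew nth_default // mulr0.
Qed.

Lemma vertex_is_linear H w r : linear (vertex H w r).
Proof.
move=> a f g.
pose N := (size (transl w f) + size (transl w g)
  + size (transl w (a *: f + g)%R))%N.
rewrite !(@vertexE H w r _ N); try by rewrite /N; lia.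
rewrite scaler_sumr -big_split; apply: eq_bigr => k _ /=.
by rewrite linearP mulrDr scalerAr.
Qed.
HB.instance Definition _ H w r :=
  GRing.isLinear.Build F Sym Sym *:%R (vertex H w r) (vertex_is_linear H w r).

Lemma HopE t r f : Hop t r f = vertex (sf_h F) (fun k => t ^+ k - 1) r f.
Proof.
have [N0 N0P] := fsum_vertex (fun k => (-1) ^+ k.-1) (fun=> 1) (-1) t (sf_h F) r f.
set w := fun k => _; rewrite (@vertexE _ _ _ _ (N0 + size (transl w f))) ?leq_addl //.
have /N0P eqN := leq_addr (size (transl w f)) N0.
transitivity (\sum_(ij \in [set: nat * nat]%classic) (t ^+ ij.2 * (-1) ^+ ij.1) *:
      (sf_h F (r + ij.1 + ij.2)%N *
       skew (fun k => (-1) ^+ k.-1) ij.1 (skew (fun=> 1) ij.2 f))).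
  apply: eq_fsbigr => ij _; rewrite (perp_weighted natF_neq0 _ _ (weighted_e F)).
  by rewrite (perp_weighted natF_neq0 _ _ (weighted_h F)).
rewrite eqN; apply: eq_bigr => k _; congr (_ * _); apply: eq_skew => j.
by rewrite mulr1 exprS -mulrA -expr2 sqrr_sign mulr1 addrC.
Qed.

Lemma homog_expand d f : sf_homog d f ->
  f = \sum_(l <- parts_of d) coord l f *: psum F l.
Proof.
move=> hf; apply/eqP; rewrite -subr_eq0; apply/eqP/(coord_inj natF_neq0) => m.
rewrite linearB linear_sum /=.
under eq_bigr do rewrite linearZ /= (coord_psum natF_neq0).
have [mp|mp] := boolP (m \in parts_of d).
  rewrite (bigD1_seq m) ?parts_of_uniq //= eqxx mulr1 big1 ?addr0 ?subrr // => l lm.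
  by rewrite eq_sym (negPf lm) mulr0.
rewrite (coord_homog natF_neq0 hf) => [|/eqP]; last by rewrite -mem_parts_of (negPf mp).
rewrite sub0r big_seq big1 ?oppr0 // => l lp; case: eqP => [eqm|_]; last by rewrite mulr0.
by rewrite -eqm (negPf mp) in lp.
Qed.

Lemma skew_homog w d j f : sf_homog d f -> (d < j)%N -> skew w j f = 0.
Proof.
move=> /homog_expand -> ltdj; rewrite linear_sum big_seq big1 // => l.
rewrite mem_parts_of => /eqP suml; rewrite linearZ /=.
have : (sumn l < j)%N by rewrite suml.
have : all (fun k => (0 < k)%N) l by apply/allP => k /part_pos.
rewrite /psum => l0 ltlj; rewrite [skew _ _ _](_ : _ = 0) ?scaler0 //.
elim: (l : seq nat) j l0 ltlj {ltdj} => [|k s IH] j /=.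
  by rewrite big_nil skew1; case: j.
case: k => // k /IH {}IH ltj; rewrite big_cons (skew_p natF_neq0).
by rewrite !IH ?mulr0 ?scaler0 ?if_same ?addr0 //; lia.
Qed.

(** On functions of degree n the factor t^(n-j) is produced by the scaling
    p_k -> t^k p_k, which makes sense for all symmetric functions. *)
Definition hbar_weight (t : F) (k : nat) : F := (-1) ^+ k - (- t^-1) ^+ k.
Definition Hbar_op (t : F) (r : nat) f : Sym :=
  vertex (sf_e F) (hbar_weight t) r (rescale (fun k => t ^+ k) f).

Lemma Hbar_op_linear t r : linear (Hbar_op t r).
Proof. by move=> a f g; rewrite /Hbar_op !linearP. Qed.

Lemma Hbar_homogE t r n f : t != 0 -> sf_homog n f ->
  Hbar_homog t r n f = Hbar_op t r f.
Proof.
move=> t0 hf.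
have [N0 N0P] := fsum_vertex (fun=> 1) (fun k => (-1) ^+ k.-1) (-1) t^-1
  (sf_e F) r (t ^+ n *: f).
rewrite /Hbar_op (@vertexE _ _ _ _
  (N0 + size (transl (hbar_weight t) (rescale (fun k => t ^+ k) f))));
  last exact: leq_addl.
rewrite (rescale_homog natF_neq0 _ hf).
have /N0P eqN := leq_addr (size (transl (hbar_weight t) (t ^+ n *: f))) N0.
transitivity (\sum_(ij \in [set: nat * nat]%classic) (t^-1 ^+ ij.2 * (-1) ^+ ij.1) *:
      (sf_e F (r + ij.1 + ij.2)%N *
       skew (fun=> 1) ij.1 (skew (fun k => (-1) ^+ k.-1) ij.2 (t ^+ n *: f)))).
  apply: eq_fsbigr => -[i j] _ /=; rewrite (perp_weighted natF_neq0 _ _ (weighted_e F)).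
  rewrite (perp_weighted natF_neq0 _ _ (weighted_h F)).
  have [lejn|ltnj] := leqP j n; last first.
    by rewrite linearZ /= (skew_homog _ hf) // !linear0 mulr0 !scaler0.
  rewrite !linearZ /= -scalerAr scalerA; congr (_ *: _).
  rewrite mulrAC; congr (_ * _).
  by rewrite -[in RHS](subnKC lejn) exprD mulrA -exprMn mulVf // expr1n mul1r.
rewrite eqN; apply: eq_bigr => k _; congr (_ * _); apply: eq_skew => j.
rewrite /hbar_weight mulr1 [(- t^-1) ^+ _]exprNn [(-1) ^+ j.+1]exprS /=; ring.
Qed.

Lemma HbarE t r n f : t != 0 -> sf_homog n f -> Hbar t r f = Hbar_op t r f.
Proof.
move=> t0 hf.
have [_ HP] : [set A : Sym -> Sym | linear A /\
    forall n f, sf_homog n f -> A f = Hbar_homog t r n f]%classic (Hbar t r).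
  apply: xgetPex; exists (Hbar_op t r); split; first exact: Hbar_op_linear.
  by move=> d g hg; rewrite Hbar_homogE.
by rewrite (HP n) // Hbar_homogE.
Qed.
End Vertex.

(** * Generating functions in two variables *)

Section TwoVariables.
Variable A : comNzRingType.

(** A series f as f(u), respectively f(v), in the ring of series in u with
    coefficients in series in v. *)
Definition inu : fps A -> fps (fps A) := fps_map (@fps_const A).
HB.instance Definition _ := GRing.RMorphism.copy inu (fps_map (@fps_const A)).
Definition inv2 : fps A -> fps (fps A) := @fps_const (fps A).
HB.instance Definition _ := GRing.RMorphism.copy inv2 (@fps_const (fps A)).

Lemma inuM_coef (f : fps A) X i j :
  (inu f * X) i j = \sum_(a < i.+1) f (i - a)%N * X a j.
Proof.
rewrite fpsMr; elim/big_rec2: _ => [//|a x y _ <-].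
by rewrite fpsD /inu /fps_map fpsCM.
Qed.

Lemma inv2M_coef (f : fps A) X i j :
  (inv2 f * X) i j = \sum_(b < j.+1) f (j - b)%N * X i b.
Proof. by rewrite /inv2 fpsCM fpsMr. Qed.

Lemma inu_inv2_coef (f g : fps A) i j : (inu f * inv2 g) i j = f i * g j.
Proof. by rewrite mulrC /inv2 fpsCM /inu /fps_map mulrC fpsCM. Qed.

(** The kernel sum_(a, b) g_(r+a+b) u^a v^b of a vertex operator acting on a
    product of two series. *)
Definition kern (g : nat -> A) r : fps (fps A) := fun a b => g (r + a + b)%N.
Definition tail (g : nat -> A) r : fps A := fun a => g (r + a)%N.

Lemma tail_rec g r : tail g r = fps_const (g r) + fpsX A * tail g r.+1.
Proof.
apply: fps_ext => -[|n]; rewrite fpsD fpsXM /tail /= ?addr0 ?addn0 //.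
by rewrite add0r addnS.
Qed.

Lemma kern_recu g r : kern g r = inv2 (tail g r) + fpsX _ * kern g r.+1.
Proof.
apply: fps_ext => -[|a]; rewrite fpsD fpsXM; apply: fps_ext => b; rewrite fpsD.
  by rewrite /kern /inv2 /= /tail addn0 fps0 addr0.
by rewrite /inv2 /= fps0 add0r /kern addnS.
Qed.

Lemma kern_recv g r : kern g r = inu (tail g r) + inv2 (fpsX _) * kern g r.+1.
Proof.
apply: fps_ext => a; rewrite fpsD /inv2 fpsCM; apply: fps_ext => -[|b].
  by rewrite fpsD fpsXM /inu /fps_map /= addr0 /kern /tail addn0.
by rewrite fpsD fpsXM /inu /fps_map /= add0r /kern !addnS.
Qed.

(** The generating series of the values of a vertex operator on the products
    E_i E_j, when the translation only multiplies E by a geometric series. *)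
Definition vgen (g : nat -> A) (E : fps A) r := kern g r * inu E * inv2 E.

Lemma vgen_coef g E r i j : vgen g E r i j =
  \sum_(a < i.+1) \sum_(b < j.+1) g (r + a + b)%N * (E (i - a)%N * E (j - b)%N).
Proof.
rewrite /vgen mulrC mulrA mulrC inuM_coef; apply: eq_bigr => a _.
rewrite inv2M_coef mulr_sumr; apply: eq_bigr => b _.
by rewrite /kern; ring.
Qed.

(** The analogue of [vgen] for a single factor E(u). *)
Definition agen (g : nat -> A) (E : fps A) r := tail g r * E.

Lemma agen0 g E : agen g E 0 = (g : fps A) * E.
Proof. by congr (_ * _); apply: fps_ext. Qed.

Lemma agen_rec g E r : agen g E r = fps_const (g r) * E + fpsX A * agen g E r.+1.
Proof. by rewrite /agen {1}tail_rec; ring. Qed.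

Lemma vgen_recv g E r :
  vgen g E r = inv2 E * inu (agen g E r) + inv2 (fpsX _) * vgen g E r.+1.
Proof. by rewrite /vgen {1}kern_recv /agen rmorphM /=; ring. Qed.

(** The kernel telescopes: its recursions in u and in v both produce the
    kernel for r + 1. *)
Lemma vgen_diff g E r : (inu (fpsX A) - inv2 (fpsX A)) * vgen g E r.+1 =
  inv2 E * inu (agen g E r) - inu E * inv2 (agen g E r).
Proof.
have eq1 : vgen g E r = inu E * inv2 (agen g E r) + inu (fpsX _) * vgen g E r.+1.
  by rewrite /vgen {1}kern_recu /agen rmorphM /= /inu fps_mapX; ring.
have eq2 := vgen_recv g E r; rewrite mulrBl.
have -> : inu (fpsX A) * vgen g E r.+1 = vgen g E r - inu E * inv2 (agen g E r).
  by rewrite eq1; ring.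
have -> : inv2 (fpsX A) * vgen g E r.+1 = vgen g E r - inv2 E * inu (agen g E r).
  by rewrite eq2; ring.
by ring.
Qed.

Definition scale2 (s s' : A) (X : fps (fps A)) : fps (fps A) :=
  fps_scale (fps_const s) (fps_map (fps_scale s') X).
HB.instance Definition _ s s' := GRing.RMorphism.copy (scale2 s s')
  (fps_scale (fps_const s) \o fps_map (fps_scale s')).

Lemma scale2_inu s s' f : scale2 s s' (inu f) = inu (fps_scale s f).
Proof.
apply: fps_ext => i; rewrite /scale2 /inu /fps_scale /fps_map /=.
rewrite -rmorphXn /= -[LHS]/(fps_const (s ^+ i) * fps_scale s' (fps_const (f i))).
by rewrite fps_scaleC -rmorphM.
Qed.

Lemma scale2_inv s s' f : scale2 s s' (inv2 f) = inv2 (fps_scale s' f).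
Proof.
apply: fps_ext => -[|i]; rewrite /scale2 /inv2 /fps_scale /fps_map /=.
  by rewrite expr0 mul1r.
by rewrite [X in _ * X](rmorph0 (fps_scale s')) mulr0.
Qed.

Lemma scale2_coef s s' X i j : scale2 s s' X i j = s ^+ i * (s' ^+ j * X i j).
Proof. by rewrite /scale2 /fps_scale /fps_map -rmorphXn /= fpsCM. Qed.

(** The coefficients of X are determined one after the other, by induction on
    the exponent of v. *)
Lemma lin_reg (s s' : A) : GRing.lreg s -> forall X : fps (fps A),
  (fps_const (fps_const s) * fpsX _ - fps_const (fps_const s') * inv2 (fpsX A)) * X = 0 ->
  X = 0.
Proof.
move=> sreg X eq0.
have rec i j : s * X i j - (if j is j'.+1 then s' * X i.+1 j' else 0) = 0.
  have /= := congr1 (fun Y : fps (fps A) => Y i.+1 j) eq0.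
  have e1 : (fps_const (fps_const s) * (fpsX _ * X)) i.+1 j = s * X i j.
    by rewrite fpsCM fpsXM fpsCM.
  have e2 : (fps_const (fps_const s') * (inv2 (fpsX A) * X)) i.+1 j =
      if j is j'.+1 then s' * X i.+1 j' else 0.
    rewrite fpsCM fpsCM /inv2 fpsCM fpsXM.
    by case: (j) => [|j'] //; rewrite mulr0.
  by rewrite mulrBl -!mulrA fpsB fpsB e1 e2.
apply: fps_ext => i; apply: fps_ext => j; rewrite !fps0.
elim: j i => [|j IH] i; apply: sreg; rewrite mulr0; have := rec i.
  by move=> /(_ 0%N); rewrite subr0.
by move=> /(_ j.+1); rewrite IH mulr0 subr0.
Qed.
End TwoVariables.

(** * The identity behind the commutation relation *)

Section Identity.
Variable R : comNzRingType.
Variables (q t c : R).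

(** The image of E(u) E(v) under K, multiplied by (xy)^2 (x - y), for x = u,
    y = v, A = E(u), A' = E(tu), B = E(v), B' = E(tv) and c = E_1; see
    [hat_H3op_num]. *)
Definition num_K (x y A A' B B' : R) : R :=
  (1 - q) * (- (y ^+ 2 * B * (A' - A - (t - 1) * c * x * A)
                - x ^+ 2 * A * (B' - B - (t - 1) * c * y * B))
             - q ^+ 2 * (y ^+ 2 * B' * (A - A' - (1 - t) * c * x * A')
                         - x ^+ 2 * A' * (B - B' - (1 - t) * c * y * B')))
  + q * (1 - t) * c * (x * y) *
    (y * B * (A' - A) - x * A * (B' - B)
     + q * (y * B' * (A - A') - x * A' * (B - B'))).

(** The image of E(u) E(v) under D, multiplied by x - y, where now A' = E(u/t)
    and B' = E(v/t); see [hat_mac_num]. *)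
Definition num_D (x y A A' B B' : R) : R :=
  q ^+ 2 * (x - y) * (A * B) + q * (1 - q) * (x - y) * (A' * B + A * B')
  + (1 - q) ^+ 2 * (y * (A' * B - A * B') + (x - y) * (A' * B)).

(** The same for E_1 E(u) E(v), multiplied by t xy (x - y); see
    [hat_mac_plE1_num]. *)
Definition num_Dc (x y A A' B B' : R) : R :=
  t * c * (x * y) * num_D x y A A' B B'
  + (1 - q) * (q ^+ 2 * (1 - t) * c * (x * y) * (x - y) * (A * B)
     + t * q * (1 - q) * (x - y) * (y * B * (A' - A) + x * A * (B' - B))
     + t * (1 - q) ^+ 2 * (x * y) * (A' * B - A * B')).

(** [num_K] as a linear expression in products of series, to which a further
    linear operator can be applied termwise. *)
Definition lin_K (x y d11 d12 d21 d22 c11 c12 c21 c22 : R) : R :=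
  (1 - q) * (y ^+ 2 - x ^+ 2) * d11
  + (1 - q) * (x ^+ 2 - q ^+ 2 * y ^+ 2) * d12
  + (1 - q) * (q ^+ 2 * x ^+ 2 - y ^+ 2) * d21
  + q ^+ 2 * (1 - q) * (y ^+ 2 - x ^+ 2) * d22
  + (1 - t) * (x * y) * ((1 - q) * (x - y) + q * (x - y)) * c11
  + q * (1 - t) * (x * y) * (q * y - x) * c12
  + q * (1 - t) * (x * y) * (y - q * x) * c21
  + q ^+ 2 * (1 - t) * (x * y) * ((1 - q) * (y - x) + (x - y)) * c22.

Lemma num_KE x y A A' B B' : num_K x y A A' B B' =
  lin_K x y (A * B) (A * B') (A' * B) (A' * B')
    (c * (A * B)) (c * (A * B')) (c * (A' * B)) (c * (A' * B')).
Proof. by rewrite /num_K /lin_K; ring. Qed.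

(** D K requires D on the four products E(t^i u) E(t^j v) with i, j in {1, 2},
    with and without a factor E_1, and K D requires K on three products. All
    arguments are multiplied by t, so that E(u/t) does not occur: Ai stands for
    E(t^i u) and Bj for E(t^j v). The hypotheses determine these values up to
    denominators; the factor in the conclusion clears all denominators, after
    which the relation is a polynomial identity. *)
Lemma commutation_num (x y A0 A1 A2 B0 B1 B2 : R)
    (d11 d12 d21 d22 c11 c12 c21 c22 K11 K01 K10 DK KD : R) :
  (t * x - t * y) * d11 = num_D (t * x) (t * y) A1 A0 B1 B0 ->
  (t * x - t * (t * y)) * d12 = num_D (t * x) (t * (t * y)) A1 A0 B2 B1 ->
  (t * (t * x) - t * y) * d21 = num_D (t * (t * x)) (t * y) A2 A1 B1 B0 ->
  (t * (t * x) - t * (t * y)) * d22 =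
    num_D (t * (t * x)) (t * (t * y)) A2 A1 B2 B1 ->
  t * ((t * x) * (t * y)) * (t * x - t * y) * c11 =
    num_Dc (t * x) (t * y) A1 A0 B1 B0 ->
  t * ((t * x) * (t * (t * y))) * (t * x - t * (t * y)) * c12 =
    num_Dc (t * x) (t * (t * y)) A1 A0 B2 B1 ->
  t * ((t * (t * x)) * (t * y)) * (t * (t * x) - t * y) * c21 =
    num_Dc (t * (t * x)) (t * y) A2 A1 B1 B0 ->
  t * ((t * (t * x)) * (t * (t * y))) * (t * (t * x) - t * (t * y)) * c22 =
    num_Dc (t * (t * x)) (t * (t * y)) A2 A1 B2 B1 ->
  ((t * x) * (t * y)) ^+ 2 * (t * x - t * y) * K11 =
    num_K (t * x) (t * y) A1 A2 B1 B2 ->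
  (x * (t * y)) ^+ 2 * (x - t * y) * K01 = num_K x (t * y) A0 A1 B1 B2 ->
  ((t * x) * y) ^+ 2 * (t * x - y) * K10 = num_K (t * x) y A1 A2 B0 B1 ->
  ((t * x) * (t * y)) ^+ 2 * (t * x - t * y) * DK =
    lin_K (t * x) (t * y) d11 d12 d21 d22 c11 c12 c21 c22 ->
  (t * x - t * y) * KD =
    q ^+ 2 * (t * x - t * y) * K11 + q * (1 - q) * (t * x - t * y) * (K01 + K10)
    + (1 - q) ^+ 2 * (t * y * (K01 - K10) + (t * x - t * y) * K01) ->
  t ^+ 12 * (x ^+ 3 * y ^+ 3) * (x - y) ^+ 2 * (t * x - y) * (x - t * y) *
    (t * DK - KD - q ^+ 3 * (t - 1) * K11) = 0.
Proof.
move=> h11 h12 h21 h22 k11 k12 k21 k22 hK11 hK01 hK10 hDK hKD.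
pose P := t ^+ 12 * (x ^+ 3 * y ^+ 3) * (x - y) ^+ 2 * (t * x - y) * (x - t * y).
pose X := t * x; pose Y := t * y.
(* Distribute P over the terms so that every value occurs multiplied by the
   denominator in its hypothesis. *)
have eDK : P * (t * DK) =
    t ^+ 8 * (x * y) * (x - y) * (t * x - y) * (x - t * y) *
    (((t * x) * (t * y)) ^+ 2 * (t * x - t * y) * DK).
  by rewrite /P; ring.
have eK11 : P * K11 =
    t ^+ 7 * (x * y) * (x - y) * (t * x - y) * (x - t * y) *
    (((t * x) * (t * y)) ^+ 2 * (t * x - t * y) * K11).
  by rewrite /P; ring.
have eKD : P * KD =
    t ^+ 11 * (x ^+ 3 * y ^+ 3) * (x - y) * (t * x - y) * (x - t * y) *
    ((t * x - t * y) * KD).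
  by rewrite /P; ring.
have eKD' : t ^+ 11 * (x ^+ 3 * y ^+ 3) * (x - y) * (t * x - y) * (x - t * y) *
   (q ^+ 2 * (t * x - t * y) * K11 + q * (1 - q) * (t * x - t * y) * (K01 + K10)
    + (1 - q) ^+ 2 * (t * y * (K01 - K10) + (t * x - t * y) * K01)) =
   q ^+ 2 * (t ^+ 7 * (x * y) * (x - y) * (t * x - y) * (x - t * y)) *
     (((t * x) * (t * y)) ^+ 2 * (t * x - t * y) * K11)
   + (q * (1 - q) * (x - y) + (1 - q) ^+ 2 * (y + (x - y))) *
     (t ^+ 10 * (x * y) * (x - y) * (t * x - y)) *
     ((x * (t * y)) ^+ 2 * (x - t * y) * K01)
   + (q * (1 - q) * (x - y) - (1 - q) ^+ 2 * y) *
     (t ^+ 10 * (x * y) * (x - y) * (x - t * y)) *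
     (((t * x) * y) ^+ 2 * (t * x - y) * K10).
  by ring.
have eDK' : t ^+ 8 * (x * y) * (x - y) * (t * x - y) * (x - t * y) *
    lin_K (t * x) (t * y) d11 d12 d21 d22 c11 c12 c21 c22 =
  lin_K X Y
   (t ^+ 7 * (x * y) * (t * x - y) * (x - t * y) * ((t * x - t * y) * d11))
   (t ^+ 7 * (x * y) * (x - y) * (t * x - y) * ((t * x - t * (t * y)) * d12))
   (t ^+ 7 * (x * y) * (x - y) * (x - t * y) * ((t * (t * x) - t * y) * d21))
   (t ^+ 6 * (x * y) * (t * x - y) * (x - t * y) *
      ((t * (t * x) - t * (t * y)) * d22))
   (t ^+ 4 * (t * x - y) * (x - t * y) *
      (t * ((t * x) * (t * y)) * (t * x - t * y) * c11))
   (t ^+ 3 * (x - y) * (t * x - y) *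
      (t * ((t * x) * (t * (t * y))) * (t * x - t * (t * y)) * c12))
   (t ^+ 3 * (x - y) * (x - t * y) *
      (t * ((t * (t * x)) * (t * y)) * (t * (t * x) - t * y) * c21))
   (t * (t * x - y) * (x - t * y) *
      (t * ((t * (t * x)) * (t * (t * y))) * (t * (t * x) - t * (t * y)) * c22)).
  by rewrite /lin_K /X /Y; ring.
transitivity (P * (t * DK) - P * KD - q ^+ 3 * (t - 1) * (P * K11)).
  by rewrite /P; ring.
rewrite eDK hDK eDK' h11 h12 h21 h22 k11 k12 k21 k22.
rewrite eKD hKD eKD' eK11 hK11 hK01 hK10.
rewrite /lin_K /num_Dc /num_D /num_K /X /Y; ring.
Qed.
End Identity.

(** * Vertex operators on products of two E_k *)

Section Engine.
Variable F : fieldType.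
Hypothesis natF_neq0 : forall n, n.+1%:R != 0 :> F.
Variables q t : F.
Hypothesis t_neq0 : t != 0.
Hypothesis t_nroot : forall k, 1 - t ^+ k.+1 != 0.
Local Notation Sym := (symfun F).
Implicit Types (f g : Sym) (l m : intpart) (w v : nat -> F).

(** The function e_n[X/(1-t)]. *)
Definition plE (n : nat) : Sym := rescale (fun k => (1 - t ^+ k)^-1) (sf_e F n).
Local Notation E := (plE : fps Sym).
Definition wE (k : nat) : F := (1 - t ^+ k)^-1 * (-1) ^+ k.-1.

Lemma weightedE : weighted wE plE.
Proof. exact: (weighted_rescale natF_neq0 _ (weighted_e F)). Qed.

Lemma wE_mul k : (1 - t ^+ k.+1) * wE k.+1 = (-1) ^+ k.
Proof. by rewrite /wE mulrA divff ?mul1r. Qed.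

(** Products of exponential series are compared through their weights. *)
Lemma weighted_rel w v u c d e : weighted w c -> weighted v d -> weighted u e ->
  (forall k, w k.+1 + v k.+1 = u k.+1) -> (c : fps Sym) * (d : fps Sym) = e.
Proof.
move=> nc nd ne eqw; apply: fps_ext => n.
apply: (weighted_uniq natF_neq0 _ ne).
exact: eq_weighted (weighted_mul nc nd).
Qed.

Lemma fps_scaleA (s : F) (c : fps Sym) :
  fps_scale s%:A c = (fun n => s ^+ n *: c n) :> fps Sym.
Proof. by apply: fps_ext => n; rewrite /fps_scale exprZn expr1n mulr_algl. Qed.

Definition hsign n : Sym := (-1) ^+ n *: sf_h F n.
Definition elow n : Sym := t^-1 ^+ n *: sf_e F n.

(** The three multiplicative relations below replace h_n and e_n by quotients
    of E(u), E(tu) and E(u/t): this is what closes the computation. *)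
Lemma rel_h : (hsign : fps Sym) * E = fps_scale t%:A E.
Proof.
rewrite fps_scaleA; apply: weighted_rel (weighted_scale (-1) (weighted_h F))
  weightedE (weighted_scale t weightedE) _ => k.
rewrite mulr1 exprS mulN1r -wE_mul; ring.
Qed.

Lemma rel_e : (sf_e F : fps Sym) * fps_scale t%:A E = E.
Proof.
rewrite fps_scaleA; apply: weighted_rel (weighted_e F)
  (weighted_scale t weightedE) weightedE _ => k.
rewrite /= -wE_mul; ring.
Qed.

Lemma rel_elow : (elow : fps Sym) * E = fps_scale t^-1%:A E.
Proof.
rewrite fps_scaleA; apply: weighted_rel (weighted_scale t^-1 (weighted_e F))
  weightedE (weighted_scale t^-1 weightedE) _ => k.
rewrite /= -wE_mul mulrA mulrBr mulr1 -exprMn mulVf // expr1n; ring.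
Qed.

Lemma plE0 : plE 0 = 1.
Proof. exact: weighted0 weightedE. Qed.

Lemma plE1 : sf_e F 1 = (1 - t) *: plE 1.
Proof.
have e1 := weightedS_div natF_neq0 0 weightedE.
rewrite big_ord1 subnn plE0 mulr1 invr1 scale1r in e1.
have e2 := weightedS_div natF_neq0 0 (weighted_e F).
rewrite big_ord1 subnn (weighted0 (weighted_e F)) mulr1 invr1 scale1r in e2.
by rewrite e2 e1 scalerA -[1 - t]/(1 - t ^+ 1) wE_mul.
Qed.

Lemma plE1_p : plE 1 = (1 - t)^-1 *: sf_p F 1.
Proof.
have -> : sf_p F 1 = sf_e F 1.
  have e2 := weightedS_div natF_neq0 0 (weighted_e F).
  by rewrite e2 big_ord1 subnn (weighted0 (weighted_e F)) mulr1 invr1 !scale1r.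
by rewrite plE1 scalerA mulVf ?scale1r // -[t]expr1.
Qed.

(** A translation multiplies the series of c by the scalar series rho. *)
Lemma vertex_prod H w v (c : nat -> Sym) (rho : fps F) r i j : weighted v c ->
  newton (fun k => w k.+1 * v k.+1) rho ->
  vertex H w r (c i * c j) = \sum_(a < i.+1) \sum_(b < j.+1)
    (rho a * rho b) *: (H (r + a + b)%N * (c (i - a)%N * c (j - b)%N)).
Proof.
move=> nc nrho.
pose T a b := if (a <= i)%N && (b <= j)%N then
  (rho a * rho b) *: (H (r + a + b)%N * (c (i - a)%N * c (j - b)%N)) else 0.
pose M := (maxn i j).+1.
have T0 a b : (M <= a)%N || (M <= b)%N -> T a b = 0.
  by move=> leM; rewrite /T; case: ifP => //; rewrite /M in leM *; lia.
pose N := (M + M + size (transl w (c i * c j)%R))%N.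
rewrite (@vertexE _ _ _ _ _ N) ?leq_addl //.
transitivity (\sum_(k < N) \sum_(a < k.+1) T a (k - a)%N).
  apply: eq_bigr => k _; rewrite (skewM w) mulr_sumr; apply: eq_bigr => a _.
  rewrite !(skew_weighted natF_neq0 _ _ nc nrho) /T -addnA subnKC; last by rewrite -ltnS.
  case: leqP => leai; last by rewrite mul0r mulr0.
  case: leqP => lebj; last by rewrite !mulr0.
  by rewrite -scalerAl -!scalerAr scalerA.
rewrite (antidiag_sum (M := M)) ?leq_addr //.
have leiM : (i.+1 <= M)%N by rewrite ltnS leq_maxl.
have lejM : (j.+1 <= M)%N by rewrite ltnS leq_maxr.
rewrite [RHS](big_ord_widen_cond M xpredT (fun a => \sum_(b < j.+1)
    (rho a * rho b) *: (H (r + a + b)%N * (c (i - a)%N * c (j - b)%N)))) //.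
rewrite [RHS]big_mkcond; apply: eq_bigr => a _ /=; rewrite ltnS.
case: leqP => leai; last by rewrite big1 // => b _; rewrite /T leqNgt leai.
rewrite (big_ord_widen_cond M xpredT (fun b =>
    (rho a * rho b) *: (H (r + a + b)%N * (c (i - a)%N * c (j - b)%N)))) //.
rewrite [RHS]big_mkcond; apply: eq_bigr => b _ /=.
by rewrite /T leai ltnS.
Qed.

Lemma vertex_geom H w v (c : nat -> Sym) (s : F) r i j : weighted v c ->
  (forall k, w k.+1 * v k.+1 = s ^+ k.+1) ->
  s ^+ r *: vertex H w r (c i * c j) = vgen (fun n => s ^+ n *: H n) c r i j.
Proof.
move=> nc eqw.
have nr : newton (fun k => w k.+1 * v k.+1) (fun n => s ^+ n).
  by apply: eq_newton (newton_geom s); apply: fps_ext => k; rewrite eqw.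
rewrite (vertex_prod _ _ _ _ nc nr) vgen_coef scaler_sumr; apply: eq_bigr => a _.
rewrite scaler_sumr; apply: eq_bigr => b _.
by rewrite scalerA -scalerAl -!exprD addnA.
Qed.

Lemma Hop_gen r i j :
  Hop t r (plE i * plE j) = (-1) ^+ r *: vgen hsign plE r i j.
Proof.
rewrite (HopE natF_neq0).
have eqw k : (t ^+ k.+1 - 1) * wE k.+1 = (-1) ^+ k.+1.
  by rewrite -opprB mulNr wE_mul exprS mulN1r.
rewrite -(vertex_geom (sf_h F) (w := fun k => t ^+ k - 1) r i j weightedE eqw).
by rewrite scalerA -exprMn mulrNN mulr1 expr1n scale1r.
Qed.

Lemma Hbar_gen r i j : Hbar_op t r (plE i * plE j) =
  vgen (sf_e F) (fps_scale t%:A E) r i j.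
Proof.
rewrite /Hbar_op rmorphM /=.
have resc k : rescale (fun k => t ^+ k) (plE k) = fps_scale t%:A E k.
  rewrite fps_scaleA; exact: (weighted_uniq natF_neq0
    (weighted_rescale natF_neq0 (fun k => t ^+ k) weightedE)
    (weighted_scale t weightedE) k).
rewrite !resc; have nF : weighted (fun k => t ^+ k * wE k) (fps_scale t%:A E).
  by rewrite fps_scaleA; apply: weighted_scale weightedE.
have eqw k : hbar_weight t k.+1 * (t ^+ k.+1 * wE k.+1) = 1 ^+ k.+1.
  rewrite /hbar_weight expr1n [(- t^-1) ^+ _]exprNn.
  transitivity ((-1) ^+ k.+1 * ((1 - t^-1 ^+ k.+1) * t ^+ k.+1) * wE k.+1).
    ring.
  rewrite mulrBl mul1r -exprMn mulVf // expr1n -opprB mulrN mulNr -mulrA wE_mul.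
  by rewrite exprS mulN1r mulNr opprK -expr2 sqrr_sign.
have := vertex_geom (sf_e F) r i j nF eqw.
have -> : (fun n => 1 ^+ n *: sf_e F n) = sf_e F.
  by apply: funext => n; rewrite expr1n scale1r.
by rewrite expr1n scale1r.
Qed.

Definition mac_weight k : F := (-1) ^+ k.-1 * ((1 - q ^+ k) * (1 - t ^+ k)).
(** Macdonald's operator, transported by the plethysm X -> X/(1-t). *)
Definition mac : Sym -> Sym := vertex elow mac_weight 0.
HB.instance Definition _ := GRing.Linear.copy mac (vertex elow mac_weight 0).

(** The series (1 - q X) / (1 - X). *)
Definition mac_rho : fps F := fun n => if n is 0 then 1 else 1 - q.

Lemma mac_rhoP : newton (fun k => mac_weight k.+1 * wE k.+1) mac_rho.
Proof.
have -> : mac_rho = ((fun n => 1 ^+ n) : fps F) * (1 + fps_const (- q) * fpsX F).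
  rewrite mulrC; apply: fps_ext => n.
  rewrite mulrDl mul1r fpsD -mulrA fpsCM fpsXM.
  by case: n => [|n] /=; rewrite ?expr0 ?mulr0 ?addr0 // !expr1n mulr1.
apply: eq_newton (newton_mul (newton_geom 1) (newton_lin (- q))).
apply: fps_ext => k; rewrite fpsD opprK expr1n /mac_weight -mulrA -mulrA.
by rewrite wE_mul mulrCA -expr2 sqrr_sign mulr1.
Qed.

(** Writing the coefficients of (1 - qX)/(1 - X) as q [a = 0] + (1 - q) splits
    the double sum of [vertex_prod] into three kinds of terms. *)
Definition ygen r : fps (fps Sym) :=
  fps_const (fps_const (q ^+ 2 *: elow r)) * inu E * inv2 E
  + fps_const (fps_const (q * (1 - q))%:A) *
      (inv2 E * inu (agen elow E r) + inu E * inv2 (agen elow E r))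
  + fps_const (fps_const ((1 - q) ^+ 2)%:A) * vgen elow E r.

Lemma mac_gen r i j :
  vertex elow mac_weight r (plE i * plE j) = ygen r i j.
Proof.
rewrite (vertex_prod _ _ _ _ weightedE mac_rhoP).
pose T a b := elow (r + a + b)%N * (plE (i - a)%N * plE (j - b)%N).
have rhoE a : mac_rho a = q * (a == 0%N)%:R + (1 - q).
  by case: a => [|a] /=; rewrite ?mulr1 ?mulr0 ?add0r // addrC subrK.
have sum0 n (h : nat -> Sym) : \sum_(a < n.+1) (a == 0 :> nat)%:R *: h a = h 0%N.
  rewrite big_ord_recl /= scale1r big1 ?addr0 // => a _.
  by rewrite /= scale0r.
transitivity (q ^+ 2 *: T 0%N 0%N
  + (q * (1 - q)) *: (\sum_(a < i.+1) T a 0%N + \sum_(b < j.+1) T 0%N b)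
  + (1 - q) ^+ 2 *: \sum_(a < i.+1) \sum_(b < j.+1) T a b).
  transitivity (\sum_(a < i.+1)
    (q ^+ 2 *: ((a == 0 :> nat)%:R *: T a 0%N)
     + (q * (1 - q)) *: (T a 0%N + (a == 0 :> nat)%:R *: \sum_(b < j.+1) T a b)
     + (1 - q) ^+ 2 *: \sum_(b < j.+1) T a b)).
    apply: eq_bigr => a _; rewrite -/(T a).
    transitivity (\sum_(b < j.+1) (mac_rho a * q) *: ((b == 0 :> nat)%:R *: T a b)
      + \sum_(b < j.+1) (mac_rho a * (1 - q)) *: T a b).
      rewrite -big_split; apply: eq_bigr => b _ /=; rewrite scalerA -scalerDl.
      by congr (_ *: _); rewrite [in LHS](rhoE b); ring.
    rewrite -!scaler_sumr sum0 rhoE !scalerDr !scalerA.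
    set X := \sum_(b < _) _; set c0 := (_ == _)%:R.
    have -> : (q * c0 + (1 - q)) * q = q ^+ 2 * c0 + q * (1 - q) by ring.
    have -> : (q * c0 + (1 - q)) * (1 - q) = q * (1 - q) * c0 + (1 - q) ^+ 2 by ring.
    by rewrite !scalerDl -!addrA.
  rewrite !big_split /= -!scaler_sumr (sum0 i (fun a => T a 0%N)) big_split /=.
  by rewrite (sum0 i (fun a => \sum_(b < j.+1) T a b)).
rewrite /ygen !fpsD; congr (_ + _ + _).
- by rewrite -mulrA !fpsCM inu_inv2_coef /T !addn0 !subn0 -[RHS]scalerAl.
- rewrite !fpsCM mulr_algl fpsD; congr (_ *: (_ + _)).
    rewrite mulrC inu_inv2_coef /agen fpsM mulr_suml; apply: eq_bigr => a _.
    by rewrite /T addn0 subn0 mulrA.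
  rewrite inu_inv2_coef /agen fpsM mulr_sumr; apply: eq_bigr => b _.
  by rewrite /T addn0 subn0 mulrCA.
- by rewrite !fpsCM mulr_algl vgen_coef.
Qed.

(** E_1 is a multiple of p_1, so the translation adds a single term. *)
Lemma skew_plE1 k f : skew mac_weight k (plE 1 * f) =
  plE 1 * skew mac_weight k f +
  (if k is k'.+1 then (1 - q) *: skew mac_weight k' f else 0).
Proof.
rewrite plE1_p -scalerAl linearZ /= (skew_p natF_neq0) scalerDr scalerAl.
congr (_ + _); case: k => [|k]; first by rewrite scaler0.
rewrite subSS subn0 scalerA /mac_weight mul1r !expr1 mulrCA mulVf ?mulr1 //.
by rewrite -[t]expr1.
Qed.

Lemma mac_plE1 f : mac (plE 1 * f) =
  plE 1 * mac f + (1 - q) *: vertex elow mac_weight 1 f.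
Proof.
pose N := (size (transl mac_weight f) + size (transl mac_weight (plE 1 * f)%R))%N.
rewrite /mac (@vertexE _ _ _ _ (plE 1 * f) N.+1); last by rewrite /N; lia.
rewrite (@vertexE _ _ _ _ f N.+1); last by rewrite /N; lia.
rewrite (@vertexE _ _ _ 1 f N) ?leq_addr //.
rewrite mulr_sumr scaler_sumr.
under eq_bigr do rewrite skew_plE1 mulrDr mulrCA.
rewrite big_split /=; congr (_ + _).
rewrite big_ord_recl mulr0 add0r; apply: eq_bigr => k _.
by rewrite -scalerAr.
Qed.
End Engine.

(** * Operators acting on series coefficientwise *)

Section Hat.
Variable F : fieldType.
Local Notation Sym := (symfun F).
Local Notation S2 := (fps (fps Sym)).

Definition hat (L : Sym -> Sym) (X : S2) : S2 := fun i j => L (X i j).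

(** The series over which the coefficientwise action of a linear operator is
    linear. *)
Definition scalar_series (s : S2) := exists p : fps (fps F),
  s = fps_map (fps_map (GRing.in_alg Sym)) p.

Lemma hatD (L : {linear Sym -> Sym}) X Y : hat L (X + Y) = hat L X + hat L Y.
Proof. by apply: fps_ext => i; apply: fps_ext => j; exact: linearD. Qed.

Lemma hatM (L : {linear Sym -> Sym}) s X : scalar_series s ->
  hat L (s * X) = s * hat L X.
Proof.
move=> [p ->]; apply: fps_ext => i; apply: fps_ext => j.
have coefE (Y : S2) : (fps_map (fps_map (GRing.in_alg Sym)) p * Y) i j =
    \sum_(a < i.+1) \sum_(b < j.+1) p a b *: Y (i - a)%N (j - b)%N.
  rewrite fpsM; elim/big_rec2: _ => [//|a x y _ <-]; rewrite fpsD; congr (_ + _).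
  by rewrite fpsM; apply: eq_bigr => b _; rewrite /fps_map mulr_algl.
rewrite coefE /hat coefE linear_sum; apply: eq_bigr => a _.
by rewrite linear_sum; apply: eq_bigr => b _; rewrite linearZ.
Qed.

Definition const2 (a : F) : S2 := fps_const (fps_const a%:A).
Definition vu : S2 := inu (fpsX Sym).
Definition vv : S2 := inv2 (fpsX Sym).

Lemma scalarD s s' : scalar_series s -> scalar_series s' -> scalar_series (s + s').
Proof. by move=> [p ->] [p' ->]; exists (p + p'); rewrite rmorphD. Qed.
Lemma scalarN s : scalar_series s -> scalar_series (- s).
Proof. by move=> [p ->]; exists (- p); rewrite rmorphN. Qed.
Lemma scalarM s s' : scalar_series s -> scalar_series s' -> scalar_series (s * s').
Proof. by move=> [p ->] [p' ->]; exists (p * p'); rewrite rmorphM. Qed.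
Lemma scalar1 : scalar_series 1.
Proof. by exists 1; rewrite rmorph1. Qed.
Lemma scalarX s n : scalar_series s -> scalar_series (s ^+ n).
Proof. by move=> [p ->]; exists (p ^+ n); rewrite rmorphXn. Qed.
Lemma scalar_const2 a : scalar_series (const2 a).
Proof.
exists (fps_const (fps_const a)); rewrite fps_mapC /=; congr (fps_const _).
by rewrite [RHS]fps_mapC.
Qed.
Lemma scalar_vu : scalar_series vu.
Proof. by exists (fpsX _); rewrite fps_mapX /vu /inu fps_mapX. Qed.
Lemma scalar_vv : scalar_series vv.
Proof. by exists (fps_const (fpsX _)); rewrite fps_mapC /= [X in fps_const X]fps_mapX. Qed.

Lemma const2D a b : const2 (a + b) = const2 a + const2 b.
Proof. by rewrite /const2 scalerDl !rmorphD. Qed.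
Lemma const2M a b : const2 (a * b) = const2 a * const2 b.
Proof. by rewrite /const2 -!rmorphM mulr_algl scalerA. Qed.
Lemma const21 : const2 1 = 1.
Proof. by rewrite /const2 scale1r !rmorph1. Qed.
Lemma const2N a : const2 (- a) = - const2 a.
Proof. by rewrite /const2 scaleNr !rmorphN. Qed.
Lemma const2X a n : const2 (a ^+ n) = const2 a ^+ n.
Proof. by elim: n => [|n IH]; rewrite ?const21 // !exprS const2M IH. Qed.
Lemma const2M_coef a X i j : (const2 a * X) i j = a *: X i j.
Proof. by rewrite /const2 !fpsCM mulr_algl. Qed.

Definition scale_uv (a b : F) : S2 -> S2 := scale2 a%:A b%:A.
HB.instance Definition _ a b := GRing.RMorphism.copy (scale_uv a b) (scale2 a%:A b%:A).

Lemma scale_uv_coef a b X i j : scale_uv a b X i j = (a ^+ i * b ^+ j) *: X i j.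
Proof.
by rewrite /scale_uv scale2_coef !exprZn !expr1n !mulr_algl scalerA.
Qed.

Lemma hat_scale_uv (L : {linear Sym -> Sym}) a b X : hat L (scale_uv a b X) = scale_uv a b (hat L X).
Proof.
by apply: fps_ext => i; apply: fps_ext => j; rewrite /hat !scale_uv_coef linearZ.
Qed.

Lemma scale_uv_const2 a b c : scale_uv a b (const2 c) = const2 c.
Proof.
apply: fps_ext => i; apply: fps_ext => j; rewrite scale_uv_coef.
by case: i j => [|i] [|j] //=; rewrite ?scaler0 // mul1r scale1r.
Qed.
Lemma scale_uv_const a b (c : Sym) :
  scale_uv a b (fps_const (fps_const c)) = fps_const (fps_const c).
Proof.
apply: fps_ext => i; apply: fps_ext => j; rewrite scale_uv_coef.
by case: i j => [|i] [|j] //=; rewrite ?scaler0 // mul1r scale1r.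
Qed.
Lemma scale_uv_vu a b : scale_uv a b vu = const2 a * vu.
Proof.
rewrite /scale_uv /vu [LHS]scale2_inu fps_scaleX rmorphM /=; congr (_ * _).
by rewrite /inu fps_mapC.
Qed.
Lemma scale_uv_vv a b : scale_uv a b vv = const2 b * vv.
Proof. by rewrite /scale_uv /vv [LHS]scale2_inv fps_scaleX rmorphM /=. Qed.
Lemma scale_uv_inu a b f : scale_uv a b (inu f) = inu (fps_scale a%:A f).
Proof. exact: scale2_inu. Qed.
Lemma scale_uv_inv a b f : scale_uv a b (inv2 f) = inv2 (fps_scale b%:A f).
Proof. exact: scale2_inv. Qed.
Lemma fps_scale_comp (a b : Sym) (f : fps Sym) :
  fps_scale a (fps_scale b f) = fps_scale (a * b) f.
Proof. by apply: fps_ext => n; rewrite /fps_scale mulrA exprMn. Qed.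

Lemma vu_inj (X : S2) : vu * X = 0 -> X = 0.
Proof.
move=> eq0; apply: (@fpsX_inj (fps Sym)); rewrite mulr0 -eq0.
by rewrite /vu /inu fps_mapX.
Qed.
Lemma vv_inj (X : S2) : vv * X = 0 -> X = 0.
Proof.
move=> eq0; apply: fps_ext => i; apply: (@fpsX_inj Sym); rewrite mulr0.
have := congr1 (fun Y : S2 => Y i) eq0.
by rewrite /vv /inv2 fpsCM.
Qed.
Lemma const2_inj a (X : S2) : a != 0 -> const2 a * X = 0 -> X = 0.
Proof.
by move=> a0 eq0; rewrite -[X]mul1r -const21 -(mulVf a0) const2M -mulrA eq0 mulr0.
Qed.
Lemma lin_inj a b (X : S2) : a != 0 -> (const2 a * vu - const2 b * vv) * X = 0 -> X = 0.
Proof.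
move=> a0; rewrite /vu /inu fps_mapX; apply: lin_reg => x y.
by rewrite !mulr_algl => /(congr1 ( *:%R a^-1)); rewrite !scalerA mulVf // !scale1r.
Qed.
End Hat.

Section RmorphNum.
Variables (R S : comNzRingType) (phi : {rmorphism R -> S}).
Lemma rmorph_num_K q t c x y A A' B B' : phi (num_K q t c x y A A' B B') =
  num_K (phi q) (phi t) (phi c) (phi x) (phi y) (phi A) (phi A') (phi B) (phi B').
Proof.
by rewrite /num_K !(rmorphD, rmorphB, rmorphN, rmorphM, rmorphXn, rmorph1).
Qed.
Lemma rmorph_num_D q x y A A' B B' : phi (num_D q x y A A' B B') =
  num_D (phi q) (phi x) (phi y) (phi A) (phi A') (phi B) (phi B').
Proof.
by rewrite /num_D !(rmorphD, rmorphB, rmorphN, rmorphM, rmorphXn, rmorph1).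
Qed.
Lemma rmorph_num_Dc q t c x y A A' B B' : phi (num_Dc q t c x y A A' B B') =
  num_Dc (phi q) (phi t) (phi c) (phi x) (phi y) (phi A) (phi A') (phi B) (phi B').
Proof.
by rewrite /num_Dc /num_D !(rmorphD, rmorphB, rmorphN, rmorphM, rmorphXn, rmorph1).
Qed.
End RmorphNum.

(** * The operators on E(u) E(v) *)

Section Commutation.
Variable F : fieldType.
Hypothesis natF_neq0 : forall n, n.+1%:R != 0 :> F.
Variables q t : F.
Hypothesis t_neq0 : t != 0.
Hypothesis t_nroot : forall k, 1 - t ^+ k.+1 != 0.
Local Notation Sym := (symfun F).
Local Notation S2 := (fps (fps Sym)).
Local Notation E := (plE t : fps Sym).
Implicit Types f g : Sym.

(** The operator of the theorem as a combination of vertex operators; it agrees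
    with it on homogeneous functions by [H3qtE]. *)
Definition H3op f : Sym :=
  (1 - q) *: (vertex (sf_h F) (fun k => t ^+ k - 1) 3 f - q ^+ 2 *: Hbar_op t 3 f)
  + q *: (sf_e F 1 * (vertex (sf_h F) (fun k => t ^+ k - 1) 2 f
                      + q *: Hbar_op t 2 f)).

Lemma H3op_is_linear : linear H3op.
Proof.
move=> a f g; rewrite /H3op !linearP /= !Hbar_op_linear.
set v3f := vertex _ _ 3 f; set v3g := vertex _ _ 3 g.
set v2f := vertex _ _ 2 f; set v2g := vertex _ _ 2 g.
set h3f := Hbar_op t 3 f; set h3g := Hbar_op t 3 g.
set h2f := Hbar_op t 2 f; set h2g := Hbar_op t 2 g.
have [io E] : exists io : F -> Sym, forall b (z : Sym), b *: z = io b * z.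
  by exists (GRing.in_alg Sym) => b z; rewrite mulr_algl.
by rewrite !E; ring.
Qed.
HB.instance Definition _ := GRing.isLinear.Build F Sym Sym *:%R H3op H3op_is_linear.

Let c : S2 := fps_const (fps_const (plE t 1)).
Let A : S2 := inu E.
Let A' : S2 := inu (fps_scale t%:A E).
Let Am : S2 := inu (fps_scale t^-1%:A E).
Let B : S2 := inv2 E.
Let B' : S2 := inv2 (fps_scale t%:A E).
Let Bm : S2 := inv2 (fps_scale t^-1%:A E).
Local Notation x := (vu F).
Local Notation y := (vv F).
Local Notation cst := (@const2 F).

Lemma inu_rec (g : nat -> Sym) (h : fps Sym) r : x * inu (agen g h r.+1) =
  inu (agen g h r) - fps_const (fps_const (g r)) * inu h.
Proof.
rewrite [agen g h r]agen_rec rmorphD /= !rmorphM /=.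
have -> : inu (fps_const (g r)) = fps_const (fps_const (g r)) by rewrite /inu fps_mapC.
by rewrite addrC addKr.
Qed.
Lemma inv_rec (g : nat -> Sym) (h : fps Sym) r : y * inv2 (agen g h r.+1) =
  inv2 (agen g h r) - fps_const (fps_const (g r)) * inv2 h.
Proof. by rewrite [agen g h r]agen_rec rmorphD !rmorphM /= addrC addKr. Qed.

Lemma hsign0 : hsign F 0 = 1.
Proof. by rewrite /hsign expr0 scale1r (weighted0 (weighted_h F)). Qed.

Lemma constconst_scale (a : F) (f : Sym) :
  fps_const (fps_const (a *: f)) = cst a * fps_const (fps_const f) :> S2.
Proof. by rewrite /const2 -!rmorphM mulr_algl. Qed.

Lemma hsign1_plE : hsign F 1 = (t - 1) *: plE t 1.
Proof.
have := congr1 (fun f : fps Sym => f 1%N) (rel_h natF_neq0 t_nroot).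
rewrite fpsM !big_ord_recl big_ord0 /= hsign0 mul1r (plE0 natF_neq0) mulr1 addr0.
rewrite fps_scaleA expr1 => /(canRL (addKr _)) ->.
by rewrite scalerBl scale1r addrC.
Qed.

Lemma hsign1 : fps_const (fps_const (hsign F 1)) = (cst t - 1) * c :> S2.
Proof. by rewrite hsign1_plE constconst_scale const2D const2N const21. Qed.

Lemma sfe1 : fps_const (fps_const (sf_e F 1)) = (1 - cst t) * c :> S2.
Proof. by rewrite (plE1 natF_neq0 t_nroot) constconst_scale const2D const2N const21. Qed.

Lemma hat_H3op : hat H3op (A * B) =
  (1 - cst q) * (- vgen (hsign F) E 3
                 - cst q ^+ 2 * vgen (sf_e F) (fps_scale t%:A E) 3)
  + cst q * ((1 - cst t) * c) *
    (vgen (hsign F) E 2 + cst q * vgen (sf_e F) (fps_scale t%:A E) 2).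
Proof.
rewrite -sfe1 -const2X -const21 -const2N -const2D.
apply: fps_ext => i; apply: fps_ext => j; rewrite /hat inu_inv2_coef /H3op.
rewrite -!(HopE natF_neq0) !(Hop_gen natF_neq0 t_neq0 t_nroot).
rewrite !(Hbar_gen natF_neq0 t_neq0 t_nroot) !fpsD -!mulrA !const2M_coef.
rewrite !fpsCM !fpsD !fpsN !const2M_coef.
by rewrite !exprS expr0 !mulr1 mulrNN mulr1 mulN1r scaleN1r scale1r.
Qed.

(** Each vertex operator is replaced by its two-variable expression through
    [vgen_diff]; the recursion in r then expresses everything in E(u), E(tu),
    E(v), E(tv) and E_1. *)
Lemma hat_H3op_num : (x * y) ^+ 2 * (x - y) * hat H3op (A * B) =
  num_K (cst q) (cst t) c x y A A' B B'.
Proof.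
rewrite hat_H3op.
have := vgen_diff (hsign F) E 2; have := vgen_diff (hsign F) E 1.
have := vgen_diff (sf_e F) (fps_scale t%:A E) 2.
have := vgen_diff (sf_e F) (fps_scale t%:A E) 1.
have e0 : sf_e F 0 = 1 by rewrite (weighted0 (weighted_e F)).
have u1 : x * inu (agen (hsign F) E 1) = A' - A.
  by rewrite inu_rec agen0 (rel_h natF_neq0 t_nroot) hsign0 !rmorph1 mul1r.
have v1 : y * inv2 (agen (hsign F) E 1) = B' - B.
  by rewrite inv_rec agen0 (rel_h natF_neq0 t_nroot) hsign0 !rmorph1 mul1r.
have ub1 : x * inu (agen (sf_e F) (fps_scale t%:A E) 1) = A - A'.
  by rewrite inu_rec agen0 (rel_e natF_neq0 t_nroot) e0 !rmorph1 mul1r.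
have vb1 : y * inv2 (agen (sf_e F) (fps_scale t%:A E) 1) = B - B'.
  by rewrite inv_rec agen0 (rel_e natF_neq0 t_nroot) e0 !rmorph1 mul1r.
have u2 : x ^+ 2 * inu (agen (hsign F) E 2) = A' - A - (cst t - 1) * c * x * A.
  by rewrite expr2 -mulrA inu_rec mulrBr u1 hsign1; ring.
have v2 : y ^+ 2 * inv2 (agen (hsign F) E 2) = B' - B - (cst t - 1) * c * y * B.
  by rewrite expr2 -mulrA inv_rec mulrBr v1 hsign1; ring.
have ub2 : x ^+ 2 * inu (agen (sf_e F) (fps_scale t%:A E) 2) =
    A - A' - (1 - cst t) * c * x * A'.
  by rewrite expr2 -mulrA inu_rec mulrBr ub1 sfe1 -/A'; ring.
have vb2 : y ^+ 2 * inv2 (agen (sf_e F) (fps_scale t%:A E) 2) =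
    B - B' - (1 - cst t) * c * y * B'.
  by rewrite expr2 -mulrA inv_rec mulrBr vb1 sfe1 -/B'; ring.
rewrite -/A -/B -/A' -/B' -/x -/y.
move: u1 v1 ub1 vb1 u2 v2 ub2 vb2.
move: (inu (agen (hsign F) E 1)) (inv2 (agen (hsign F) E 1)) => a1 a1'.
move: (inu (agen (hsign F) E 2)) (inv2 (agen (hsign F) E 2)) => a2 a2'.
move: (inu (agen (sf_e F) (fps_scale t%:A E) 1)) => b1.
move: (inv2 (agen (sf_e F) (fps_scale t%:A E) 1)) => b1'.
move: (inu (agen (sf_e F) (fps_scale t%:A E) 2)) => b2.
move: (inv2 (agen (sf_e F) (fps_scale t%:A E) 2)) => b2'.
move: (vgen (hsign F) E 3) (vgen (hsign F) E 2) => X3 X2.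
move: (vgen (sf_e F) (fps_scale t%:A E) 3) (vgen (sf_e F) (fps_scale t%:A E) 2).
move=> Y3 Y2 u1 v1 ub1 vb1 u2 v2 ub2 vb2 e2 e3 d2 d3.
transitivity (
  (1 - cst q) * (- ((x * y) ^+ 2 * ((x - y) * X3))
                 - cst q ^+ 2 * ((x * y) ^+ 2 * ((x - y) * Y3)))
  + cst q * ((1 - cst t) * c) * (x * y) ^+ 2 *
    ((x - y) * X2 + cst q * ((x - y) * Y2))).
  by ring.
rewrite d3 d2 e3 e2.
transitivity (
  (1 - cst q) * (- (y ^+ 2 * B * (x ^+ 2 * a2) - x ^+ 2 * A * (y ^+ 2 * a2'))
    - cst q ^+ 2 * (y ^+ 2 * B' * (x ^+ 2 * b2) - x ^+ 2 * A' * (y ^+ 2 * b2')))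
  + cst q * ((1 - cst t) * c) * (x * y) *
    ((y * B * (x * a1) - x * A * (y * a1'))
     + cst q * (y * B' * (x * b1) - x * A' * (y * b1')))).
  by ring.
rewrite u1 v1 ub1 vb1 u2 v2 ub2 vb2 /num_K; ring.
Qed.

Lemma hat_mac : hat (mac q t) (A * B) = ygen q t 0.
Proof.
apply: fps_ext => i; apply: fps_ext => j; rewrite /hat inu_inv2_coef.
by apply: mac_gen.
Qed.

Lemma hat_mac1 : hat (mac q t) (c * (A * B)) =
  c * ygen q t 0 + (1 - cst q) * ygen q t 1.
Proof.
rewrite -const21 -const2N -const2D; apply: fps_ext => i; apply: fps_ext => j.
rewrite !fpsD const2M_coef /hat /c !fpsCM inu_inv2_coef.
rewrite mac_plE1 // (mac_gen natF_neq0 q t_neq0 t_nroot 1).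
by have -> : mac q t (plE t i * plE t j) = ygen q t 0 i j by apply: mac_gen.
Qed.

Lemma elow0 : elow t 0 = 1 :> Sym.
Proof. by rewrite /elow expr0 scale1r (weighted0 (weighted_e F)). Qed.

Lemma ygen0 : (x - y) * ygen q t 0 = num_D (cst q) x y A Am B Bm.
Proof.
rewrite /ygen elow0 constconst_scale !rmorph1 mulr1 agen0.
rewrite (rel_elow natF_neq0 t_neq0 t_nroot) vgen_recv agen0.
rewrite (rel_elow natF_neq0 t_neq0 t_nroot).
rewrite -/(cst (q * (1 - q))) -/(cst ((1 - q) ^+ 2)) const2M !const2X const2D const2N const21.
have := vgen_diff (elow t) E 0; rewrite agen0 (rel_elow natF_neq0 t_neq0 t_nroot).
rewrite -/A -/B -/Am -/Bm -/x -/y; move: (vgen _ _ 1) => X1 d1.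
transitivity (cst q ^+ 2 * (x - y) * (A * B)
  + cst q * (1 - cst q) * (x - y) * (B * Am + A * Bm)
  + (1 - cst q) ^+ 2 * (y * ((x - y) * X1) + (x - y) * (B * Am))).
  by ring.
by rewrite d1 /num_D; ring.
Qed.

Lemma ygen1 : cst t * (x * y) * (x - y) * ygen q t 1 =
  cst q ^+ 2 * (1 - cst t) * c * (x * y) * (x - y) * (A * B)
  + cst t * cst q * (1 - cst q) * (x - y) * (y * B * (Am - A) + x * A * (Bm - B))
  + cst t * (1 - cst q) ^+ 2 * (x * y) * (Am * B - A * Bm).
Proof.
have elow1 : fps_const (fps_const (elow t 1)) = cst t^-1 * ((1 - cst t) * c) :> S2.
  by rewrite /elow expr1 constconst_scale sfe1.
rewrite /ygen constconst_scale elow1.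
rewrite -/(cst (q * (1 - q))) -/(cst ((1 - q) ^+ 2)) const2M !const2X const2D const2N const21.
have u1 : x * inu (agen (elow t) E 1) = Am - A.
  by rewrite inu_rec agen0 (rel_elow natF_neq0 t_neq0 t_nroot) elow0 !rmorph1 mul1r.
have v1 : y * inv2 (agen (elow t) E 1) = Bm - B.
  by rewrite inv_rec agen0 (rel_elow natF_neq0 t_neq0 t_nroot) elow0 !rmorph1 mul1r.
have := vgen_diff (elow t) E 0; rewrite agen0 (rel_elow natF_neq0 t_neq0 t_nroot).
rewrite -/A -/B -/Am -/Bm -/x -/y; move: (vgen _ _ 1) => X1 d1.
move: u1 v1; move: (inu (agen _ _ _)) (inv2 (agen _ _ _)) => a1 a1' u1 v1.
have tt : cst t * cst t^-1 = 1 by rewrite -const2M divff // const21.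
transitivity (cst q ^+ 2 * (cst t * cst t^-1) * (1 - cst t) * c * (x * y) * (x - y) * (A * B)
  + cst t * cst q * (1 - cst q) * (x - y) * (y * B * (x * a1) + x * A * (y * a1'))
  + cst t * (1 - cst q) ^+ 2 * (x * y) * ((x - y) * X1)).
  by ring.
by rewrite u1 v1 d1 tt; ring.
Qed.

Lemma hat_mac_num : (x - y) * hat (mac q t) (A * B) = num_D (cst q) x y A Am B Bm.
Proof. by rewrite hat_mac ygen0. Qed.

Lemma hat_mac_plE1_num : cst t * (x * y) * (x - y) * hat (mac q t) (c * (A * B)) =
  num_Dc (cst q) (cst t) c x y A Am B Bm.
Proof.
rewrite hat_mac1; transitivity (cst t * c * (x * y) * ((x - y) * ygen q t 0)
  + (1 - cst q) * (cst t * (x * y) * (x - y) * ygen q t 1)).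
  by ring.
by rewrite ygen0 ygen1 /num_Dc; ring.
Qed.
End Commutation.

(** * The commutation relation *)

Section CommutationFinal.
Variable F : fieldType.
Hypothesis natF_neq0 : forall n, n.+1%:R != 0 :> F.
Variables q t : F.
Hypothesis t_neq0 : t != 0.
Hypothesis t_nroot : forall k, 1 - t ^+ k.+1 != 0.
Local Notation Sym := (symfun F).
Local Notation S2 := (fps (fps Sym)).
Local Notation E := (plE t : fps Sym).
Local Notation x := (vu F).
Local Notation y := (vv F).
Local Notation cst := (@const2 F).
Local Notation T := (cst t).
Local Notation Q := (cst q).
Let c : S2 := fps_const (fps_const (plE t 1)).

Let A k : S2 := inu (fps_scale (t ^+ k)%:A E).
Let B k : S2 := inv2 (fps_scale (t ^+ k)%:A E).

Lemma alg_mul (a b : F) : a%:A * b%:A = (a * b)%:A :> Sym.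
Proof. by rewrite mulr_algl scalerA. Qed.

Lemma scale_uv_AB i j : scale_uv (t ^+ i) (t ^+ j) (inu E * inv2 E) = A i * B j.
Proof. by rewrite rmorphM /= scale_uv_inu scale_uv_inv. Qed.

Lemma scale_uv_A i j s k : t ^+ i * s = t ^+ k ->
  scale_uv (t ^+ i) (t ^+ j) (inu (fps_scale s%:A E)) = A k.
Proof. by move=> e; rewrite scale_uv_inu fps_scale_comp alg_mul e. Qed.
Lemma scale_uv_B i j s k : t ^+ j * s = t ^+ k ->
  scale_uv (t ^+ i) (t ^+ j) (inv2 (fps_scale s%:A E)) = B k.
Proof. by move=> e; rewrite scale_uv_inv fps_scale_comp alg_mul e. Qed.
Lemma scale_uv_A0 i j : scale_uv (t ^+ i) (t ^+ j) (inu E) = A i.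
Proof. by rewrite scale_uv_inu. Qed.
Lemma scale_uv_B0 i j : scale_uv (t ^+ i) (t ^+ j) (inv2 E) = B j.
Proof. by rewrite scale_uv_inv. Qed.

Lemma powV i : t ^+ i.+1 * t^-1 = t ^+ i.
Proof. by rewrite exprSr -mulrA divff // mulr1. Qed.

(** Substitution of t^i u and t^j v in [hat_mac_num]. *)
Lemma hat_mac_scaled i j :
  (cst (t ^+ i.+1) * x - cst (t ^+ j.+1) * y) * hat (mac q t) (A i.+1 * B j.+1) =
  num_D Q (cst (t ^+ i.+1) * x) (cst (t ^+ j.+1) * y) (A i.+1) (A i) (B j.+1) (B j).
Proof.
have := congr1 (scale_uv (t ^+ i.+1) (t ^+ j.+1)) (hat_mac_num natF_neq0 q t_neq0 t_nroot).
rewrite rmorph_num_D rmorphM /= -hat_scale_uv scale_uv_AB rmorphB /= scale_uv_vu scale_uv_vv scale_uv_const2 scale_uv_A0 scale_uv_B0.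
by rewrite (scale_uv_A _ (powV i)) (scale_uv_B _ (powV j)).
Qed.

Lemma hat_mac_plE1_scaled i j :
  T * ((cst (t ^+ i.+1) * x) * (cst (t ^+ j.+1) * y)) *
  (cst (t ^+ i.+1) * x - cst (t ^+ j.+1) * y) * hat (mac q t) (c * (A i.+1 * B j.+1)) =
  num_Dc Q T c (cst (t ^+ i.+1) * x) (cst (t ^+ j.+1) * y) (A i.+1) (A i) (B j.+1) (B j).
Proof.
have := congr1 (scale_uv (t ^+ i.+1) (t ^+ j.+1)) (hat_mac_plE1_num natF_neq0 q t_neq0 t_nroot).
rewrite rmorph_num_Dc !rmorphM /= -hat_scale_uv rmorphM /= scale_uv_AB rmorphB /= scale_uv_vu scale_uv_vv !scale_uv_const2.
by rewrite scale_uv_A0 scale_uv_B0 scale_uv_const (scale_uv_A _ (powV i)) (scale_uv_B _ (powV j)).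
Qed.

Lemma hat_H3op_scaled i j :
  ((cst (t ^+ i) * x) * (cst (t ^+ j) * y)) ^+ 2 *
  (cst (t ^+ i) * x - cst (t ^+ j) * y) * hat (H3op q t) (A i * B j) =
  num_K Q T c (cst (t ^+ i) * x) (cst (t ^+ j) * y) (A i) (A i.+1) (B j) (B j.+1).
Proof.
have := congr1 (scale_uv (t ^+ i) (t ^+ j)) (hat_H3op_num natF_neq0 q t_neq0 t_nroot).
rewrite rmorph_num_K !rmorphM /= -hat_scale_uv scale_uv_AB rmorphB /= scale_uv_vu scale_uv_vv !scale_uv_const2.
by rewrite scale_uv_A0 scale_uv_B0 scale_uv_const (scale_uv_A _ (esym (exprSr t i))) (scale_uv_B _ (esym (exprSr t j))).
Qed.

Lemma scalarB s s' : scalar_series s -> scalar_series s' -> scalar_series (s - s' : S2).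
Proof. by move=> ? ?; apply: scalarD => //; apply: scalarN. Qed.

Lemma hatB (L : {linear Sym -> Sym}) X Y : hat L (X - Y) = hat L X - hat L Y.
Proof. by apply: fps_ext => i; apply: fps_ext => j; exact: linearB. Qed.

Ltac scal := repeat first [ apply: scalarM | apply: scalarB | apply: scalarD
  | apply: scalarN | apply: scalarX | apply: scalar1 | apply: scalar_const2
  | apply: scalar_vu | apply: scalar_vv ].

Lemma hat_lin_K (L : {linear Sym -> Sym}) a b X Y d11 d12 d21 d22 c11 c12 c21 c22 :
  scalar_series X -> scalar_series Y ->
  hat L (lin_K (cst a) (cst b) X Y d11 d12 d21 d22 c11 c12 c21 c22) =
  lin_K (cst a) (cst b) X Y (hat L d11) (hat L d12) (hat L d21) (hat L d22)
    (hat L c11) (hat L c12) (hat L c21) (hat L c22).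
Proof.
move=> sX sY; rewrite /lin_K.
do ! (rewrite hatD; congr (_ + _)); apply: hatM; scal => //.
Qed.

Lemma hat_num_D (L : {linear Sym -> Sym}) a X Y C C' D D' :
  scalar_series X -> scalar_series Y ->
  hat L (num_D (cst a) X Y C C' D D') =
  cst a ^+ 2 * (X - Y) * hat L (C * D)
  + cst a * (1 - cst a) * (X - Y) * (hat L (C' * D) + hat L (C * D'))
  + (1 - cst a) ^+ 2 * (Y * (hat L (C' * D) - hat L (C * D')) + (X - Y) * hat L (C' * D)).
Proof.
move=> sX sY; rewrite /num_D; move: (C * D) (C' * D) (C * D') => U V W.
rewrite hatD hatD; congr (_ + _ + _).
- by apply: hatM; scal.
- by rewrite hatM ?hatD //; scal.
- by rewrite hatM; [rewrite hatD hatM // hatB hatM // | ]; scal.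
Qed.

(** The factor in [commutation_num] is regular in the ring of series. *)
Lemma commutation_series (X := A 1 * B 1) :
  T * hat (mac q t) (hat (H3op q t) X) - hat (H3op q t) (hat (mac q t) X)
  - Q ^+ 3 * (T - 1) * hat (H3op q t) X = 0.
Proof.
have c1 : cst (t ^+ 1) = T by [].
have c2 : cst (t ^+ 2) = T * T by rewrite const2X expr2.
have c0 : cst (t ^+ 0) = 1 by rewrite const21.
pose D Y := hat (mac q t) Y; pose K Y := hat (H3op q t) Y.
have := @commutation_num S2 Q T c x y (A 0) (A 1) (A 2) (B 0) (B 1) (B 2)
  (D (A 1 * B 1)) (D (A 1 * B 2)) (D (A 2 * B 1)) (D (A 2 * B 2))
  (D (c * (A 1 * B 1))) (D (c * (A 1 * B 2))) (D (c * (A 2 * B 1)))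
  (D (c * (A 2 * B 2))) (K (A 1 * B 1)) (K (A 0 * B 1)) (K (A 1 * B 0))
  (D (K (A 1 * B 1))) (K (D (A 1 * B 1))).
have a0 := hat_mac_scaled 0 0; have a1 := hat_mac_scaled 0 1; have a2 := hat_mac_scaled 1 0.
have a3 := hat_mac_scaled 1 1; have b0 := hat_mac_plE1_scaled 0 0; have b1 := hat_mac_plE1_scaled 0 1.
have b2 := hat_mac_plE1_scaled 1 0; have b3 := hat_mac_plE1_scaled 1 1.
have k0 := hat_H3op_scaled 1 1; have k1 := hat_H3op_scaled 0 1; have k2 := hat_H3op_scaled 1 0.
rewrite c1 in a0 a1 a2 b0 b1 b2 k0 k1 k2.
rewrite c2 in a1 a2 a3 b1 b2 b3; rewrite c0 !mul1r in k1 k2.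
rewrite -!(mulrA T T) in a1 a2 a3 b1 b2 b3.
move=> /(_ a0 a1 a2 a3 b0 b1 b2 b3 k0 k1 k2) fin.
have hDK : ((T * x) * (T * y)) ^+ 2 * (T * x - T * y) * D (K (A 1 * B 1)) =
  lin_K Q T (T * x) (T * y) (D (A 1 * B 1)) (D (A 1 * B 2)) (D (A 2 * B 1)) (D (A 2 * B 2))
  (D (c * (A 1 * B 1))) (D (c * (A 1 * B 2))) (D (c * (A 2 * B 1)))
  (D (c * (A 2 * B 2))).
  have := congr1 D k0; rewrite num_KE {1}/D hatM; last by scal.
  by move=> ->; apply: hat_lin_K; scal.
have hKD : (T * x - T * y) * K (D (A 1 * B 1)) =
    Q ^+ 2 * (T * x - T * y) * K (A 1 * B 1)
    + Q * (1 - Q) * (T * x - T * y) * (K (A 0 * B 1) + K (A 1 * B 0))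
    + (1 - Q) ^+ 2 * (T * y * (K (A 0 * B 1) - K (A 1 * B 0))
                      + (T * x - T * y) * K (A 0 * B 1)).
  have := congr1 K a0; rewrite {1}/K hatM; last by scal.
  by move=> ->; apply: hat_num_D; scal.
have {}fin := fin hDK hKD.
move: fin; rewrite -/(D _) -/(K _); move: (_ - _ - _) => Z fin.
(* Each factor is regular: t is a unit, u and v are variables, and the linear
   forms have an invertible coefficient at u. *)
have cT n (Y : S2) : T ^+ n * Y = 0 -> Y = 0.
  by rewrite -const2X; apply: const2_inj; rewrite expf_neq0.
have vun n (Y : S2) : x ^+ n * Y = 0 -> Y = 0.
  by elim: n => [|n IH]; rewrite ?expr0 ?mul1r // exprS -mulrA => /vu_inj.
have vvn n (Y : S2) : y ^+ n * Y = 0 -> Y = 0.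
  by elim: n => [|n IH]; rewrite ?expr0 ?mul1r // exprS -mulrA => /vv_inj.
have xy (Y : S2) : (x - y) * Y = 0 -> Y = 0.
  by move=> e; apply: (@lin_inj _ 1 1); rewrite ?oner_neq0 // const21 !mul1r.
have xty (Y : S2) : (x - T * y) * Y = 0 -> Y = 0.
  by move=> e; apply: (@lin_inj _ 1 t); rewrite ?oner_neq0 // const21 !mul1r.
have txy (Y : S2) : (T * x - y) * Y = 0 -> Y = 0.
  by move=> e; apply: (@lin_inj _ t 1); rewrite // const21 !mul1r.
apply: xty; apply: txy; apply: (xy _); apply: xy; apply: (vvn 3%N); apply: (vun 3%N).
by apply: (cT 12%N); rewrite -[RHS]fin; ring.
Qed.

(** Coefficient extraction; the substitution of tu, tv contributes t^(i+j) on
    both sides. *)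
Lemma commutation i j : t *: mac q t (H3op q t (plE t i * plE t j)) =
  H3op q t (mac q t (plE t i * plE t j)) +
  (q ^+ 3 * (t - 1)) *: H3op q t (plE t i * plE t j).
Proof.
have := congr1 (fun f : S2 => f i j) commutation_series.
have e (L : {linear Sym -> Sym}) : hat L (A 1 * B 1) = scale_uv t t (hat L (inu E * inv2 E)).
  by rewrite -hat_scale_uv -[t]expr1 scale_uv_AB.
rewrite !e !hat_scale_uv -const21 -const2N -const2D -const2X -const2M.
rewrite !fpsD !fpsN !const2M_coef !scale_uv_coef /hat inu_inv2_coef => /eqP.
have tn : t ^+ i * t ^+ j != 0 by rewrite mulf_neq0 // expf_neq0.
rewrite subr_eq0 subr_eq => /eqP eqt; apply: (scalerI tn).
transitivity (t *: ((t ^+ i * t ^+ j) *: mac q t (H3op q t (plE t i * plE t j)))).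
  by rewrite !scalerA [in LHS]mulrC.
transitivity ((q ^+ 3 * (t - 1)) *: ((t ^+ i * t ^+ j) *: H3op q t (plE t i * plE t j))
  + (t ^+ i * t ^+ j) *: H3op q t (mac q t (plE t i * plE t j))); first exact: eqt.
rewrite addrC [RHS]scalerDr; congr (_ + _).
by rewrite !scalerA; congr (_ *: _); rewrite mulrC.
Qed.
End CommutationFinal.

(** * Expansions on products of two and three E_k *)

(** Scalars as elements of the algebra, so that identities mixing scaling and
    multiplication become identities in a commutative ring. *)
Lemma scale_io (F : fieldType) (A : comAlgType F) :
  exists io : {rmorphism F -> A}, forall c z, c *: z = io c * z.
Proof. by exists (GRing.in_alg A) => c z; rewrite mulr_algl. Qed.

Section VgenCoef.
Variable A : comNzRingType.
Variables (g : nat -> A) (E : fps A).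

Lemma inv2_inu_coef (f h : fps A) i j : (inv2 f * inu h) i j = f j * h i.
Proof. by rewrite mulrC inu_inv2_coef mulrC. Qed.

Lemma agenS_coef r n : agen g E r.+1 n = agen g E r n.+1 - g r * E n.+1.
Proof.
by rewrite [agen g E r]agen_rec fpsD fpsCM fpsXM addrC addKr.
Qed.

Lemma vgen_rec_coef r k l : vgen g E r k l = E l * agen g E r k +
  (if l is l'.+1 then vgen g E r.+1 k l' else 0).
Proof.
rewrite [vgen g E r]vgen_recv !fpsD inv2_inu_coef; congr (_ + _).
by rewrite /inv2 fpsCM fpsXM.
Qed.

(** Division by u - v: the coefficient of u^k v^l is the sum of those of
    u^(k+s+1) v^(l-s) in the numerator. Every product E_(k+s+1) E_(l-s) that
    arises has a smaller second index than E_k E_(l+1). *)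
Lemma vgenS_coef r k l : vgen g E r.+1 k l =
  \sum_(s < l.+1) (E (l - s)%N * agen g E r (k + s).+1
                   - E (k + s).+1 * agen g E r (l - s)%N).
Proof.
have rec i j : vgen g E r.+1 i j = (E j * agen g E r i.+1 - E i.+1 * agen g E r j)
    + (if j is j'.+1 then vgen g E r.+1 i.+1 j' else 0).
  have := congr1 (fun f : fps (fps A) => f i.+1 j) (vgen_diff g E r).
  rewrite mulrBl !fpsD !fpsN inu_inv2_coef inv2_inu_coef.
  rewrite {1}/inu fps_mapX fpsXM /inv2 fpsCM fpsXM => <-.
  case: j => [|j]; last by rewrite subrK.
  by rewrite subr0 addr0.
elim: l k => [|l IH] k; first by rewrite rec big_ord1 subnn addn0 addr0.
rewrite rec IH [RHS]big_ord_recl subn0 addn0; congr (_ + _).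
by apply: eq_bigr => s _ /=; rewrite /bump /= add1n subSS addSnnS.
Qed.
End VgenCoef.

Section Pairs.
Variable F : fieldType.
Hypothesis natF_neq0 : forall n, n.+1%:R != 0 :> F.
Variables q t : F.
Hypothesis t_neq0 : t != 0.
Hypothesis t_nroot : forall k, 1 - t ^+ k.+1 != 0.
Local Notation Sym := (symfun F).
Local Notation E := (plE t).
Local Notation ti n := (t^-1 ^+ n).

Lemma agen_elow n : agen (elow t) (E : fps Sym) 0 n = ti n *: E n.
Proof. by rewrite agen0 (rel_elow natF_neq0 t_neq0 t_nroot) fps_scaleA. Qed.

Lemma vgen_elow k l : vgen (elow t) (E : fps Sym) 1 k l =
  \sum_(s < l.+1) (ti (k + s).+1 - ti (l - s)) *: (E (k + s).+1 * E (l - s)%N).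
Proof.
rewrite vgenS_coef; apply: eq_bigr => s _; rewrite !agen_elow.
by have [io eio] := scale_io Sym; rewrite !eio; ring.
Qed.

Lemma ygen_coef r k l : ygen q t r k l = q ^+ 2 *: (elow t r * (E k * E l)) +
  (q * (1 - q)) *: (E l * agen (elow t) (E : fps Sym) r k
                    + E k * agen (elow t) (E : fps Sym) r l) +
  (1 - q) ^+ 2 *: vgen (elow t) (E : fps Sym) r k l.
Proof.
rewrite /ygen !fpsD -mulrA !fpsCM !mulr_algl !fpsD inv2_inu_coef !inu_inv2_coef.
by rewrite -scalerAl.
Qed.

(** The eigenvalue attached to E_k E_l, that is, to a partition with columns k
    and l. *)
Definition mac_ev k l := q ^+ 2 + (1 - q) * (ti k + q * ti l).

Lemma mac_pair k l : mac q t (E k * E l) = mac_ev k l *: (E k * E l) +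
  \sum_(s < l) ((1 - q) ^+ 2 * (ti (k + s).+1 - ti (l - s.+1))) *:
               (E (k + s).+1 * E (l - s.+1)%N).
Proof.
have -> : mac q t (E k * E l) = ygen q t 0 k l by apply: mac_gen.
rewrite ygen_coef elow0 mul1r.
rewrite vgen_rec_coef !agen_elow /mac_ev.
have -> : (if l is l'.+1 then vgen (elow t) (E : fps Sym) 1 k l' else 0) =
    \sum_(s < l) (ti (k + s).+1 - ti (l - s.+1)) *: (E (k + s).+1 * E (l - s.+1)%N).
  case: l => [|l]; first by rewrite big_ord0.
  by rewrite vgen_elow; apply: eq_bigr => s _; rewrite subSS.
under [X in _ = _ + X]eq_bigr do rewrite -scalerA.
rewrite -scaler_sumr; move: (\sum_(s < l) _) => X.
by have [io eio] := scale_io Sym; rewrite !eio; ring.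
Qed.

(** The eigenvalue attached to E_1 E_k E_l. *)
Definition mac_ev3 k l := q ^+ 3 + (1 - q) * (ti k + q * ti l + q ^+ 2 * t^-1).

Lemma mac_triple k l : mac q t (E 1 * (E k * E l)) =
  mac_ev3 k l *: (E 1 * (E k * E l)) +
  \sum_(s < l) ((1 - q) ^+ 2 * (ti (k + s).+1 - ti (l - s.+1))) *:
               (E 1 * (E (k + s).+1 * E (l - s.+1)%N)) +
  (1 - q) *: ((q * (1 - q)) *: ((ti k.+1 - 1) *: (E k.+1 * E l)
                                + (ti l.+1 - 1) *: (E k * E l.+1))
  + (1 - q) ^+ 2 *: \sum_(s < l.+1)
      (ti (k + s).+1 - ti (l - s)) *: (E (k + s).+1 * E (l - s)%N)).
Proof.
rewrite (mac_plE1 natF_neq0 q t_neq0) // mac_pair (mac_gen natF_neq0 q t_neq0 t_nroot).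
rewrite ygen_coef.
rewrite !agenS_coef !agen_elow elow0 vgen_elow /mac_ev3.
have elow1 : elow t 1 = (t^-1 * (1 - t)) *: E 1.
  by rewrite /elow expr1 (plE1 natF_neq0 t_nroot) scalerA.
rewrite elow1; have -> : \sum_(s < l) ((1 - q) ^+ 2 * (ti (k + s).+1 - ti (l - s.+1))) *:
    (E 1 * (E (k + s).+1 * E (l - s.+1)%N)) = E 1 *
    \sum_(s < l) ((1 - q) ^+ 2 * (ti (k + s).+1 - ti (l - s.+1))) *:
    (E (k + s).+1 * E (l - s.+1)%N).
  by rewrite mulr_sumr; apply: eq_bigr => s _; rewrite -scalerAr.
move: (\sum_(s < l) _) (\sum_(s < l.+1) _) => X Y.
have tt : t^-1 * (1 - t) = t^-1 - 1 by rewrite mulrBr mulVf // mulr1.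
rewrite tt /mac_ev; have [io eio] := scale_io Sym; rewrite !eio; ring.
Qed.

Definition H3op_coef i j := (1 - t) * ((1 - q * t ^+ j.+1) * (1 - q ^+ 2 * t ^+ i)).

(** The coefficient (i, j) of the series (u - v) K(E(u) E(v)). *)
Definition H3op_num i j : Sym :=
  H3op_coef i j *: (E 1 * (E i * E j.+1)) - H3op_coef j i *: (E 1 * (E i.+1 * E j))
  + ((1 - q) * ((1 - q ^+ 2 * t ^+ i) * (t ^+ j.+2 - 1))) *: (E i * E j.+2)
  - ((1 - q) * ((1 - q ^+ 2 * t ^+ j) * (t ^+ i.+2 - 1))) *: (E i.+2 * E j).

Lemma H3op_pair k l : H3op q t (E k * E l) =
  \sum_(s < l.+1) H3op_num (k + s).+1 (l - s).
Proof.
rewrite /H3op -!(HopE natF_neq0) !(Hop_gen natF_neq0 t_neq0 t_nroot).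
rewrite !(Hbar_gen natF_neq0 t_neq0 t_nroot) !vgenS_coef.
have h0 n : agen (hsign F) (E : fps Sym) 0 n = t ^+ n *: E n.
  by rewrite agen0 (rel_h natF_neq0 t_nroot) fps_scaleA.
have e0 n : agen (sf_e F) (fps_scale t%:A (E : fps Sym)) 0 n = E n.
  by rewrite agen0 (rel_e natF_neq0 t_nroot).
have eh0 := hsign0 F.
have eh1 := hsign1_plE natF_neq0 t_nroot.
have ee0 : sf_e F 0 = 1 by rewrite (weighted0 (weighted_e F)).
rewrite !scaler_sumr -sumrN -!big_split /= !mulr_sumr !scaler_sumr -big_split /=.
apply: eq_bigr => s _.
rewrite !agenS_coef !h0 !e0 eh0 eh1 ee0 !fps_scaleA (plE1 natF_neq0 t_nroot).
rewrite /H3op_num /H3op_coef; have [io eio] := scale_io Sym; rewrite !eio; ring.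
Qed.
End Pairs.

(** * Self-adjointness of Macdonald's operator *)

Section SelfAdjoint.
Variable F : fieldType.
Hypothesis natF_neq0 : forall n, n.+1%:R != 0 :> F.
Local Notation Sym := (symfun F).
Implicit Types (f g : Sym) (w v : nat -> F).

Lemma skew_rescale w v j g :
  skew w j (rescale v g) = rescale v (skew (fun k => v k * w k) j g).
Proof.
elim/(symfun_ind natF_neq0): g j => [j|f g IHf IHg j|c f IHf j|k f IHf j].
- by rewrite rmorph1 !skew1 rmorph_nat.
- by rewrite !linearD /= IHf IHg.
- by rewrite !linearZ /= IHf.
rewrite rmorphM /= (rescale_p natF_neq0) -scalerAl linearZ /= (skew_p natF_neq0).
rewrite (skew_p natF_neq0) rmorphD rmorphM /= (rescale_p natF_neq0) scalerDr IHf scalerAl.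
congr (_ + _); case: ifP => _; last by rewrite scaler0 rmorph0.
by rewrite IHf scalerA [RHS]linearZ.
Qed.

Variables q t : F.
Hypothesis t_neq0 : t != 0.

(** The weights of the form for which D is self-adjoint. *)
Definition psi_weight k : F := (1 - q ^+ k) * (1 - t ^+ k).

(** D is a sum of products of a multiplication and a skewing operator. Taking
    adjoints exchanges the two, and the rescaling by psi exchanges their weights
    up to a factor t^-k that migrates from one to the other. *)
Lemma mac_selfadjoint f g : sprod (mac q t f) (rescale psi_weight g) =
  sprod f (rescale psi_weight (mac q t g)).
Proof.
pose N := (size (transl (mac_weight q t) f) + size (transl (mac_weight q t) g))%N.
rewrite /mac (@vertexE _ _ _ _ f N) ?leq_addr // (@vertexE _ _ _ _ g N) ?leq_addl //.
rewrite [rescale _ (\sum_(_ < _) _)]linear_sum.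
rewrite (sprod_suml natF_neq0) (sprod_sumr natF_neq0); apply: eq_bigr => k _.
rewrite !add0n.
have nlow : weighted (fun k => t^-1 ^+ k * (-1) ^+ k.-1) (elow t).
  exact: weighted_scale (weighted_e F).
have nmac := weighted_seqP natF_neq0 (mac_weight q t).
rewrite (sprod_weighted natF_neq0 _ _ _ nlow).
rewrite sprodC -(sprod_weighted natF_neq0 _ _ _ nmac) sprodC.
congr (sprod f _); rewrite skew_rescale.
rewrite [RHS](rmorphM (rescale psi_weight)) /=.
have -> : rescale psi_weight (elow t k) = t^-1 ^+ k *: weighted_seq (mac_weight q t) k.
  have n1 := weighted_rescale natF_neq0 psi_weight nlow.
  have n2 := weighted_scale t^-1 nmac.
  refine (weighted_uniq natF_neq0 n1 _ k); apply: eq_weighted n2 => i.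
  by rewrite /psi_weight /mac_weight; ring.
rewrite -scalerAl scalerAr -linearZ /=; congr (_ * rescale _ _).
rewrite -(skewS natF_neq0).
by apply: eq_skew => // i; rewrite /psi_weight /mac_weight; ring.
Qed.
End SelfAdjoint.

(** * Spans of initial segments *)

Section Span.
Variables (F : fieldType) (V : lmodType F).
Implicit Types (v w : nat -> V) (x y : V).

(** Only initial segments of a sequence occur; membership is a proposition
    because the vectors need not be linearly independent. *)
Definition span v N x := exists c : nat -> F, x = \sum_(i < N) c i *: v i.

Lemma span0 v N : span v N 0.
Proof. by exists (fun=> 0); rewrite big1 // => i _; rewrite scale0r. Qed.
Lemma spanD v N x y : span v N x -> span v N y -> span v N (x + y).
Proof.
move=> [c ->] [d ->]; exists (fun i => c i + d i).
by rewrite -big_split; apply: eq_bigr => i _; rewrite scalerDl.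
Qed.
Lemma spanZ v N a x : span v N x -> span v N (a *: x).
Proof.
move=> [c ->]; exists (fun i => a * c i).
by rewrite scaler_sumr; apply: eq_bigr => i _; rewrite scalerA.
Qed.
Lemma spanN v N x : span v N x -> span v N (- x).
Proof. by rewrite -scaleN1r; apply: spanZ. Qed.
Lemma spanB v N x y : span v N x -> span v N y -> span v N (x - y).
Proof. by move=> sx sy; apply/spanD/spanN. Qed.
Lemma span_sum v N I (r : seq I) (P : pred I) (h : I -> V) :
  (forall i, P i -> span v N (h i)) -> span v N (\sum_(i <- r | P i) h i).
Proof.
by move=> sh; elim/big_rec: _ => [|i x Pi sx]; [apply: span0|apply: spanD => //; apply: sh].
Qed.
Lemma span_mem v N i : (i < N)%N -> span v N (v i).
Proof.
move=> ltiN; exists (fun j => (j == i)%:R).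
rewrite (bigD1 (Ordinal ltiN)) //= eqxx scale1r big1 ?addr0 // => j nj.
by rewrite -val_eqE /= in nj; rewrite (negPf nj) scale0r.
Qed.
Lemma span_sub v N w M x : (forall i, (i < N)%N -> span w M (v i)) ->
  span v N x -> span w M x.
Proof.
by move=> sv [c ->]; apply: span_sum => i _; apply/spanZ/sv.
Qed.
Lemma span_widen v N M x : (N <= M)%N -> span v N x -> span v M x.
Proof.
by move=> leNM; apply: span_sub => i lti; apply: span_mem; exact: leq_trans leNM.
Qed.
Lemma eq_span v w N x : (forall i, (i < N)%N -> v i = w i) -> span v N x -> span w N x.
Proof.
by move=> eqv; apply: span_sub => i lti; rewrite eqv //; apply: span_mem.
Qed.
End Span.

Lemma span_map (F : fieldType) (V W : lmodType F) (L : {linear V -> W}) v N x :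
  span v N x -> span (fun i => L (v i)) N (L x).
Proof.
move=> [c ->]; exists c; rewrite linear_sum; apply: eq_bigr => i _.
by rewrite linearZ.
Qed.

(** * Pieri rules for two columns *)

Lemma nth_part21 a b i : nth 0%N (part21 a b) i = ((i < a) + (i < a + b))%N.
Proof.
rewrite /part21 /= nth_cat size_nseq !nth_nseq; case: ltnP => lea; last first.
  by case: (ltnP (i - a) b); case: (ltnP i (a + b)); lia.
by rewrite ltn_addr.
Qed.

Lemma nth_part321 a b i :
  nth 0%N (part321 a b) i = ((i < 1) + (i < a.+1) + (i < (a + b).+1))%N.
Proof. by case: i => [//|i]; rewrite [LHS](nth_part21 a b i) add0n !ltnS. Qed.

Section Pieri.
Variable F : fieldType.
Hypothesis natF_neq0 : forall n, n.+1%:R != 0 :> F.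
Local Notation Sym := (symfun F).
Local Notation alt := (alt F).

Lemma eq_alt n (a b : 'I_n -> nat) : a =1 b -> alt a = alt b.
Proof. by move=> eqab; congr (\det _); apply/matrixP => i j; rewrite !mxE eqab. Qed.

Lemma alt_eq0 n (a : 'I_n -> nat) i j : i != j -> a i = a j -> alt a = 0.
Proof.
move=> nij eqa; rewrite -[alt a]/(\det (\matrix_(k, i) 'X_k ^+ a i)) -det_tr; apply: (determinant_alternate nij) => k.
by rewrite !mxE eqa.
Qed.

(** The term of the alternant for a permutation s times the monomial of a set S
    is the term for the exponents raised on s(S). *)
Lemma mesym_alt n k (a : 'I_n -> nat) : mesym n F k * alt a =
  \sum_(S : {set 'I_n} | #|S| == k) alt (fun i => (a i + (i \in S))%N).
Proof.
rewrite mesymE alt_leibniz mulr_sumr.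
under [RHS]eq_bigr do rewrite alt_leibniz.
rewrite [RHS]exchange_big; apply: eq_bigr => s _.
rewrite mulr_suml [RHS](reindex_inj (imset_inj (@perm_inj _ s))) /=.
apply: eq_big => [S|S _]; first by rewrite card_imset //; exact: perm_inj.
rewrite -scalerAr -mpolyXD; congr (_ *: mpolyX _ _).
by apply/mnmP => i; rewrite mnmDE !mnmE /= mem_imset; [exact: addnC|exact: perm_inj].
Qed.

Lemma schur_alt n (l : intpart) : (size l <= n)%N ->
  sf_proj n (schur F l) * alt (@rho n) = alt (rho_plus l).
Proof. by move=> szl; rewrite (alt_jt natF_neq0) det_jt. Qed.

Lemma alt_rho_neq0 n : alt (@rho n) != 0.
Proof.
apply/eqP => eq0; have := @alt_rho_coef F n (part21 0 0) (part21 0 0) (leq0n n) (leq0n n).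
have -> : alt (@rho_plus n (part21 0 0)) = alt (@rho n).
  by apply: eq_alt => i; rewrite /rho_plus nth_nil.
by rewrite eq0 mcoeff0 eqxx => /esym/eqP; rewrite oner_eq0.
Qed.

(** A function of degree n is determined by its component in n variables, and
    multiplication by the Vandermonde determinant is injective. *)
Lemma lift_span n (f : Sym) (m : nat -> intpart) N : sf_homog n f ->
  (forall i, (i < N)%N -> sumn (m i) = n) ->
  span (fun i => alt (@rho_plus n (m i))) N (sf_proj n f * alt (@rho n)) ->
  span (fun i => schur F (m i)) N f.
Proof.
move=> hf hm [c eqc]; exists c; apply/eqP; rewrite -subr_eq0; apply/eqP.
set g := \sum_(i < N) _.
have hg : sf_homog n g.
  apply: sf_homog_sum => i; apply: sf_homogZ.
  by have := schur_homog F (m i); rewrite hm.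
have hfg : sf_homog n (f - g).
  by rewrite addrC -scaleN1r; apply: sf_homog_lin.
apply: (symfun_eq0_deg (N := n)) => [k mm ltn_mm|].
  have [//|] := boolP (mm \in msupp (sf_fam (f - g) k)); last by rewrite -mcoeff_eq0 => /eqP.
  move: (hfg k) => /dhomogP/(_ mm) hk /hk mdE.
  by rewrite mdE ltnn in ltn_mm.
apply/eqP; rewrite -/(sf_proj n _) rmorphB /= subr_eq0; apply/eqP.
apply: (mulIf (alt_rho_neq0 n)); rewrite eqc /g rmorph_sum mulr_suml.
apply: eq_bigr => i _; rewrite [X in _ = X * _]sf_projZ -scalerAl schur_alt //.
by rewrite -[X in (_ <= X)%N](hm i) //; exact: part_sumn_ge.
Qed.

(** The combinatorial form of the vanishing criterion: within a block of equal
    parts, only strips that are initial segments contribute. *)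
Lemma initial_segment (P : nat -> bool) u w : (u <= w)%N ->
  (forall i, (u <= i)%N -> (i.+1 < w)%N -> P i.+1 -> P i) ->
  exists2 c, (c <= w - u)%N & forall i, (u <= i < w)%N -> P i = (i < u + c)%N.
Proof.
elim: w => [|w IH] leuw down; first by exists 0%N => // i; rewrite andbF.
case: (eqVneq u w.+1) => [->|nuw].
  by exists 0%N => // i /andP[lei lti]; lia.
have [|i lei lti|c lec Pc] := IH; first by lia.
  by apply: down => //; lia.
case: (boolP (P w)) => Pw; last first.
  exists c; first by lia.
  move=> i /andP[lei]; rewrite ltnS leq_eqVlt => /orP[/eqP ->|lti].
    by rewrite (negPf Pw); lia.
  by apply: Pc; rewrite lei.
have ec : c = (w - u)%N.
  case: (eqVneq u w) => [euw|nuw']; first by lia.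
  have := Pc w.-1; rewrite (down w.-1); [lia|lia|lia|].
  by rewrite prednK //; lia.
exists (w.+1 - u)%N => // i /andP[lei lti].
case: (eqVneq i w) => [->|niw]; first by rewrite Pw; lia.
by rewrite Pc ?ec; lia.
Qed.

Lemma card_ord_lt n c : (c <= n)%N -> #|[set i : 'I_n | (i < c)%N]| = c.
Proof.
move=> lec; rewrite cardsE -sum1_card -(big_ord_widen n (fun=> 1%N)) //.
by rewrite sum1_card card_ord.
Qed.

Lemma rho_succ n (i j : 'I_n) : j = i.+1 :> nat -> rho i = (rho j).+1.
Proof. by move=> eqj; have := ltn_ord j; rewrite /rho; lia. Qed.

(** A strip that is not stacked at the top of a block of equal parts
    contributes an alternant with two equal exponents. *)
Lemma vstrip_eq0 n (l : seq nat) (S : {set 'I_n}) (i j : 'I_n) :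
  j = i.+1 :> nat -> nth 0%N l i = nth 0%N l j -> i \notin S -> j \in S ->
  alt (fun x => (rho_plus l x + (x \in S))%N) = 0.
Proof.
move=> eqj eql iS jS; apply: (@alt_eq0 _ _ i j).
  by apply/eqP => eqij; rewrite eqij jS in iS.
by rewrite /rho_plus eql (rho_succ eqj) (negPf iS) jS; lia.
Qed.

Definition twocol n c := part21 c (n - c.*2).

Lemma sumn_part21 a b : sumn (part21 a b) = (a.*2 + b)%N.
Proof. by rewrite /part21 /= sumn_cat !sumn_nseq; lia. Qed.
Lemma sumn_part321 a b : sumn (part321 a b) = (a.*2 + b).+3.
Proof. by rewrite [LHS]/= -/(sumn (part21 a b)) sumn_part21. Qed.

(** A strip added to a column of height l consists of c boxes in the second
    column and k - c below the first one, or its alternant vanishes. The case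
    c = l, which arises once, is the leading term. *)
Lemma pieri_col n k l (S : {set 'I_n}) : n = (k + l)%N -> (l <= k)%N -> #|S| = k ->
  let a := alt (fun i => (rho_plus (part21 0 l) i + (i \in S))%N) in
  a = 0 \/ exists c, [/\ (c <= l)%N, a = alt (rho_plus (twocol n c)) &
                         c = l -> S = [set i : 'I_n | (i < k)%N]].
Proof.
move=> nE lelk cardS a.
case: (boolP [exists i : 'I_n, [exists j : 'I_n,
    [&& j == i.+1 :> nat, nth 0%N (part21 0 l) i == nth 0%N (part21 0 l) j,
        i \notin S & j \in S]]]).
  move=> /existsP[i /existsP[j /and4P[/eqP eqj /eqP eql iS jS]]]; left.
  exact: vstrip_eq0 eqj eql iS jS.
move=> /existsPn noij; right.
pose P x := if insub x is Some i then (i : 'I_n) \in S else false.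
have PE (i : 'I_n) : P i = (i \in S) by rewrite /P valK.
have down i : (i.+1 < n)%N -> i.+1 != l -> P i.+1 -> P i.
  move=> ltSi nil Pi; have lti := ltnW ltSi.
  have := noij (Ordinal lti) => /existsPn /(_ (Ordinal ltSi)).
  rewrite !nth_part21 -!PE /= eqxx Pi andbT /=; case: (P i); rewrite // andbT.
  by case/eqP; case: ltnP; case: ltnP; lia.
have [||c lec Pc] := @initial_segment P 0 l; first by [].
  by move=> i _ lti; apply: down; lia.
have [||d led Pd] := @initial_segment P l n; first by lia.
  by move=> i lei lti; apply: down; lia.
have SE (i : 'I_n) : (i \in S) = (i < c)%N || (l <= i < l + d)%N.
  rewrite -PE; have [lti|lei] := ltnP i l; first by rewrite Pc //= orbF.
  by rewrite Pd ?lei ?ltn_ord //; lia.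
have cd : (c + d)%N = k.
  rewrite -cardS -(cardsID [set i : 'I_n | (i < l)%N] S).
  have -> : S :&: [set i : 'I_n | (i < l)%N] = [set i : 'I_n | (i < c)%N].
    by apply/setP => i; rewrite !inE SE; lia.
  have -> : S :\: [set i : 'I_n | (i < l)%N] =
      [set i : 'I_n | (i < l + d)%N] :\: [set i : 'I_n | (i < l)%N].
    by apply/setP => i; rewrite !inE SE; lia.
  rewrite cardsD (finset.setIidPr _); last by apply/fintype.subsetP => i; rewrite !inE; lia.
  by rewrite !card_ord_lt; lia.
exists c; split=> [||cl]; first by lia.
  apply: eq_alt => i; rewrite /rho_plus !nth_part21 SE.
  by have := ltn_ord i; lia.
by apply/setP => i; rewrite inE SE; lia.
Qed.

Lemma alt_proj_e n k (l : intpart) : (size l <= n)%N ->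
  sf_proj n (sf_e F k * schur F l) * alt (@rho n) =
  \sum_(S : {set 'I_n} | #|S| == k) alt (fun i => (rho_plus l i + (i \in S))%N).
Proof. by move=> szl; rewrite rmorphM -mulrA /= schur_alt // -mesym_alt. Qed.

Lemma e_mul_schur_col k l : (l <= k)%N ->
  span (fun c => schur F (twocol (k + l) c)) l
    (sf_e F k * schur F (part21 0 l) - schur F (twocol (k + l) l)).
Proof.
move=> lelk; pose n := (k + l)%N.
have sz0 : (size (part21 0 l) <= n)%N by rewrite size_cat !size_nseq /n; lia.
have hl : sumn (twocol n l) = n by rewrite sumn_part21 /n; lia.
apply: (lift_span (n := n)) => [|i lti|].
- rewrite addrC -scaleN1r; apply: sf_homog_lin.
    by have := schur_homog F (twocol n l); rewrite hl.
  apply: sf_homogM (sf_e_homog F k) _.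
  by have := schur_homog F (part21 0 l); rewrite sumn_part21.
- by rewrite sumn_part21; lia.
rewrite rmorphB mulrBl [X in span _ _ (X - _)]alt_proj_e //.
rewrite [X in span _ _ (_ - X)]schur_alt; last by rewrite -[X in (_ <= X)%N]hl part_sumn_ge.
have cS0 : #|[set i : 'I_n | (i < k)%N]| == k by rewrite card_ord_lt // /n; lia.
rewrite (bigD1 _ cS0).
have -> : alt (fun i : 'I_n => (rho_plus (part21 0 l) i +
    (i \in [set i : 'I_n | (i < k)%N]))%N) = alt (rho_plus (twocol n l)).
  apply: eq_alt => i; rewrite /rho_plus !nth_part21 inE.
  by have := ltn_ord i; rewrite /n; lia.
rewrite addrC addKr; apply: span_sum => S /andP[/eqP cS nS].
have [-> | [c [lec -> cl]]] := pieri_col erefl lelk cS; first exact: span0.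
rewrite /n; apply: (span_mem (fun c => alt (@rho_plus (k + l) (twocol (k + l) c)))).
rewrite ltn_neqAle lec andbT; apply/eqP => ecl.
by rewrite (cl ecl) eqxx in nS.
Qed.

Lemma schur_nil : schur F (part21 0 0) = 1.
Proof. exact: det_mx00. Qed.

Lemma schur_col l : schur F (part21 0 l) = sf_e F l.
Proof.
have [c] := @e_mul_schur_col l 0 (leq0n l).
rewrite big_ord0 schur_nil mulr1 addn0 => /eqP; rewrite subr_eq0 => /eqP ->.
by rewrite /twocol subn0.
Qed.

Lemma e_mul_schur k l : (l <= k)%N ->
  span (fun c => schur F (twocol (k + l) c)) l
    (sf_e F k * sf_e F l - schur F (twocol (k + l) l)).
Proof. by rewrite -(schur_col l); apply: e_mul_schur_col. Qed.

Lemma pieri_one_first n c (i : 'I_n) : (0 < c)%N -> (c.*2 < n)%N ->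
  nat_of_ord i = 0%N ->
  alt (fun x => (rho_plus (twocol n.-1 c) x + (x == i))%N) =
  alt (rho_plus (part321 c.-1 (n.-1 - c.*2))).
Proof.
move=> c0 lecn i0; apply: eq_alt => x.
rewrite /rho_plus nth_part321 nth_part21 -val_eqE /= i0; lia.
Qed.

(** A box not in the first row goes to the end of the second or of the first
    column; elsewhere its alternant vanishes. *)
Lemma pieri_one_other n c (i : 'I_n) : (0 < c)%N -> (c.*2 < n)%N ->
  nat_of_ord i != 0%N ->
  alt (fun x => (rho_plus (twocol n.-1 c) x + (x == i))%N) = 0 \/
  exists2 d, (d < n./2.+1)%N &
    alt (fun x => (rho_plus (twocol n.-1 c) x + (x == i))%N) =
    alt (rho_plus (twocol n d)).
Proof.
move=> c0 lecn i0.
have [eic|nic] := eqVneq (i : nat) c.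
  have [ec|nc] := eqVneq c (n.-1 - c)%N.
    right; exists c; first by lia.
    apply: eq_alt => x; rewrite /rho_plus !nth_part21 -val_eqE /= eic.
    by lia.
  right; exists c.+1; first by lia.
  apply: eq_alt => x; rewrite /rho_plus !nth_part21 -val_eqE /= eic.
  by lia.
have [eic'|nic'] := eqVneq (i : nat) (n.-1 - c)%N.
  right; exists c; first by lia.
  apply: eq_alt => x; rewrite /rho_plus !nth_part21 -val_eqE /= eic'.
  by lia.
left; have lti := ltn_ord i; have lti' : (i.-1 < n)%N by lia.
have eqi : i = (Ordinal lti').+1 :> nat by rewrite /=; lia.
rewrite -(@vstrip_eq0 n (twocol n.-1 c) [set i] (Ordinal lti') i) //.
- by apply: eq_alt => x; rewrite inE.
- by rewrite !nth_part21 /=; lia.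
- by rewrite inE -val_eqE /=; lia.
- by rewrite inE.
Qed.

Lemma e1_mul_schur n c : (0 < c)%N -> (c.*2 < n)%N ->
  span (fun d => schur F (twocol n d)) n./2.+1
    (sf_e F 1 * schur F (twocol n.-1 c) - schur F (part321 c.-1 (n.-1 - c.*2))).
Proof.
move=> c0 lecn.
have h1 : sumn (twocol n.-1 c) = n.-1 by rewrite sumn_part21; lia.
have h2 : sumn (part321 c.-1 (n.-1 - c.*2)) = n by rewrite sumn_part321; lia.
apply: (lift_span (n := n)) => [|i lti|].
- rewrite addrC -scaleN1r; apply: sf_homog_lin.
    by have := schur_homog F (part321 c.-1 (n.-1 - c.*2)); rewrite h2.
  have := schur_homog F (twocol n.-1 c); rewrite h1 => hh.
  by have := sf_homogM (sf_e_homog F 1) hh; rewrite add1n prednK //; lia.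
- by rewrite sumn_part21; lia.
rewrite rmorphB mulrBl [X in span _ _ (X - _)]alt_proj_e; last first.
  by rewrite (leq_trans (part_sumn_ge _)) // h1; lia.
rewrite [X in span _ _ (_ - X)]schur_alt; last by rewrite -[X in (_ <= X)%N]h2 part_sumn_ge.
have n0 : (0 < n)%N by lia.
have cS0 : #|[set Ordinal n0]| == 1%N by rewrite cards1.
rewrite (bigD1 _ cS0).
have inS1 (i : 'I_n) : alt (fun x => (rho_plus (twocol n.-1 c) x + (x \in [set i]))%N) =
    alt (fun x => (rho_plus (twocol n.-1 c) x + (x == i))%N).
  by apply: eq_alt => x; rewrite inE.
rewrite inS1 (pieri_one_first (i := Ordinal n0) c0 lecn) // addrC addKr.
apply: span_sum => S /andP[/cards1P[i ->] ni0]; rewrite inS1.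
have i0 : nat_of_ord i != 0%N by apply: contraNneq ni0 => i0; apply/eqP; congr [set _]; apply: val_inj.
have [-> | [d ltd ->]] := pieri_one_other c0 lecn i0; first exact: span0.
exact: (span_mem (fun d => alt (@rho_plus n (twocol n d)))).
Qed.
End Pieri.

(** * Partitions below those of the theorem *)

Lemma sumn_takeS (s : seq nat) k : sumn (take k.+1 s) = (sumn (take k s) + nth 0%N s k)%N.
Proof.
have [ltk|lek] := ltnP k (size s).
  by rewrite (take_nth 0%N) // -cats1 sumn_cat /= addn0.
by rewrite nth_default // addn0 !take_oversize // (leq_trans lek).
Qed.

Lemma sumn_take21 a b k :
  sumn (take k (part21 a b)) = (minn k a + minn k (a + b))%N.
Proof.
elim: k => [|k IH]; first by rewrite take0 !min0n.
by rewrite sumn_takeS IH nth_part21; lia.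
Qed.

Lemma sumn_take321 a b k : sumn (take k (part321 a b)) =
  (minn k 1 + minn k a.+1 + minn k (a + b).+1)%N.
Proof.
elim: k => [|k IH]; first by rewrite take0 !min0n.
by rewrite sumn_takeS IH nth_part321; lia.
Qed.

Lemma perm_12 (s : seq nat) : all (fun k => 0 < k <= 2)%N s ->
  perm_eq s (nseq (count_mem 2 s) 2 ++ nseq (count_mem 1 s) 1)%N.
Proof.
elim: s => [//|k s IH] /= /andP[k12 /IH ps].
have [->|->] : k = 1%N \/ k = 2%N by lia.
  rewrite [X in nseq X 2%N](_ : _ = count_mem 2%N s) //.
  rewrite [X in nseq X 1%N](_ : _ = (count_mem 1%N s).+1) //.
  by rewrite -[nseq _.+1 _]cat1s perm_sym perm_catCA perm_cons perm_sym.
by rewrite /= add0n perm_cons.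
Qed.

Lemma part_le2 (m : intpart) : (nth 0 m 0 <= 2)%N ->
  exists2 c, (c.*2 <= sumn m)%N & m = twocol (sumn m) c.
Proof.
move=> le2; have p12 : all (fun k => 0 < k <= 2)%N m.
  apply/allP => k km; rewrite (part_pos km) /=.
  by apply: leq_trans le2; rewrite nth0; have /allP/(_ k km) := part_head_max m.
have pm := perm_12 p12; have sm := perm_sumn pm.
move: pm sm; set c := count_mem 2 m; set d := count_mem 1 m => pm sm.
rewrite sumn_cat !sumn_nseq in sm; exists c; first by lia.
apply: part_eq; rewrite (perm_trans pm) // /twocol sm.
by have -> : (2 * c + 1 * d - c.*2)%N = d by lia.
Qed.

Lemma part_3le2 (m : intpart) : nth 0%N m 0 = 3%N -> (nth 0 m 1 <= 2)%N ->
  exists c d, m = part321 c d.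
Proof.
case: m => [[//|k s]] km /= k3 le2; rewrite k3 in km *.
have ks : is_part s.
  move: km; rewrite /is_part /= inE negb_or => /andP[so /andP[_ ->]].
  by rewrite (path_sorted so).
have [c _ mE] := @part_le2 (IntPart ks) le2.
exists c, (sumn s - c.*2)%N; apply: val_inj => /=; congr (_ :: _).
exact: (congr1 parts mE).
Qed.

(** This order refines the dominance order, so that the partitions dominated by
    an entry come before it; see [flag_part_below]. *)
Definition flag_part n i : intpart :=
  if (i < n./2.+1)%N then twocol n i
  else part321 (i - n./2.+1) (n - 3 - (i - n./2.+1).*2).
(** Beyond this index the multiplicity of the part 1 would be negative. *)
Definition flag_size n := (n./2.+1 + n.-1./2)%N.

Lemma flag_part_sumn n i : (i < flag_size n)%N -> sumn (flag_part n i) = n.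
Proof.
rewrite /flag_size /flag_part; case: (ltnP i n./2.+1) => lti ltN.
  by rewrite sumn_part21; lia.
by rewrite sumn_part321; lia.
Qed.

(** Comparing the sums of the first c (or c + 1) parts bounds the number of
    parts equal to 2. *)
Lemma flag_part_below n i (m : intpart) : (i < flag_size n)%N ->
  dominance_lt m (flag_part n i) -> exists2 j, (j < i)%N & m = flag_part n j.
Proof.
move=> ltN [nm sm dom]; rewrite (flag_part_sumn ltN) in sm.
have head1 : (nth 0 m 0 <= nth 0 (flag_part n i) 0)%N.
  by have := dom 1%N; rewrite !sumn_takeS !take0.
move: nm dom head1; rewrite /flag_part; case: ltnP => lti nm dom head1.
  have [|c lec mE] := @part_le2 m.
    by apply: leq_trans head1 _; rewrite nth_part21; lia.
  rewrite sm in lec mE; have := dom c; rewrite mE !sumn_take21 => domc.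
  have ci : c <> i by move=> ci; apply: nm; rewrite mE ci.
  exists c; first by lia.
  by case: ltnP => //; lia.
have [le2|gt2] := leqP (nth 0 m 0)%N 2.
  have [c lec mE] := part_le2 le2; rewrite sm in lec mE.
  exists c; first by lia.
  by case: ltnP => //; lia.
have e3 : nth 0%N m 0 = 3%N by move: head1; rewrite nth_part321; lia.
have [|c [d mE]] := part_3le2 e3.
  by have := dom 2%N; rewrite !sumn_takeS !take0 e3 !nth_part321; lia.
have := dom c.+1; rewrite mE !sumn_take321 => domc.
move: sm; rewrite mE sumn_part321 => sm.
have ci : c <> (i - n./2.+1)%N.
  move=> ci; apply: nm; rewrite mE ci; congr part321; move: sm; lia.
exists (n./2.+1 + c)%N; first by move: ltN; rewrite /flag_size; lia.
case: ltnP => [|_]; first by lia.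
by congr part321; lia.
Qed.

Lemma count_part21 a b : count_mem 2%N (part21 a b) = a.
Proof. by rewrite /part21 /= count_cat !count_nseq /= mul1n mul0n addn0. Qed.
Lemma count_part321 a b : count_mem 2%N (part321 a b) = a.
Proof. by rewrite [LHS]/= add0n; exact: (count_part21 a b). Qed.

Lemma flag_part_inj n i j : (i < flag_size n)%N -> (j < flag_size n)%N ->
  flag_part n i = flag_part n j -> i = j.
Proof.
rewrite /flag_size => lti ltj eqf.
have : count_mem 2%N (flag_part n i) = count_mem 2%N (flag_part n j) by rewrite eqf.
have : nth 0%N (flag_part n i) 0 = nth 0%N (flag_part n j) 0 by rewrite eqf.
rewrite /flag_part; case: (ltnP i n./2.+1) => lei; case: (ltnP j n./2.+1) => lej;
  rewrite ?nth_part21 ?nth_part321 ?count_part21 ?count_part321; lia.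
Qed.

Section DominanceInd.
Implicit Types (l m : intpart).
(** A natural number that is strictly monotone for dominance, which makes
    dominance well founded. *)
Definition dom_measure l := \sum_(k < (sumn l).+2) sumn (take k l).

Lemma dom_measure_lt m l : dominance_lt m l -> (dom_measure m < dom_measure l)%N.
Proof.
move=> [nml sml dom]; rewrite /dom_measure sml.
have [/existsP[k ltk]|/existsPn noS] :=
    boolP [exists k : 'I_(sumn l).+2, sumn (take k m) < sumn (take k l)]%N.
  rewrite (bigD1 k) //= [ltnRHS](bigD1 k) //= -addSn leq_add //.
  by apply: leq_sum => i _; exact: dom.
case: nml; apply: part_nth_eq => i.
have eqk k : (k <= (sumn l).+1)%N -> sumn (take k m) = sumn (take k l).
  move=> lek; have lek' : (k < (sumn l).+2)%N by [].
  by have := noS (Ordinal lek'); have := dom k; rewrite /=; lia.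
have [lei|lti] := leqP i (sumn l).
  by have := eqk i.+1 lei; rewrite !sumn_takeS eqk; lia.
rewrite !nth_default //; last by rewrite -sml in lti; exact: leq_trans (part_sumn_ge _) (ltnW lti).
exact: leq_trans (part_sumn_ge _) (ltnW lti).
Qed.

Lemma dominance_ind (P : intpart -> Prop) :
  (forall l, (forall m, dominance_lt m l -> P m) -> P l) -> forall l, P l.
Proof.
move=> IH l; have [n] := ubnP (dom_measure l); elim: n l => [//|n IHn] l ltn.
apply: IH => m /dom_measure_lt ltm; apply: IHn.
by apply: leq_trans ltm _; rewrite -ltnS.
Qed.
End DominanceInd.

(** * Unitriangularity of Schur functions over products of elementary ones *)
Section Flag.
Variable F : fieldType.
Hypothesis natF_neq0 : forall n, n.+1%:R != 0 :> F.
Local Notation Sym := (symfun F).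

(** The product attached to [flag_part n i], for the sequence c of the e_k or of
    the E_k: the factors are the column heights. *)
Definition flag (c : nat -> Sym) n i : Sym :=
  if (i < n./2.+1)%N then c (n - i)%N * c i
  else c 1%N * (c (n - 2 - (i - n./2.+1))%N * c (i - n./2.+1).+1).

Lemma span_mul (a : Sym) v N x : span v N x -> span (fun i => a * v i) N (a * x).
Proof.
move=> [d ->]; exists d; rewrite mulr_sumr; apply: eq_bigr => i _.
by rewrite -scalerAr.
Qed.

Lemma flag_pair c n k l : (k + l)%N = n -> span (flag c n) n./2.+1 (c k * c l).
Proof.
wlog lelk : k l / (l <= k)%N => [wl|] kl.
  have [/wl|/ltnW /wl wl'] := leqP l k; first exact.
  by rewrite mulrC; apply: wl'; rewrite addnC.
have ltl : (l < n./2.+1)%N by lia.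
have := span_mem (flag c n) ltl; rewrite {2}/flag ltl.
by have -> : (n - l)%N = k by lia.
Qed.

Lemma flag_triple c n k l N : c 0%N = 1 -> (k + l).+1 = n -> (l <= k)%N ->
  (n./2.+1 + l <= N)%N -> span (flag c n) N (c 1%N * (c k * c l)).
Proof.
move=> c0 kl lelk leN; case: l kl lelk leN => [|l] kl lelk leN.
  rewrite c0 mulr1; apply: (span_widen (N := n./2.+1)); first by lia.
  by apply: flag_pair; lia.
have ltl : (n./2.+1 + l < N)%N by lia.
have := span_mem (flag c n) ltl; rewrite {2}/flag ltnNge leq_addr /= addKn.
by have -> : (n - 2 - l)%N = k by lia.
Qed.

Lemma schur_twocol_flag n i : (i < n./2.+1)%N ->
  span (flag (sf_e F) n) i (schur F (twocol n i) - flag (sf_e F) n i).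
Proof.
elim/ltn_ind: i => i IH lti; rewrite /flag lti -opprB; apply: spanN.
have lei : (i <= n - i)%N by lia.
have := e_mul_schur natF_neq0 lei; rewrite subnK; last by lia.
apply: span_sub => j ltj; rewrite -[schur _ _](subrK (flag (sf_e F) n j)).
apply: spanD; last by apply: span_mem.
by apply: (span_widen (ltnW ltj)); apply: IH => //; lia.
Qed.

(** The Pieri rules express the products triangularly through Schur functions;
    this is the inverse triangular expansion. *)
Lemma schur_flag n i : (i < flag_size n)%N ->
  span (flag (sf_e F) n) i (schur F (flag_part n i) - flag (sf_e F) n i).
Proof.
move=> ltN; rewrite /flag_part; case: ltnP => [|lei]; first exact: schur_twocol_flag.
move: ltN; rewrite /flag_size; set j := (i - n./2.+1)%N => ltN.
have lt2 : (j.+1.*2 < n)%N by lia.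
have := e1_mul_schur natF_neq0 (ltn0Sn j) lt2.
have -> : (n.-1 - j.+1.*2)%N = (n - 3 - j.*2)%N by lia.
set s3 := schur F (part321 _ _); set s2 := schur F (twocol _ _) => sp3.
have {}sp3 : span (flag (sf_e F) n) i (sf_e F 1 * s2 - s3).
  apply: span_sub sp3 => k ltk; apply: (span_widen lei).
  rewrite -[schur _ _](subrK (flag (sf_e F) n k)).
  apply: spanD; last by apply: span_mem.
  by apply: (span_widen (ltnW ltk)); apply: schur_twocol_flag.
have sp2 : span (flag (sf_e F) n) i (sf_e F 1 * (s2 - flag (sf_e F) n.-1 j.+1)).
  have lt1 : (j.+1 < n.-1./2.+1)%N by lia.
  have := span_mul (sf_e F 1) (schur_twocol_flag lt1).
  apply: span_sub => k ltk; rewrite /flag; case: ltnP => [_|]; last by lia.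
  apply: flag_triple; [exact: weighted0 (weighted_e F)|lia|lia|lia].
have -> : flag (sf_e F) n i = sf_e F 1 * flag (sf_e F) n.-1 j.+1.
  rewrite /flag; case: ltnP => [|_]; first by lia.
  case: ltnP => [_|]; last by lia.
  by rewrite -/j; have -> : (n.-1 - j.+1)%N = (n - 2 - j)%N by lia.
rewrite mulrBr in sp2; have := spanB sp2 sp3.
by rewrite opprB addrC addrA subrK.
Qed.

Lemma schur_flag_mem n i N : (i < flag_size n)%N -> (i < N)%N ->
  span (flag (sf_e F) n) N (schur F (flag_part n i)).
Proof.
move=> ltn ltN; rewrite -[schur _ _](subrK (flag (sf_e F) n i)).
apply: spanD; last by apply: span_mem.
by apply: (span_widen (ltnW ltN)); apply: schur_flag.
Qed.

Definition lead_coef q t (l : intpart) : F :=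
  \prod_(i < size l) \prod_(j < nth 0%N l i)
    (1 - q ^+ arm l i j * t ^+ (leg l i j).+1).

Lemma integral_form_flag q t (J : intpart -> Sym) n i : integral_forms q t J ->
  (i < flag_size n)%N ->
  span (flag (sf_e F) n) i
    (J (flag_part n i) - lead_coef q t (flag_part n i) *: flag (sf_e F) n i).
Proof.
move=> [tri _] ltn; have [c ->] := tri (flag_part n i).
rewrite -/(lead_coef q t (flag_part n i)) addrAC -scalerBr; apply: spanD.
  by apply/spanZ/schur_flag.
case: finite_supportP => [_|X XP _ _]; first by rewrite big_nil; apply: span0.
rewrite big_seq; apply: span_sum => m mX; apply: spanZ.
have [j ltj ->] := flag_part_below ltn (XP m mX).
by apply: schur_flag_mem => //; exact: ltn_trans ltn.
Qed.
End Flag.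

(** * Triangular operators *)
Section Triangular.
Variables (F : fieldType) (V : lmodType F).
Implicit Types (x y : V).

Lemma span_triangular (v H : nat -> V) (c : nat -> F) N :
  (forall i, (i < N)%N -> c i != 0) ->
  (forall i, (i < N)%N -> span v i (H i - c i *: v i)) ->
  forall n x, (n <= N)%N -> span v n x -> span H n x.
Proof.
move=> c0 tri n x len; apply: span_sub => i lti.
have : (i < n)%N by []; elim/ltn_ind: i lti => i IH lti _.
have -> : v i = (c i)^-1 *: (H i - (H i - c i *: v i)).
  by rewrite opprB addrC subrK scalerA mulVf ?scale1r // c0 // (leq_trans lti).
apply/spanZ/spanB; first by apply: span_mem.
have := tri i (leq_trans lti len); apply: span_sub => j ltj.
have ltjn := ltn_trans ltj lti; exact: IH.
Qed.

Lemma triangular_span (v H : nat -> V) (c : nat -> F) N :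
  (forall i, (i < N)%N -> span v i (H i - c i *: v i)) ->
  forall n x, (n <= N)%N -> span H n x -> span v n x.
Proof.
move=> tri n x len; apply: span_sub => i lti.
rewrite -[H i](subrK (c i *: v i)); apply: spanD; last by apply/spanZ/span_mem.
by apply: (span_widen (ltnW lti)); apply: tri; exact: leq_trans len.
Qed.

Variables (L : {linear V -> V}) (v : nat -> V) (ev : nat -> F) (N : nat).
Hypothesis diag : forall i, (i < N)%N -> span v i (L (v i) - ev i *: v i).

Lemma triangular_stable n x : (n <= N)%N -> span v n x -> span v n (L x).
Proof.
move=> len /(span_map L); apply: span_sub => i lti.
rewrite -[L _](subrK (ev i *: v i)); apply: spanD; last by apply/spanZ/span_mem.
by apply: (span_widen (ltnW lti)); apply: diag; exact: leq_trans len.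
Qed.

(** Comparing L x with d x, the last term of x multiplied by ev_n - d lies in
    the span of the lower vectors; hence so does x, and one descends. *)
Lemma eigen_eq0 d n x : (n <= N)%N -> span v n x ->
  (forall i, (i < n)%N -> ev i != d) -> L x = d *: x -> x = 0.
Proof.
elim: n x => [|n IH] x len sx nd Lx; first by case: sx => c; rewrite big_ord0.
suff sx' : span v n x.
  by apply: (IH x) => // [|i lti]; [exact: ltnW | apply: nd; exact: ltnW].
have [c xE] := sx; rewrite big_ord_recr /= in xE.
set y := \sum_(i < n) _ in xE; have sy : span v n y by exists c.
have d0 : ev n - d != 0 by rewrite subr_eq0 nd.
suff sv : span v n ((ev n - d) *: (c n *: v n)).
  rewrite xE; apply: spanD => //.
  by rewrite -[c n *: v n]scale1r -(mulVf d0) -scalerA; exact: spanZ.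
have s1 : span v n (c n *: (L (v n) - ev n *: v n) + (L y - d *: y)).
  apply: spanD; first by apply/spanZ/diag.
  by apply: spanB; [apply: triangular_stable => //; exact: ltnW | exact: spanZ].
have e0 : c n *: L (v n) + L y = d *: (c n *: v n) + d *: y.
  by rewrite -scalerDr addrC -linearZ -linearD [_ + y]addrC -xE.
have := spanN s1; rewrite scalerBr addrACA -opprD e0.
rewrite [c n *: _ + d *: y]addrC addrKA opprB !scalerA [c n * ev n]mulrC.
by rewrite -!scalerBl -mulrBl -scalerA.
Qed.

Variables (B : V -> V -> F) (H : nat -> V) (c : nat -> F).
Hypothesis linB : forall z a x y, B (a *: x + y) z = a * B x z + B y z.
Hypothesis symB : forall x y, B x y = B y x.
Hypothesis adjB : forall x y, B (L x) y = B x (L y).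
Hypothesis orthB : forall i j, (i < N)%N -> (j < N)%N -> i != j -> B (H i) (H j) = 0.
Hypothesis nondegB : forall x, span H N x ->
  (forall i, (i < N)%N -> B x (H i) = 0) -> x = 0.
Hypothesis c_neq0 : forall i, (i < N)%N -> c i != 0.
Hypothesis triH : forall i, (i < N)%N -> span v i (H i - c i *: v i).

Lemma form_span n x z : span H n x -> (forall i, (i < n)%N -> B (H i) z = 0) ->
  B x z = 0.
Proof.
move=> [d ->] Bz; elim/big_rec: _ => [|i y _ By]; last by rewrite linB By Bz // mulr0 add0r.
have := linB z 1 0 0; rewrite scale1r addr0 mul1r => /eqP.
by rewrite -{1}[B 0 z]addr0 (inj_eq (addrI _)) eq_sym => /eqP.
Qed.

(** L (H_i) - ev_i H_i is a combination of the H_j with j < i. It is orthogonal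
    to these by self-adjointness, and to the other H_j because they are
    orthogonal to these; so it vanishes by nondegeneracy. *)
Lemma triangular_eigen i : (i < N)%N -> L (H i) = ev i *: H i.
Proof.
move=> lti; apply/eqP; rewrite -subr_eq0; apply/eqP.
set R := _ - _; have sR : span H i R.
  apply: (span_triangular c_neq0 triH) (ltnW lti) _.
  have sw := triH lti; set w := H i - _ in sw.
  have -> : R = c i *: (L (v i) - ev i *: v i) + (L w - ev i *: w).
    have key (w0 : V) : L (w0 + c i *: v i) - ev i *: (w0 + c i *: v i) =
        c i *: (L (v i) - ev i *: v i) + (L w0 - ev i *: w0).
      rewrite linearD linearZ /= scalerDr opprD addrACA addrC; congr (_ + _).
      by rewrite scalerBr !scalerA mulrC.
    by rewrite -key subrK.
  apply: spanD; first by apply/spanZ/diag.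
  by apply: spanB; [apply: triangular_stable => //; exact: ltnW | exact: spanZ].
apply: nondegB => [|j ltj]; first exact: span_widen (ltnW lti) sR.
have [leij|ltji] := leqP i j.
  apply: form_span sR _ => k ltk; apply: orthB => //; first exact: ltn_trans lti.
  by rewrite neq_ltn (leq_trans ltk).
have BN x z : B (- x) z = - B x z.
  have B0 : B 0 z = 0 by apply: (@form_span 0 0 z); [exact: span0|].
  by rewrite -[- x]addr0 -scaleN1r linB B0 addr0 mulN1r.
have BD x y z : B (x + y) z = B x z + B y z by rewrite -[x]scale1r linB mul1r scale1r.
have BZ a x z : B (a *: x) z = a * B x z.
  have B0 : B 0 z = 0 by apply: (@form_span 0 0 z); [exact: span0|].
  by rewrite -[_ *: _]addr0 linB B0 addr0.
rewrite /R BD BN BZ (orthB lti ltj) ?mulr0 ?subr0; last by rewrite neq_ltn ltji orbT.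
rewrite adjB symB; apply: (@form_span j.+1).
  apply: (span_triangular c_neq0 triH) (ltj) _.
  apply: triangular_stable => //; apply: (triangular_span triH) => //.
  exact: span_mem.
move=> k; rewrite ltnS => lek; apply: orthB => //; first exact: leq_ltn_trans ltj.
by rewrite neq_ltn (leq_ltn_trans lek).
Qed.
End Triangular.

(** * The operators on the flags *)

Lemma scaled_eq_comb (F : fieldType) (V : lmodType F) (s c d : F) (a a' m m' k k' : V) :
  s *: a = m + d *: k -> s *: a' = m' + d *: k' ->
  s *: (c *: a + a') = c *: m + m' + d *: (c *: k + k').
Proof.
move=> e e'; rewrite scalerDr scalerA mulrC -scalerA e e' !scalerDr addrACA.
by rewrite !scalerA [c * d]mulrC.
Qed.

Section Conclusion.
Variable F : fieldType.
Hypothesis natF_neq0 : forall n, n.+1%:R != 0 :> F.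
Variables q t : F.
Hypothesis t_neq0 : t != 0.
Hypothesis qt_nroot : forall a l, 1 - q ^+ a * t ^+ l.+1 != 0.
Hypothesis q_nroot : forall k, 1 - q ^+ k.+1 != 0.
Local Notation Sym := (symfun F).
Local Notation E := (plE t).
Implicit Types (f g x : Sym).

Lemma t_nroot k : 1 - t ^+ k.+1 != 0.
Proof. by have := qt_nroot 0 k; rewrite expr0 mul1r. Qed.

Definition flag_ev n i : F :=
  if (i < n./2.+1)%N then mac_ev q t (n - i) i
  else mac_ev3 q t (n - 2 - (i - n./2.+1)) (i - n./2.+1).+1.

Lemma flag_pair_lt (c : nat -> Sym) n k l N : (k + l)%N = n -> (l <= k)%N ->
  (l < N)%N -> span (flag c n) N (c k * c l).
Proof.
move=> kl lelk ltl; have ltl' : (l < n./2.+1)%N by lia.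
have := span_mem (flag c n) ltl; rewrite {2}/flag ltl'.
by have -> : (n - l)%N = k by lia.
Qed.

Lemma mac_flag n i : (i < flag_size n)%N ->
  span (flag E n) i (mac q t (flag E n i) - flag_ev n i *: flag E n i).
Proof.
rewrite /flag_size => ltN; rewrite {2 3}/flag /flag_ev; case: ltnP => lei.
  rewrite (mac_pair natF_neq0 q t_neq0 t_nroot) addrC addKr.
  by apply: span_sum => s _; apply/spanZ/flag_pair_lt; have := ltn_ord s; lia.
set j := (i - n./2.+1)%N.
rewrite (mac_triple natF_neq0 q t_neq0 t_nroot) addrC -addrA addKr.
have sp k l : (k + l)%N = n -> span (flag E n) i (E k * E l).
  by move=> kl; apply: (span_widen lei); apply: flag_pair.
apply: spanD.
  apply: span_sum => s _; apply/spanZ/flag_triple; first exact: plE0.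
  - by have := ltn_ord s; lia.
  - by have := ltn_ord s; lia.
  - by have := ltn_ord s; lia.
apply/spanZ/spanD; first by apply/spanZ/spanD; apply/spanZ/sp; lia.
by apply/spanZ/span_sum => s _; apply/spanZ/sp; have := ltn_ord s; lia.
Qed.

Lemma commutation_flag n x : span (flag E n) n./2.+1 x ->
  t *: mac q t (H3op q t x) =
  H3op q t (mac q t x) + (q ^+ 3 * (t - 1)) *: H3op q t x.
Proof.
have KP a (u v : Sym) : H3op q t (a *: u + v) = a *: H3op q t u + H3op q t v.
  exact: linearP.
have MP a (u v : Sym) : mac q t (a *: u + v) = a *: mac q t u + mac q t v.
  exact: linearP.
have K0 : H3op q t 0 = 0 by exact: linear0.
have M0 : mac q t 0 = 0 by exact: linear0.
move=> [c ->]; elim/big_rec: _ => [|i y _ IH].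
  by rewrite !(K0, M0) !scaler0 addr0.
move: y IH => /= y IH; rewrite /flag ltn_ord.
have cz := commutation natF_neq0 q t_neq0 t_nroot (n - i) i.
rewrite (MP (c i) _ y) !KP MP; exact: scaled_eq_comb cz IH.
Qed.

(** In the sum of [H3op_pair] the product E_1 E_(k+1) E_(l+1) occurs only in
    the term s = 0; all other products come earlier in the flag. *)
Lemma H3op_lead k l : (l <= k)%N -> let n := (k + l + 3)%N in
  span (flag E n) (n./2.+1 + l)
    (H3op q t (E k * E l) - H3op_coef q t k.+1 l *: (E 1 * (E k.+1 * E l.+1))).
Proof.
move=> lelk n; rewrite (H3op_pair natF_neq0 q t_neq0 t_nroot) big_ord_recl.
have sp i j : (i + j)%N = n -> span (flag E n) (n./2.+1 + l) (E i * E j).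
  move=> ij; apply: (span_widen (N := n./2.+1)); first exact: leq_addr.
  exact: flag_pair.
have sp3 i j : (i + j).+1 = n -> (j <= i)%N -> (j <= l)%N ->
    span (flag E n) (n./2.+1 + l) (E 1 * (E i * E j)).
  by move=> ij leji lejl; apply: flag_triple => //; [exact: plE0|lia].
rewrite addn0 subn0 addrAC; apply: spanD; last first.
  apply: span_sum => s _; rewrite /= /bump /= /H3op_num; have := ltn_ord s => lts.
  apply: spanB; first apply: spanD; first apply: spanB; apply: spanZ.
  - by apply: sp3; rewrite /n; lia.
  - by apply: sp3; rewrite /n; lia.
  - by apply: sp; rewrite /n; lia.
  - by apply: sp; rewrite /n; lia.
rewrite /H3op_num; set a := _ *: (E 1 * (E k.+1 * E l.+1)).
rewrite -!addrA addrC -!addrA addNr addr0.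
apply: spanD; first by apply/spanN/spanZ/sp3; rewrite /n; lia.
apply: spanD; first by apply/spanZ/sp; rewrite /n; lia.
by apply/spanN/spanZ/sp; rewrite /n; lia.
Qed.

Lemma sf_p_homog k : sf_homog k.+1 (sf_p F k.+1).
Proof.
move=> n; apply: rpred_sum => i _.
by rewrite mpolyXn dhomogX /= mdegMn mdeg1 mul1n.
Qed.

Lemma weighted_homog w (c : nat -> Sym) : weighted w c -> forall n, sf_homog n (c n).
Proof.
move=> nc; elim/ltn_ind => -[|n] IH; first by rewrite (weighted0 nc); exact: sf_homog1.
rewrite (weightedS_div natF_neq0 n nc); apply/sf_homogZ/sf_homog_sum => i.
have e : (i.+1 + (n - i))%N = n.+1 by have := ltn_ord i; lia.
have hp : sf_homog i.+1 (w i.+1 *: sf_p F i.+1) by apply/sf_homogZ/sf_p_homog.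
by have := sf_homogM hp (IH (n - i)%N _); rewrite e; apply; lia.
Qed.

Lemma flag_homog n i : (i < n./2.+1)%N -> sf_homog n (flag E n i).
Proof.
move=> lti; rewrite /flag lti; have hE := weighted_homog (weightedE natF_neq0 t).
have e : n = (n - i + i)%N by lia.
by rewrite {1}e; apply: sf_homogM.
Qed.

Lemma span_flag_homog n x : span (flag E n) n./2.+1 x -> sf_homog n x.
Proof.
move=> [c ->]; apply: sf_homog_sum => i; apply/sf_homogZ/flag_homog.
exact: ltn_ord.
Qed.

Lemma H3qt_factor f : H3qt q t f =
  (1 - q) *: (Hop t 3 f - q ^+ 2 *: Hbar t 3 f)
  + q *: (sf_e F 1 * (Hop t 2 f + q *: Hbar t 2 f)).
Proof. by rewrite /H3qt; have [io eio] := scale_io Sym; rewrite !eio; ring. Qed.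

Lemma H3qtE n f : sf_homog n f -> H3qt q t f = H3op q t f.
Proof.
move=> hf; rewrite H3qt_factor !(HopE natF_neq0).
by rewrite !(HbarE natF_neq0 _ t_neq0 hf).
Qed.
End Conclusion.

(** * Macdonald functions as eigenvectors *)

Section Macdonald.
Variable F : fieldType.
Hypothesis natF_neq0 : forall n, n.+1%:R != 0 :> F.
Variables q t : F.
Hypothesis t_neq0 : t != 0.
Hypothesis qt_nroot : forall a l, 1 - q ^+ a * t ^+ l.+1 != 0.
Hypothesis q_nroot : forall k, 1 - q ^+ k.+1 != 0.
Local Notation Sym := (symfun F).
Local Notation E := (plE t).
Local Notation t_nroot := (t_nroot qt_nroot).
Implicit Types (f g x : Sym).

(** The plethysm that takes J_m to H_m. *)
Local Notation pl := (rescale (fun k => (1 - t ^+ k)^-1) : Sym -> Sym).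
Local Notation form x y := (sprod x (rescale (psi_weight q t) y)).

Lemma pl_flag n i : pl (flag (sf_e F) n i) = flag E n i.
Proof. by rewrite /flag; case: ifP => _; rewrite !rmorphM. Qed.

(** The plethysm is self-adjoint, and the product of its weights, twice, with
    the weights psi is (1 - q^k)/(1 - t^k). *)
Lemma form_pl f g : form (pl f) (pl g) = scal_qt q t f g.
Proof.
rewrite /scal_qt (diag_form_psum natF_neq0 (fun k => (1 - q ^+ k) / (1 - t ^+ k))).
apply: etrans (sprod_rescale natF_neq0 _ _ _) _; congr (sprod f _).
apply: etrans (rescale_comp natF_neq0 _ _ _) _.
apply: etrans (rescale_comp natF_neq0 _ _ _) _.
apply: eq_rescale => // k; rewrite /psi_weight; have := t_nroot k.
by move=> nz; field.
Qed.

Variable J : intpart -> Sym.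
Hypothesis J_forms : integral_forms q t J.

Lemma macdonald_HE m : macdonald_H t J m = pl (J m).
Proof.
rewrite -[RHS](schur_expand natF_neq0); apply: eq_fsbigr => l _.
rewrite /macdonald_K /scal_t (diag_form_psum natF_neq0 (fun k => (1 - t ^+ k)^-1)).
by rewrite (sprod_rescale natF_neq0).
Qed.

Lemma lead_coef_neq0 (l : intpart) : lead_coef q t l != 0.
Proof. by apply/prodf_neq0 => i _; apply/prodf_neq0 => j _. Qed.

(** By dominance induction the J_m span, and the weights of the form are
    invertible. *)
Lemma form_nondeg x : (forall m, form x (pl (J m)) = 0) -> x = 0.
Proof.
move=> xJ; pose P g := form x (pl g) = 0.
have PD f g : P f -> P g -> P (f + g).
  by rewrite /P => Pf Pg; rewrite !raddfD /= (sprodDr natF_neq0) Pf Pg addr0.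
have PZ c f : P f -> P (c *: f).
  by rewrite /P => Pf; rewrite !linearZ /= (sprodZr natF_neq0) Pf mulr0.
have PN f : P f -> P (- f) by rewrite -scaleN1r; apply: PZ.
have P0 : P 0 by have := PZ 0 _ (xJ (part21 0 0)); rewrite scale0r.
have Pschur : forall l, P (schur F l).
  apply: dominance_ind => l IH; have [c JE] := J_forms.1 l.
  have -> : schur F l = (lead_coef q t l)^-1 *:
      (J l - \sum_(m \in [set m | dominance_lt m l]%classic) c m *: schur F m).
    by rewrite JE addrK scalerA mulVf ?scale1r // lead_coef_neq0.
  apply/PZ/PD; [exact: xJ|apply: PN].
  case: finite_supportP => [_|X XP _ _]; first by rewrite big_nil.
  rewrite big_seq; elim/big_rec: _ => [//|m y mX Py].
  by apply: PD => //; apply/PZ/IH/XP.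
have Pall g : P g by elim/(symfun_ind_schur natF_neq0): g.
apply: (sprod_nondeg natF_neq0) => f; rewrite sprodC.
have := Pall (rescale (fun k => (1 - q ^+ k)^-1) f).
rewrite /P !(rescale_comp natF_neq0).
rewrite (_ : rescale _ f = f) //.
rewrite (eq_rescale natF_neq0 (v := fun=> 1)) => [|k]; last first.
  by rewrite /psi_weight; have := t_nroot k; have := q_nroot k => nq nt; field; rewrite nq nt.
have id1 : rescale (fun=> 1) f = f.
  elim/(symfun_ind natF_neq0): f => [|f g IHf IHg|c f IHf|k f IHf].
  - by rewrite rmorph1.
  - by rewrite rmorphD /= IHf IHg.
  - by rewrite linearZ /= IHf.
  - by rewrite rmorphM /= IHf (rescale_p natF_neq0) scale1r.
exact: id1.
Qed.

Lemma macdonald_flag n i : (i < flag_size n)%N ->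
  span (flag E n) i (pl (J (flag_part n i))
                     - lead_coef q t (flag_part n i) *: flag E n i).
Proof.
move=> lti; have := span_map (rescale (fun k => (1 - t ^+ k)^-1))
  (integral_form_flag natF_neq0 J_forms lti).
rewrite linearB linearZ /= pl_flag.
by apply: eq_span => j _; exact: pl_flag.
Qed.

Lemma mac_macdonald n i : (i < flag_size n)%N ->
  mac q t (pl (J (flag_part n i))) = flag_ev q t n i *: pl (J (flag_part n i)).
Proof.
move=> lti; pose N := flag_size n.
apply: (@triangular_eigen F _ (mac q t) (flag E n) (flag_ev q t n) N _
  (fun x y => form x y) (fun i => pl (J (flag_part n i)))
  (fun i => lead_coef q t (flag_part n i))) => //.
- by move=> j ltj; exact: mac_flag.
- by move=> z a x y; rewrite (sprodDl natF_neq0) (sprodZl natF_neq0).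
- by move=> x y; rewrite sprodC (sprod_rescale natF_neq0).
- by move=> x y; exact: mac_selfadjoint.
- move=> j k ltj ltk njk; rewrite form_pl; apply: J_forms.2 => eqjk.
  by case/eqP: njk; exact: flag_part_inj eqjk.
- move=> x [d ->] x0; apply: form_nondeg => m.
  have [/existsP[j /eqP <-]|/existsPn nm] := boolP [exists j : 'I_N, flag_part n j == m].
    exact: x0.
  rewrite (sprod_suml natF_neq0) big1 // => j _; rewrite (sprodZl natF_neq0) form_pl.
  rewrite J_forms.2 ?mulr0 // => eqj; have := nm j; rewrite eqj eqxx //.
- by move=> j _; exact: lead_coef_neq0.
- by move=> j ltj; exact: macdonald_flag.
Qed.

(** Removing the first row leaves the arms and legs of the other cells
    unchanged, so only the three cells of the first row contribute. *)
Lemma lead_coef321 a b : lead_coef q t (part321 a b) =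
  H3op_coef q t (a + b).+1 a * lead_coef q t (part21 a b).
Proof.
rewrite /lead_coef [size _]/= big_ord_recl; congr (_ * _).
pose s := (nseq a 2 ++ nseq b 1)%N.
have cnt j : count (fun r => j < r)%N s = ((j < 2) * a + (j < 1) * b)%N.
  by rewrite count_cat !count_nseq.
rewrite !big_ord_recl big_ord0 mulr1 /arm /leg.
transitivity ((1 - q ^+ 2 * t ^+ (count (fun r => 0 < r)%N s).+1) *
  ((1 - q ^+ 1 * t ^+ (count (fun r => 1 < r)%N s).+1) *
   (1 - q ^+ 0 * t ^+ (count (fun r => 2 < r)%N s).+1))); first by rewrite /= !drop0.
rewrite !cnt !ltnn /= !mul1n !mul0n !addn0 expr0 expr1 mul1r /H3op_coef; ring.
Qed.

Hypothesis ev_neq : forall k l, (l <= k)%N ->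
  (forall k' l', (k' + l')%N = (k + l).+1 -> (l' <= k')%N ->
     mac_ev q t k' l' != mac_ev3 q t k l) /\
  (forall k' l', (k' + l')%N = (k + l)%N -> (l' < l)%N ->
     mac_ev3 q t k' l' != mac_ev3 q t k l).

(** Both sides are eigenvectors of D for the eigenvalue of E_1 E_(a+b+1)
    E_(a+1), and their leading coefficients agree; their difference lies lower in
    the flag. *)
Theorem H3qt_macdonald a b :
  H3qt q t (macdonald_H t J (part21 a b)) = macdonald_H t J (part321 a b).
Proof.
(* The degrees of the two sides and the index of (3 2^a 1^b) in the flag; n is
   written as in the lemma on leading terms, with k = a + b and l = a. *)
pose m := (a.*2 + b)%N; pose n := ((a + b) + a + 3)%N.
pose i := (n./2.+1 + a)%N.
have lta : (a < m./2.+1)%N by rewrite /m; lia.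
have ltm : (a < flag_size m)%N by rewrite /flag_size /m; lia.
have lti : (i < flag_size n)%N by rewrite /flag_size /i /n; lia.
have ni : (n./2.+1 <= i)%N by rewrite leq_addr.
have iE : (i - n./2.+1)%N = a by rewrite addKn.
have p21 : part21 a b = flag_part m a.
  by rewrite /flag_part lta /twocol; congr part21; rewrite /m; lia.
have p321 : part321 a b = flag_part n i.
  rewrite /flag_part ltnNge ni /= iE; congr part321; rewrite /n; lia.
have fm : flag E m a = E (a + b)%N * E a.
  by rewrite /flag lta; congr (E _ * E _); rewrite /m; lia.
have fn : flag E n i = E 1 * (E (a + b).+1 * E a.+1).
  by rewrite /flag ltnNge ni /= iE; congr (_ * (E _ * _)); rewrite /n; lia.
rewrite !macdonald_HE; set x := pl (J (part21 a b)); set y := pl (J (part321 a b)).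
have sx : span (flag E m) a (x - lead_coef q t (part21 a b) *: (E (a + b)%N * E a)).
  by rewrite -fm /x p21; exact: macdonald_flag.
have sx' : span (flag E m) m./2.+1 x.
  rewrite -[x](subrK (lead_coef q t (part21 a b) *: (E (a + b)%N * E a))).
  apply: spanD; first by apply: (span_widen (ltnW lta)).
  by rewrite -fm; apply/spanZ/span_mem.
rewrite (H3qtE natF_neq0 q t_neq0 (span_flag_homog natF_neq0 t_neq0 sx')).
have sG : span (flag E n) i (H3op q t x - lead_coef q t (part321 a b) *: flag E n i).
  have s1 : span (flag E n) i
      (H3op q t (x - lead_coef q t (part21 a b) *: (E (a + b)%N * E a))).
    have := span_map (H3op q t) sx; apply: span_sub => j ltj.
    suff : span (flag E n) i (H3op q t (flag E m j)) by [].
    have -> : flag E m j = E (m - j)%N * E j by rewrite /flag (ltn_trans ltj lta).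
    have lej : (j <= m - j)%N by rewrite /m; lia.
    have := H3op_lead natF_neq0 (q := q) t_neq0 qt_nroot lej.
    have -> : (m - j + j + 3)%N = n by rewrite /m /n; lia.
    move=> /= sl; rewrite -[H3op q t _](subrK (H3op_coef q t (m - j).+1 j *:
      (E 1 * (E (m - j).+1 * E j.+1)))).
    apply: spanD; first by apply: span_widen sl; rewrite /i; lia.
    by apply/spanZ/flag_triple; [exact: plE0|rewrite /m /n; lia|rewrite /m; lia|rewrite /i; lia].
  have leab : (a <= a + b)%N by exact: leq_addr.
  have := spanZ (lead_coef q t (part21 a b))
    (H3op_lead natF_neq0 t_neq0 qt_nroot leab); rewrite -/n -/i => s2.
  have := spanD s1 s2; rewrite linearB linearZ /= scalerBr addrA subrK.
  by rewrite scalerA mulrC -lead_coef321 fn.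
have sy : span (flag E n) i (y - lead_coef q t (part321 a b) *: flag E n i).
  by rewrite /y p321; exact: macdonald_flag.
apply/eqP; rewrite -subr_eq0; apply/eqP.
pose d := mac_ev3 q t (a + b).+1 a.+1.
apply: (@eigen_eq0 F _ (mac q t) (flag E n) (flag_ev q t n) (flag_size n) _ d i).
- by move=> j ltj; exact: mac_flag.
- exact: ltnW.
- by have := spanB sG sy; rewrite opprB addrA subrK.
- move=> j ltj; rewrite /flag_ev /d; have [] := ev_neq (_ : a.+1 <= (a + b).+1)%N.
    by rewrite ltnS leq_addr.
  case: ltnP => [ltj'|lej'] h1 h2; first by apply: h1; rewrite /n; lia.
  by apply: h2; move: ltj; rewrite /i /n; lia.
have evy : mac q t y = d *: y.
  rewrite /y p321 mac_macdonald // /flag_ev ltnNge ni /= iE /d; congr (mac_ev3 _ _ _ _ *: _).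
  by rewrite /n; lia.
have evx : mac q t x = mac_ev q t (a + b) a *: x.
  rewrite /x p21 mac_macdonald // /flag_ev lta; congr (mac_ev _ _ _ _ *: _).
  by rewrite /m; lia.
have := commutation_flag natF_neq0 t_neq0 qt_nroot sx'.
have KZ c (u : Sym) : H3op q t (c *: u) = c *: H3op q t u by exact: linearZ.
rewrite evx KZ -scalerDl => eqG.
have MB (u v : Sym) : mac q t (u - v) = mac q t u - mac q t v by exact: linearB.
apply: etrans (MB _ _) _; rewrite evy scalerBr; congr (_ - _).
apply: (scalerI t_neq0); rewrite eqG scalerA; congr (_ *: _).
rewrite /d /mac_ev /mac_ev3 !exprS.
by field.
Qed.
End Macdonald.

Import Order.TTheory Num.Theory.

(** * The field of rational functions *)

(** The polynomial t^M (ev(k', l') - ev3(k, l)), M being large enough to clear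
    the negative powers of t. *)
Definition ev_diff (A : comNzRingType) M k l k' l' (q t : A) : A :=
  q ^+ 2 * t ^+ M - q ^+ 3 * t ^+ M +
  (1 - q) * (t ^+ (M - k') + q * t ^+ (M - l')
             - (t ^+ (M - k) + q * t ^+ (M - l) + q ^+ 2 * t ^+ (M - 1))).

Lemma rmorph_ev_diff (A B : comNzRingType) (phi : {rmorphism A -> B}) M k l k' l' q t :
  phi (ev_diff M k l k' l' q t) = ev_diff M k l k' l' (phi q) (phi t).
Proof. by rewrite /ev_diff !(rmorphB, rmorphD, rmorphM, rmorphXn, rmorph1). Qed.

Section RationalFunctions.
Local Notation Poly := {mpoly rat[2]}.
Local Notation q := Qqt_q.
Local Notation t := Qqt_t.
Local Notation Q := ('X_(inord 0) : Poly).
Local Notation T := ('X_(inord 1) : Poly).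

Definition point (x y : rat) (i : 'I_2) : rat := if i == inord 0 then x else y.

Lemma pointQ x y : Q.@[point x y] = x.
Proof. by rewrite mevalXU /point eqxx. Qed.
Lemma pointT x y : T.@[point x y] = y.
Proof.
rewrite mevalXU /point; case: eqP => // /(congr1 (@nat_of_ord 2)).
by rewrite !inordK.
Qed.

(** Nonvanishing in the field of rational functions is tested by
    specialization. *)
Lemma neq0_point (p : Poly) (f : Qqt) x y : f = FracField.tofrac p ->
  p.@[point x y] != 0 -> f != 0.
Proof.
move=> ->; apply: contraNneq => /eqP; rewrite tofrac_eq0 => /eqP ->.
by rewrite meval0.
Qed.

Lemma natQqt_neq0 n : n.+1%:R != 0 :> Qqt.
Proof.
apply: (@neq0_point n.+1%:R _ 0 0); first by rewrite rmorph_nat.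
by rewrite rmorph_nat pnatr_eq0.
Qed.

Lemma Qqt_t_neq0 : t != 0.
Proof. by apply: (@neq0_point T _ 0 1); rewrite // pointT oner_eq0. Qed.

Lemma pow2_neq a b : a <> b -> 2%:R ^+ a != 2%:R ^+ b :> rat.
Proof.
move=> nab; apply/eqP => eqp; apply: nab; move: eqp.
by apply: ieexprIn.
Qed.

Lemma Qqt_nroot a l : 1 - q ^+ a * t ^+ l.+1 != 0.
Proof.
apply: (@neq0_point (1 - Q ^+ a * T ^+ l.+1) _ 1 2%:R).
  by rewrite rmorphB rmorphM !rmorphXn rmorph1.
rewrite mevalB mevalM !rmorphXn /= pointQ pointT meval1 expr1n mul1r subr_eq0.
exact: (@pow2_neq 0 l.+1).
Qed.

Lemma Qqt_q_nroot k : 1 - q ^+ k.+1 != 0.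
Proof.
apply: (@neq0_point (1 - Q ^+ k.+1) _ 2%:R 0).
  by rewrite rmorphB rmorphXn rmorph1.
rewrite mevalB rmorphXn /= pointQ meval1 subr_eq0.
exact: (@pow2_neq 0 k.+1).
Qed.

Lemma pow_shift M k : (k <= M)%N -> t ^+ M * t^-1 ^+ k = t ^+ (M - k).
Proof.
move=> le; rewrite -{1}(subnK le) exprD -mulrA -exprMn divff ?expr1n ?mulr1 //.
exact: Qqt_t_neq0.
Qed.

(** At q = 0 the eigenvalues differ by t^-k' - t^-k up to a unit. *)
Lemma mac_ev3_neq k l k' l' : (k' + l')%N = (k + l)%N -> (l' < l)%N ->
  mac_ev3 q t k' l' != mac_ev3 q t k l.
Proof.
move=> kl ltl; pose M := (k + l + k' + l')%N.
have key : t ^+ M * (mac_ev3 q t k' l' - mac_ev3 q t k l) =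
    (1 - q) * (t ^+ (M - k') + q * t ^+ (M - l') - (t ^+ (M - k) + q * t ^+ (M - l))).
  by rewrite -!pow_shift /mac_ev3; [ring|rewrite /M; lia ..].
rewrite -subr_eq0; suff : t ^+ M * (mac_ev3 q t k' l' - mac_ev3 q t k l) != 0.
  by apply: contraNneq => ->; rewrite mulr0.
rewrite key; apply: (@neq0_point ((1 - Q) *
  (T ^+ (M - k') + Q * T ^+ (M - l') - (T ^+ (M - k) + Q * T ^+ (M - l)))) _ 0 2%:R).
  by rewrite !(tofracB, tofracD, tofracM, tofracXn, tofrac1).
rewrite !(mevalB, mevalD, mevalM, rmorphXn, meval1) /= pointQ pointT.
rewrite !mul0r !addr0 ?subr0 mul1r subr_eq0; apply: pow2_neq; rewrite /M; lia.
Qed.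

(** The powers t^-k and t^-k' separate the eigenvalues at q = 0, unless k = k';
    then l' = l + 1, and the difference is nonzero at q = 3, t = 2. *)
Lemma mac_ev_neq k l k' l' : (k' + l')%N = (k + l).+1 -> (l <= k)%N -> (l' <= k')%N ->
  mac_ev q t k' l' != mac_ev3 q t k l.
Proof.
move=> kl lelk lelk'; pose M := (k + l + k' + l').+1.
have key : t ^+ M * (mac_ev q t k' l' - mac_ev3 q t k l) = ev_diff M k l k' l' q t.
  have -> : mac_ev q t k' l' - mac_ev3 q t k l = q ^+ 2 - q ^+ 3 + (1 - q) *
     (t^-1 ^+ k' + q * t^-1 ^+ l' - (t^-1 ^+ k + q * t^-1 ^+ l + q ^+ 2 * t^-1 ^+ 1)).
    by rewrite /mac_ev /mac_ev3; ring.
  by rewrite /ev_diff -!pow_shift; [ring|rewrite /M; lia ..].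
rewrite -subr_eq0; suff : t ^+ M * (mac_ev q t k' l' - mac_ev3 q t k l) != 0.
  by apply: contraNneq => ->; rewrite mulr0.
have ev x y : ev_diff M k l k' l' x y != 0 :> rat -> ev_diff M k l k' l' q t != 0.
  move=> nz; apply: (@neq0_point (ev_diff M k l k' l' Q T) _ x y).
    by rewrite [RHS](rmorph_ev_diff (@FracField.tofrac Poly)).
  by rewrite [X in X != 0](rmorph_ev_diff (meval (point x y))) /= pointQ pointT.
rewrite key; have [ekk|nkk] := eqVneq k k'.
  have el : l' = l.+1 by lia.
  apply: (ev 3%:R 2%:R); rewrite /ev_diff.
  have [P [e1 e2 e3 e4]] : exists P, [/\ (M - l' = P)%N, (M - l = P.+1)%N,
      (M - 1 = P + l)%N & M = (P + l).+1].
    by exists (M - l')%N; rewrite el /M; split=> //; lia.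
  rewrite -ekk e1 e2 e3; set z := 2%:R ^+ (_ - k); rewrite e4 !exprS !exprD.
  set u := 2%:R ^+ P; set w := 2%:R ^+ l.
  rewrite [X in X != 0](_ : _ = 6%:R * u * (1 - 3%:R * w)); last by ring.
  have u0 : u != 0 by rewrite expf_neq0.
  have w1 : 1 <= w by apply: exprn_ege1.
  rewrite mulf_neq0 ?mulf_neq0 // subr_eq0 lt_eqF //; lra.
have nz : 2%:R ^+ (M - k') - 2%:R ^+ (M - k) != 0 :> rat.
  by rewrite subr_eq0; apply: pow2_neq; rewrite /M; lia.
apply: (ev 0 2%:R); rewrite /ev_diff.
by rewrite !expr0n /= !(mul0r, subr0, addr0, add0r, mul1r).
Qed.
End RationalFunctions.

(** * The theorem *)

Theorem theorem1p3 :
  let q := Qqt_q in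
  let t := Qqt_t in
  (forall f : symfun Qqt,
     H3qt q t f = (1 - q) *: (Hop t 3 f - q ^+ 2 *: Hbar t 3 f)
                  + q *: (sf_e Qqt 1 * (Hop t 2 f + q *: Hbar t 2 f))) /\
  (forall J : intpart -> symfun Qqt, integral_forms q t J ->
     forall a b : nat,
       H3qt q t (macdonald_H t J (part21 a b)) = macdonald_H t J (part321 a b)).
Proof.
split=> [f|J J_forms a b]; first exact: H3qt_factor.
apply: (H3qt_macdonald natQqt_neq0 Qqt_t_neq0 Qqt_nroot Qqt_q_nroot J_forms).
move=> k l lelk; split=> k' l' e lel; first exact: mac_ev_neq.
exact: mac_ev3_neq.
Qed.
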